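(* Let $K_0$ be a $p$-adic field and let $f(x)=(f_1(x),\dots,f_r(x))$ be a tuple of polynomials in $m$ variables $x=(x_1,\dots,x_m)$ with coefficients in $\mathcal{O}_{K_0}$. For every finite field extension $K$ of $K_0$, write $-\lambda_K(f)$ (resp. $-\tilde{\lambda}_K(f)$) for the largest real part over all poles in $s$ of $P_{f,K}(q_K^{-s})$ (resp. $\tilde{P}_{f,K}(q_K^{-s})$), with the convention $\lambda_K(f)=+\infty$ (resp. $\tilde{\lambda}_K(f)=+\infty$) if there are no poles. Then for any such $K$ and any finite field extension $L\geq K$, \[ \lambda_L(f)\leq \lambda_K(f) \quad\text{and}\quad \tilde{\lambda}_L(f)\leq \tilde{\lambda}_K(f). \]
   Context: For a non-Archimedean local field $K$ of characteristic zero (here a finite extension of $\mathbb{Q}_p$), $\mathcal{O}_K$ denotes its valuation ring, $\pi\in K$ a uniformizer, and $q_K$ the cardinality of its residue field. For $f=(f_1,\dots,f_r)$ with coefficients in $\mathcal{O}_K$ and $n\in\mathbb{N}$ define $\tilde{N}_{n,K}(f)=\#\{\xi\in(\mathcal{O}_K/(\pi^n))^m \mid f(\xi)=0\}$ and $N_{n,K}(f)=\#\{\xi\in(\mathcal{O}_K/(\pi^n))^m \mid \exists y\in\mathcal{O}_K^m\,(f(y)=0 \wedge \xi = y+(\pi^n)^m)\}$. The Poincaré series is $\tilde{P}_{f,K}(T)=\sum_{n\ge 0}\tilde{N}_{n,K}(f)\,q_K^{-nm}T^n$ and the Serre-Poincaré series is $P_{f,K}(T)=\sum_{n\ge 0}N_{n,K}(f)\,q_K^{-n(m+1)}T^n$.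 Both are rational in $T$, so $P_{f,K}(q_K^{-s})$ and $\tilde{P}_{f,K}(q_K^{-s})$ are meromorphic in $s$. *)

(* Defs.v *)
From Stdlib Require Import ClassicalEpsilon.
From HB Require Import structures.
From mathcomp Require Import all_boot all_order all_algebra.
From mathcomp Require Import all_classical all_reals.
From mathcomp Require Import ereal exp.
From mathcomp Require Import Rstruct.
From mathcomp Require Import complex.
From mathcomp Require mpoly.
Set Implicit Arguments. Unset Strict Implicit. Unset Printing Implicit Defensive.
Import Order.TTheory GRing.Theory Num.Theory.
Local Open Scope ring_scope.

Notation RR := Rdefinitions.R.
Notation CC := (complex.complex RR).

Section Valuations.
Variable K : fieldType.
Variable v : K -> int. (* normalized discrete valuation, meaningful on K^x *)

(* x lies in the ideal (pi^n) of O_K (x = 0 has valuation +oo) *)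
Definition inPn (n : nat) (x : K) : Prop := x = 0 \/ (n%:Z <= v x).
Definition intg (x : K) : Prop := inPn 0 x.

(* v is a normalized discrete valuation on K, K has characteristic 0,
   K is complete for v, and the residue field O_K/(pi) is finite.
   Such K are exactly the p-adic fields (finite extensions of Q_p). *)
Record is_padic_val : Prop := {
  pv_mul : forall x y, x != 0 -> y != 0 -> v (x * y) = v x + v y;
  pv_add : forall x y, x != 0 -> y != 0 -> x + y != 0 ->
             Num.min (v x) (v y) <= v (x + y);
  pv_unif : exists pi : K, pi != 0 /\ v pi = 1;
  pv_char0 : forall p : nat, p \in [pchar K] -> False;
  pv_complete : forall u : nat -> K,
      (forall N, exists M, forall i j, (M <= i)%N -> (M <= j)%N ->
         inPn N (u i - u j)) ->
      exists l : K, forall N, exists M, forall i, (M <= i)%N -> inPn N (u i - l);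
  pv_res_fin : exists s : seq K, (forall y, y \in s -> intg y) /\
      forall x, intg x -> exists2 y, y \in s & inPn 1 (x - y)
}.

Definition congr (m n : nat) (x y : 'I_m -> K) : Prop :=
  forall i, inPn n (x i - y i).

(* k is the number of classes xi in (O_K/(pi^n))^m whose lifts satisfy P
   (P is assumed invariant under congruence mod pi^n). *)
Definition ncls_spec (m n : nat) (P : ('I_m -> K) -> Prop) (k : nat) : Prop :=
  exists reps : 'I_k -> ('I_m -> K),
    (forall j, (forall i, intg (reps j i)) /\ P (reps j)) /\
    (forall j j', j <> j' -> ~ congr n (reps j) (reps j')) /\
    (forall x, (forall i, intg (x i)) -> P x -> exists j, congr n x (reps j)).

Definition ncls (m n : nat) (P : ('I_m -> K) -> Prop) : nat :=
  epsilon (inhabits 0%N) (ncls_spec n P).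

Definition qres : nat := ncls 1 (fun _ : 'I_1 -> K => True).

Definition Ntilde (m r : nat) (f : 'I_r -> mpoly.mpoly m K) (n : nat) : nat :=
  ncls n (fun x => forall j, inPn n (mpoly.meval x (f j))).

Definition Nserre (m r : nat) (f : 'I_r -> mpoly.mpoly m K) (n : nat) : nat :=
  ncls n (fun x => exists y : 'I_m -> K, (forall i, intg (y i)) /\
            (forall j, mpoly.meval y (f j) = 0) /\ congr n x y).

End Valuations.

Definition fin_ext (K L : fieldType) (vK : K -> int) (vL : L -> int)
    (iota : {rmorphism K -> L}) : Prop :=
  (exists bs : seq L, forall y : L,
      exists cs : 'I_(size bs) -> K, y = \sum_(i < size bs) iota (cs i) * bs`_i)
  /\ (forall x : K, intg vK x <-> intg vL (iota x)).



(* (A, B) is a reduced representation of the power series sum_n a n T^n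
   as the rational function A(T)/B(T) (complex coefficients). *)
Definition rat_rep (a : nat -> RR) (A B : {poly CC}) : Prop :=
  coprimep A B /\ B.[0] != 0 /\
  forall n : nat, \sum_(k < n.+1) B`_k * complex.Complex (a (n - k)%N) 0 = A`_n.

Definition Tpoles (a : nat -> RR) : set CC :=
  [set alpha | exists A B, rat_rep a A B /\ root B alpha].

(* lambda: minus the largest real part of the poles s of F(q^{-s}),
   where F(T) = sum_n a n T^n.  A pole s corresponds to a pole alpha of F
   with q^{-s} = alpha, and then Re s = - ln|alpha| / ln q.  Hence
   lambda = inf over poles alpha of ln|alpha| / ln q, and +oo if none. *)
Definition lambda_of (q : nat) (a : nat -> RR) : \bar RR :=
  ereal_inf [set ((ln (ComplexField.Normc.normc alpha) / ln (q%:R : RR))%:E)%E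
            | alpha in Tpoles a].

Definition lambdaP (K : fieldType) (v : K -> int) (m r : nat)
    (f : 'I_r -> mpoly.mpoly m K) : \bar RR :=
  let q := qres v in
  lambda_of q (fun n => (Nserre v f n)%:R / ((q%:R : RR) ^+ (n * m.+1))).

Definition lambdaPt (K : fieldType) (v : K -> int) (m r : nat)
    (f : 'I_r -> mpoly.mpoly m K) : \bar RR :=
  let q := qres v in
  lambda_of q (fun n => (Ntilde v f n)%:R / ((q%:R : RR) ^+ (n * m))).

(* Main.v *)
(** Up to a factor [q^-n] in the Serre case, the coefficients of both series are volumes of sets
    [X_n] cut out by valuation conditions on polynomials, with [n] as an integer parameter.

    Rationality (Denef). Quantifier elimination for p-adic fields yields towers of families of
    polynomials, each closed under derivation in its last variable, such that the classes "same
    leading terms of all the polynomials" project onto classes one level below, with balls as fibres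
    (a p-adic form of Thom's lemma). A class therefore has volume [q^-t] with [t] read off from
    valuations, and the occurring vectors of valuations form a Presburger set, so that the volumes
    sum up to a rational series.

    Comparison. Let [e] be the ramification index of [L/K]; then [X_n(K)] is contained in
    [X_en(L)]. A class of [L] of volume [q_L^-t] meets [K^m] in a set of volume at most
    [q_K^(-t/e)], and, up to a negligible part, [X_n(K)] meets polynomially many classes. So
    [vol X_n(K)^e <= C n^a q_K^-t] for some [t] with [q_L^-t <= vol X_en(L)]. If every pole over [L]
    lay further left than a given pole over [K], then the coefficients over [L], hence those over
    [K], would decay too fast for that pole. *)

From mathcomp Require Import all_boot all_order all_algebra.
From mathcomp Require Import all_classical all_reals ereal esum sequences exp Rstruct complex.
From mathcomp Require mpoly.
From mathcomp Require Import zify ring lra.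
Require Import Defs.
Import Order.TTheory GRing.Theory Num.Theory.
Local Open Scope ring_scope.
Set Implicit Arguments. Unset Strict Implicit. Unset Printing Implicit Defensive.

(* The modules below only serve to qualify constants that sections abbreviate by local notations. *)
(** * Valued fields and Hensel's lemma *)

(** Atoms are valuations and angular components modulo powers of [pi]: such leading terms survive
    small perturbations, and those of a sum with bounded cancellation are determined by those of its
    summands. Eliminating a field variable therefore needs points at which the Taylor expansions of
    a whole family cancel little. Hensel's lemma places such centres at roots of derivatives, with a
    loss bounded in terms of the degrees alone. Quantification over a root is then the remaining
    difficulty; it yields to induction on the degree, because everything can be reduced modulo the
    polynomial whose root it is.

    Towers have coefficients in [K] even when they are evaluated in [L]. At a point of [K^m] the
    valuation over [L] of a tower polynomial is thus [e] times the one over [K], so that a single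
    count over [K] bounds the set where these valuations are large, and outside it all radii are
    linear in [n]. The exponent [t] is the link between the two fields: it is read with base [q_L]
    on one side and [q_K] on the other. *)

Module Valuation.

Section ValuedField.
Variables (F : fieldType) (v : F -> int).

(** The value [v 0] carries no information, so lower bounds on valuations go through this predicate,
    where 0 has valuation infinity. The bound is an integer because scaling by powers of [pi] goes
    in both directions. *)
Definition vge (z : int) (x : F) : bool := (x == 0) || (z <= v x).

Definition intp (p : {poly F}) : Prop := forall i, vge 0 p`_i.

Hypothesis hv : is_padic_val v.

Lemma vM x y : x != 0 -> y != 0 -> v (x * y) = v x + v y.
Proof. exact: pv_mul hv x y. Qed.

Lemma v1 : v 1 = 0.
Proof. have := vM (oner_neq0 F) (oner_neq0 F); rewrite mulr1; move: (v 1) => a; lia. Qed.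

Lemma vN x : v (- x) = v x.
Proof.
have [->|x0] := eqVneq x 0; first by rewrite oppr0.
have n10 : (-1 : F) != 0 by rewrite oppr_eq0 oner_neq0.
have := vM n10 n10; rewrite mulrNN mulr1 v1 => h.
by rewrite -mulN1r vM //; lia.
Qed.

Lemma vV x : x != 0 -> v x^-1 = - v x.
Proof.
move=> x0; have := vM x0 (invr_neq0 x0).
by rewrite divff // v1; lia.
Qed.

Lemma vX x n : x != 0 -> v (x ^+ n) = v x * n%:Z.
Proof.
move=> x0; elim: n => [|n IH]; first by rewrite expr0 v1 mulr0.
by rewrite exprS vM ?expf_neq0 // IH; lia.
Qed.

Lemma vXz x (z : int) : x != 0 -> v (x ^ z) = v x * z.
Proof.
move=> x0; case: z => n; first by rewrite -exprnP vX.
by rewrite NegzE -exprnN vV ?expf_neq0 // vX //; lia.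
Qed.

Lemma vgeP z x : reflect (x = 0 \/ z <= v x) (vge z x).
Proof.
apply: (iffP orP) => -[h|h]; try by right.
- by left; apply/eqP.
- by left; apply/eqP.
Qed.

Lemma vgeE z x : x != 0 -> vge z x = (z <= v x).
Proof. by rewrite /vge => /negbTE->. Qed.

Lemma vge0 z : vge z 0.
Proof. by rewrite /vge eqxx. Qed.

Lemma vge_self x : vge (v x) x.
Proof. by rewrite /vge lexx orbT. Qed.

Lemma vge_le z z' x : z' <= z -> vge z x -> vge z' x.
Proof. by move=> zz' /vgeP[->|h]; rewrite ?vge0 // /vge (le_trans zz' h) orbT. Qed.

Lemma vgeN z x : vge z (- x) = vge z x.
Proof. by rewrite /vge oppr_eq0 vN. Qed.

Lemma vgeD z x y : vge z x -> vge z y -> vge z (x + y).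
Proof.
have [->|x0] := eqVneq x 0; first by rewrite add0r.
have [->|y0] := eqVneq y 0; first by rewrite addr0.
rewrite (vgeE _ x0) (vgeE _ y0) => hx hy.
have [->|s0] := eqVneq (x + y) 0; first exact: vge0.
rewrite vgeE //; apply: le_trans (pv_add hv x0 y0 s0).
by rewrite le_min hx hy.
Qed.

Lemma vgeB z x y : vge z x -> vge z y -> vge z (x - y).
Proof. by move=> hx hy; apply: vgeD => //; rewrite vgeN. Qed.

Lemma vgeM a b x y : vge a x -> vge b y -> vge (a + b) (x * y).
Proof.
have [->|x0] := eqVneq x 0; first by move=> _ _; rewrite mul0r vge0.
have [->|y0] := eqVneq y 0; first by move=> _ _; rewrite mulr0 vge0.
by rewrite !vgeE ?mulf_neq0 // vM // => h1 h2; apply: lerD.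
Qed.

Lemma vgeM0 z x y : vge 0 x -> vge z y -> vge z (x * y).
Proof. by move=> hx hy; have := vgeM hx hy; rewrite add0r. Qed.

Lemma vge_sum (I : Type) (r : seq I) (P : pred I) z (f : I -> F) :
  (forall i, P i -> vge z (f i)) -> vge z (\sum_(i <- r | P i) f i).
Proof.
move=> h; elim/big_rec: _ => [|i x Pi IH]; first exact: vge0.
by apply: vgeD => //; apply: h.
Qed.

Lemma vge1 : vge 0 1.
Proof. by rewrite vgeE ?oner_neq0 // v1. Qed.

Lemma vgeX x n : vge 0 x -> vge 0 (x ^+ n).
Proof.
move=> hx; elim: n => [|n IH]; first by rewrite expr0 vge1.
by rewrite exprS; apply: vgeM0.
Qed.

Lemma vge_nat n : vge 0 n%:R.
Proof.
elim: n => [|n IH]; first exact: vge0.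
by rewrite -natr1; apply: vgeD => //; apply: vge1.
Qed.

Lemma vge_mulfl c z x : c != 0 -> vge (v c + z) (c * x) = vge z x.
Proof.
move=> c0; rewrite /vge mulf_eq0 (negbTE c0) /=.
have [->//|x0] := eqVneq x 0.
by rewrite vM // lerD2l.
Qed.

Lemma vge_mulf c z x : c != 0 -> vge z (c * x) = vge (z - v c) x.
Proof. by move=> c0; rewrite -(vge_mulfl (z - v c) x c0) addrC subrK. Qed.

Lemma natf_neq0_padic n : (0 < n)%N -> (n%:R : F) != 0.
Proof.
move=> n0; apply/eqP => h.
have hp : [pchar F] =i pred0 by move=> p; apply/negP => /(pv_char0 hv).
by move/pcharf0P: hp => /(_ n); rewrite h eqxx; case: n n0 {h}.
Qed.

Lemma v_addl x y : x != 0 -> vge (v x + 1) y -> x + y != 0 /\ v (x + y) = v x.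
Proof.
move=> x0 hy.
have s0 : x + y != 0.
  apply/negP => /eqP s0; move: hy; have -> : y = - x.
    by apply/eqP; rewrite -addr_eq0 addrC s0.
  by rewrite vgeN vgeE //; lia.
split=> //; apply/eqP; rewrite eq_le; apply/andP; split.
  have : vge (Num.min (v (x + y)) (v x + 1)) (x + y - y).
    apply: vgeB; first by rewrite vgeE //; lia.
    by apply: vge_le hy; lia.
  by rewrite addrK vgeE //; lia.
have : vge (v x) (x + y).
  by apply: vgeD; [apply: vge_self | apply: vge_le hy; lia].
by rewrite vgeE.
Qed.

Lemma v_eq x y : x != 0 -> vge (v x + 1) (y - x) -> y != 0 /\ v y = v x.
Proof. by move=> x0 /(v_addl x0); rewrite addrC subrK. Qed.

Lemma vge_all0 x : (forall N : nat, vge N x) -> x = 0.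
Proof.
move=> h; apply/eqP/negPn/negP => x0.
by have := h (absz (v x)).+1; rewrite vgeE //; lia.
Qed.

Lemma inPn_vge n x : inPn v n x <-> vge n x.
Proof. by split=> [h|/vgeP//]; apply/vgeP. Qed.

Lemma intpD p q : intp p -> intp q -> intp (p + q).
Proof. by move=> hp hq i; rewrite coefD; apply: vgeD. Qed.

Lemma intpM p q : intp p -> intp q -> intp (p * q).
Proof. by move=> hp hq i; rewrite coefM; apply: vge_sum => j _; apply: vgeM0. Qed.

Lemma intpC c : vge 0 c -> intp c%:P.
Proof. by move=> hc i; rewrite coefC; case: ifP => // _; apply: vge0. Qed.

Lemma intpX : intp 'X.
Proof. by move=> i; rewrite coefX; case: (i == 1)%N; [apply: vge1 | apply: vge0]. Qed.

Lemma intp_exp p n : intp p -> intp (p ^+ n).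
Proof.
move=> hp; elim: n => [|n IH]; last by rewrite exprS; apply: intpM.
by rewrite expr0; apply: intpC; apply: vge1.
Qed.

Lemma int_horner p x : intp p -> vge 0 x -> vge 0 p.[x].
Proof.
move=> hp hx; rewrite horner_coef; apply: vge_sum => i _.
by apply: vgeM0 => //; apply: vgeX.
Qed.

Lemma intp_deriv p : intp p -> intp p^`().
Proof. by move=> hp i; rewrite coef_deriv -mulr_natl; apply: vgeM0 => //; apply: vge_nat. Qed.

Lemma intp_ind (P : {poly F} -> Prop) : P 0 ->
  (forall p c, intp p -> vge 0 c -> P p -> P (p * 'X + c%:P)) ->
  forall p, intp p -> P p.
Proof.
move=> P0 PS p; elim/poly_ind: p => [//|p c IH] hp.
have hp' : intp p by move=> i; have := hp i.+1; rewrite coefD coefMX coefC /= addr0.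
apply: PS => //; last exact: IH.
by have := hp 0%N; rewrite coefD coefMX coefC /= add0r.
Qed.

(** Induction along Horner's scheme keeps the remainder integral without dividing derivatives by
    factorials. *)
Lemma int_taylor p x h : intp p -> vge 0 x -> vge 0 h ->
  exists2 r, vge 0 r & p.[x + h] = p.[x] + p^`().[x] * h + h ^+ 2 * r.
Proof.
move=> hp hx hh; elim/intp_ind: p / hp => [|p c hp hc [r hr IH]].
  by exists 0; rewrite ?vge0 // deriv0 !horner0; ring.
exists (p^`().[x] + r * (x + h)).
  apply: vgeD; first by apply: int_horner => //; apply: intp_deriv.
  by apply: vgeM0 => //; apply: vgeD.
by rewrite derivMXaddC !hornerE IH; ring.
Qed.

Lemma int_lip p x y z : intp p -> vge 0 x -> vge 0 y -> vge z (x - y) ->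
  vge z (p.[x] - p.[y]).
Proof.
move=> hp hx hy hz; elim/intp_ind: p / hp => [|p c hp hc IH].
  by rewrite !horner0 subr0 vge0.
rewrite !hornerE.
have -> : p.[x] * x + c - (p.[y] * y + c) = x * (p.[x] - p.[y]) + p.[y] * (x - y).
  by ring.
by apply: vgeD; apply: vgeM0 => //; apply: int_horner.
Qed.

Lemma hensel p a (k j : nat) : intp p -> vge 0 a -> p^`().[a] != 0 ->
  v p^`().[a] = k%:Z -> (k < j)%N -> vge (j + k)%N%:Z p.[a] ->
  exists x, [/\ p.[x] = 0, vge 0 x & vge j%:Z (x - a)].
Proof.
move=> hp ha d0 vd kj hpa.
set d := p^`().[a] in d0 vd.
(* Newton iteration with the slope frozen at [a]. The step has valuation at least [j + n], the
   Taylor remainder at least [2(j + n)], and the slope is off by valuation at least [j]; since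
   [k < j], each iteration gains at least one unit. *)
pose u := fix u n := if n is n'.+1 then u n' - p.[u n'] / d else a.
have ustep n y : vge n%:Z p.[y] -> (k <= n)%N -> vge (n - k)%N%:Z (p.[y] / d).
  move=> hy kn; rewrite mulrC vge_mulf ?invr_neq0 // vV // vd.
  by apply: vge_le hy; lia.
have hu n : vge j%:Z (u n - a) /\ vge (j + k + n)%N%:Z p.[u n].
  elim: n => [|n [IH1 IH2]].
    by rewrite /= subrr vge0 addn0.
  have hy : vge 0 (u n).
    by rewrite -(subrK a (u n)); apply: vgeD => //; apply: vge_le IH1; lia.
  have hs : vge (j + n)%N%:Z (p.[u n] / d).
    by have := ustep _ _ IH2; rewrite -addnA (addnC k) addnA addnK; apply; lia.
  split=> /=.
    rewrite addrAC; apply: vgeB => //; apply: vge_le hs; lia.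
  have hs0 : vge 0 (- (p.[u n] / d)) by rewrite vgeN; apply: vge_le hs; lia.
  have [r hr ->] := int_taylor hp hy hs0.
  rewrite mulrN sqrrN; apply: vgeD; last first.
    rewrite mulrC; apply: vgeM0 => //; rewrite expr2.
    by apply: vge_le (vgeM hs hs); lia.
  have -> : p.[u n] - p^`().[u n] * (p.[u n] / d) = (p.[u n] / d) * (p^`().[a] - p^`().[u n]).
    by rewrite -/d; field.
  have hl : vge j%:Z (p^`().[a] - p^`().[u n]).
    by rewrite -opprB vgeN; apply: int_lip => //; apply: intp_deriv.
  by apply: vge_le (vgeM hs hl); lia.
have ucau n m : (n <= m)%N -> vge n%:Z (u m - u n).
  move=> nm; rewrite -(subnK nm); elim: (m - n)%N => [|i IH].
    by rewrite add0n subrr vge0.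
  rewrite addSn /= addrAC; apply: vgeB => //.
  have [_ h] := hu (i + n)%N.
  have := ustep _ _ h; rewrite -addnA (addnC k) addnA addnK => /(_ ltac:(lia)).
  by apply: vge_le; lia.
have [l hl] : exists l, forall N, exists M, forall i, (M <= i)%N -> inPn v N (u i - l).
  apply: (pv_complete hv) => N; exists N => i i' hi hi'.
  apply/inPn_vge; rewrite -(subrKA (u N)); apply: vgeD; first exact: ucau.
  by rewrite -opprB vgeN; apply: ucau.
have hl' N : exists i, (N <= i)%N /\ vge N%:Z (u i - l).
  have [M hM] := hl N; exists (maxn M N); split; first by rewrite leq_maxr.
  by apply/inPn_vge/hM; rewrite leq_maxl.
have hla : vge j%:Z (l - a).
  have [i [_ hi]] := hl' j; rewrite -(subrKA (u i)); apply: vgeD.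
    by rewrite -opprB vgeN.
  by case: (hu i).
have hl0 : vge 0 l by rewrite -(subrK a l); apply: vgeD => //; apply: vge_le hla; lia.
exists l; split=> //; apply: vge_all0 => N.
have [i [Ni hi]] := hl' N.
have [h1 h2] := hu i.
have hi0 : vge 0 (u i) by rewrite -(subrK a (u i)); apply: vgeD => //; apply: vge_le h1; lia.
have := int_lip hp hi0 hl0 hi.
move=> h3; rewrite -[p.[l]](subKr p.[u i]); apply: vgeB => //.
by apply: vge_le h2; lia.
Qed.

End ValuedField.

End Valuation.
Import Valuation.

(** * Centres of finite families of polynomials *)

Definition aff (F : fieldType) (p : {poly F}) (b s : F) := p \Po (s *: 'X + b%:P).

Lemma aff_horner (F : fieldType) (p : {poly F}) b s w : (aff p b s).[w] = p.[b + s * w].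
Proof. by rewrite /aff horner_comp !hornerE addrC. Qed.

Lemma aff_aff (F : fieldType) (p : {poly F}) b s b' s' :
  aff (aff p b s) b' s' = aff p (b + s * b') (s * s').
Proof.
rewrite /aff -comp_polyA; congr (_ \Po _).
rewrite comp_polyD comp_polyZ comp_polyX comp_polyC scalerDr scalerA -addrA.
by congr (_ + _); rewrite addrC polyCD polyCM mul_polyC.
Qed.

Lemma coef_comp_scaleX (F : fieldType) (p : {poly F}) d l :
  (p \Po (d *: 'X))`_l = p`_l * d ^+ l.
Proof.
elim/poly_ind: p l => [|p c IH] l; first by rewrite comp_poly0 !coef0 mul0r.
rewrite comp_poly_MXaddC -scalerAr !coefD coefZ !coefMX !coefC.
case: l => [|l] /=; first by rewrite mulr0 add0r expr0 mulr1.
by rewrite IH !addr0 exprS; ring.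
Qed.

Lemma coef_aff (F : fieldType) (p : {poly F}) b s l :
  (aff p b s)`_l = p^`N(l).[b] * s ^+ l.
Proof.
have -> : aff p b s = aff p b 1 \Po (s *: 'X).
  rewrite /aff -comp_polyA; congr (_ \Po _).
  by rewrite comp_polyD comp_polyZ comp_polyX comp_polyC scale1r.
rewrite coef_comp_scaleX; congr (_ * _).
rewrite /aff scale1r.
elim/poly_ind: p l => [|p c IH] l.
  by rewrite comp_poly0 coef0 nderivn_poly0 ?size_poly0 // horner0.
rewrite comp_poly_MXaddC mulrDr !coefD coefMX coefMC coefC.
case: l => [|l] /=.
  by rewrite IH !nderivn0 !hornerE ?add0r; ring.
by rewrite !IH nderivnMXaddC !hornerE ?addr0; ring.
Qed.

Section Centers.
Variables (F : fieldType) (v : F -> int).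
Hypothesis hv : is_padic_val v.
Local Notation vge := (vge v).
Local Notation intp := (intp v).

Definition dominated (e : nat) (x y : F) : bool :=
  if x == 0 then y == 0 else vge (v x - e%:Z) y.

(* The expansion of [p] at [b] has bounded cancellation at [t]: no term exceeds the sum by more than [e]. *)
Definition centred e (p : {poly F}) b t := forall l, dominated e p.[t] (aff p b (t - b))`_l.

(* Equality of leading terms modulo [1 + pi^M O]. *)
Definition eqrv (M : nat) (x y : F) : bool :=
  if x == 0 then y == 0 else vge (v x + M%:Z) (y - x).

Lemma dom0 e x : dominated e x 0.
Proof. by rewrite /dominated eqxx vge0; case: ifP. Qed.

Lemma dom_refl e x : dominated e x x.
Proof. by rewrite /dominated; case: eqVneq => // x0; rewrite vgeE //; lia. Qed.

Lemma dom_le e e' x y : (e <= e')%N -> dominated e x y -> dominated e' x y.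
Proof. by rewrite /dominated => ee'; case: ifP => // _; apply: vge_le; lia. Qed.

Lemma domD e x y z : dominated e x y -> dominated e x z -> dominated e x (y + z).
Proof.
rewrite /dominated; case: ifP => _; last exact: vgeD.
by move=> /eqP-> /eqP->; rewrite addr0.
Qed.

Lemma domMint e x c y : vge 0 c -> dominated e x y -> dominated e x (c * y).
Proof.
rewrite /dominated => hc; case: ifP => _; last exact: vgeM0.
by move=> /eqP->; rewrite mulr0.
Qed.

Lemma dom_sum e x (I : Type) (r : seq I) (P : pred I) (f : I -> F) :
  (forall i, P i -> dominated e x (f i)) -> dominated e x (\sum_(i <- r | P i) f i).
Proof.
move=> h; elim/big_rec: _ => [|i y Pi IH]; first exact: dom0.
by apply: domD => //; apply: h.
Qed.

Lemma domMr e x y c : dominated e x y -> dominated e (x * c) (y * c).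
Proof.
have [->|c0] := eqVneq c 0; first by rewrite !mulr0 dom0.
rewrite /dominated mulf_eq0 (negbTE c0) orbF.
case: eqVneq => [_|x0]; first by move=> /eqP->; rewrite mul0r.
by rewrite (vM hv) // mulrC (vge_mulf hv) // => h; apply: vge_le h; lia.
Qed.

Lemma dom_comp e x (f g : {poly F}) : (forall l, dominated e x f`_l) -> intp g ->
  forall l, dominated e x (f \Po g)`_l.
Proof.
move=> hf hg l; rewrite coef_comp_poly; apply: dom_sum => i _.
by rewrite mulrC; apply: domMint => //; apply: intp_exp.
Qed.

Lemma intp_lin d b : vge 0 d -> vge 0 b -> intp (d *: 'X + b%:P).
Proof.
move=> hd hb; apply: intpD => //; last exact: intpC.
by rewrite -mul_polyC; apply: (intpM hv); [exact: intpC | exact: (intpX hv)].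
Qed.

(** The distance from the new centre to [t] is [(t - b) * (1 - beta)], so the new expansion arises
    from the old one by an integral linear substitution, which preserves domination. *)
Lemma gd_closer e p b t beta : vge 0 beta -> centred e p b t ->
  centred e p (b + (t - b) * beta) t.
Proof.
move=> hb h.
rewrite /centred; have -> : t - (b + (t - b) * beta) = (t - b) * (1 - beta) by ring.
rewrite -aff_aff; apply: dom_comp => //; apply: intp_lin => //.
by apply: vgeB => //; apply: vge1.
Qed.

Lemma vge_horner m (g : {poly F}) x : (forall l, vge m g`_l) -> vge 0 x -> vge m g.[x].
Proof.
move=> hg hx; rewrite horner_coef; apply: vge_sum => // i _.
by rewrite mulrC; apply: vgeM0 => //; apply: vgeX.
Qed.

(* Either the cancellation in [f.[1]] is bounded, or Hensel gives a root close enough to 1 to recentre at. *)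
Lemma hensel_step (f : {poly F}) (e E : nat) :
  (forall l, (0 < l < size f)%N -> v l%:R <= E%:Z) ->
  (forall l, dominated e f^`().[1] f^`()`_l) ->
  (forall l, dominated (2 * (e + E)) f.[1] f`_l) \/
  exists beta, [/\ vge 0 beta, f.[beta] = 0 &
    forall l, dominated 0 f.[1] (aff f beta (1 - beta))`_l].
Proof.
move=> hE hd; set c := f^`().[1] in hd.
have hfl0 l : (size f <= l)%N -> f`_l = 0 by move=> h; rewrite nth_default.
have [c0|c0] := eqVneq c 0.
  have hl l : f`_l.+1 = 0.
    have := hd l; rewrite /dominated c0 eqxx coef_deriv -mulr_natl mulf_eq0.
    by rewrite (negbTE (natf_neq0_padic hv _)) //= => /eqP.
  left => l; case: l => [|l]; last by rewrite hl dom0.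
  have -> : f.[1] = f`_0.
    have -> : f = (f`_0)%:P by apply/polyP => -[|l]; rewrite coefC //= hl.
    by rewrite hornerC coefC.
  exact: dom_refl.
(* Coefficient [l - 1] of the derivative is [l] times coefficient [l] of [f] and has valuation at
   least [v c - e]; division by [l] loses at most [E]. *)
pose m := v c - e%:Z - E%:Z.
have hm l : (0 < l)%N -> vge m f`_l.
  case: l => // l _; have [hs|hs] := leqP (size f) l.+1.
    by rewrite hfl0 // vge0.
  have := hd l; rewrite /dominated (negbTE c0) coef_deriv -mulr_natl (vge_mulf hv) //; last first.
    exact: (natf_neq0_padic hv).
  by apply: vge_le; have := hE l.+1 hs; rewrite /m; move: (v l.+1%:R) => w; lia.
have hf1 : vge m (f.[1] - f`_0).
  have -> : f.[1] - f`_0 = (f - (f`_0)%:P).[1] by rewrite !hornerE.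
  apply: vge_horner; last exact: vge1.
  move=> l; rewrite coefB coefC; case: l => [|l]; first by rewrite subrr vge0.
  by rewrite subr0; apply: hm.
(* A constant coefficient of valuation below [m] outweighs all the others, and then nothing cancels
   in [f.[1]]. *)
have [hm0|hm0] := boolP (vge m f`_0); last first.
  have f00 : f`_0 != 0 by apply: contraNneq hm0 => ->; rewrite vge0.
  move: hm0; rewrite vgeE // -ltNge => hm0.
  have [n0 vf] : f.[1] != 0 /\ v f.[1] = v f`_0.
    by apply: v_eq => //; apply: vge_le hf1; lia.
  left=> l; rewrite /dominated (negbTE n0) vf; case: l => [|l].
    by rewrite vgeE //; lia.
  by apply: vge_le (hm l.+1 isT); lia.
have [pi [pi0 vpi]] := pv_unif hv.
(* Scaling by [a] makes all coefficients integral, and the derivative at 1 acquires valuation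
   exactly [e + E]. *)
pose a := pi ^ (- m).
have a0 : a != 0 by rewrite expfz_neq0.
have va : v a = - m by rewrite (vXz hv) // vpi mul1r.
pose g := a *: f.
have hg : intp g.
  move=> l; rewrite coefZ (vge_mulf hv) // va; case: l => [|l]; first by apply: vge_le hm0; lia.
  by apply: vge_le (hm l.+1 isT); lia.
have g'1 : g^`().[1] = a * c by rewrite derivZ hornerZ.
have g'10 : g^`().[1] != 0 by rewrite g'1 mulf_neq0.
have vg' : v g^`().[1] = (e + E)%N%:Z by rewrite g'1 (vM hv) // va /m; lia.
set k := (e + E)%N in vg'.
(* If [g.[1]] has valuation at most [2 * k], that is the announced bound on the cancellation.
   Otherwise Hensel's lemma applies and yields a root [x] with [1 - x] divisible by [pi^(k+1)]. *)
have [hk|hk] := boolP (vge (k.+1 + k)%N%:Z g.[1]); last first.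
  have g10 : g.[1] != 0 by apply: contraNneq hk => ->; rewrite vge0.
  move: hk; rewrite vgeE // -ltNge hornerZ => hk.
  have f10 : f.[1] != 0 by move: g10; rewrite hornerZ mulf_eq0 negb_or => /andP[].
  rewrite (vM hv) // va in hk.
  left=> l; rewrite /dominated (negbTE f10).
  have : vge m f`_l by case: l => [|l] //; apply: hm.
  by apply: vge_le; move: hk; rewrite /k; move: (v f.[1]) => w; lia.
right.
have [x [gx hx hx1]] := hensel hv hg (vge1 hv) g'10 vg' (ltnSn k) hk.
exists x; split=> //.
  by move/eqP: gx; rewrite hornerZ mulf_eq0 (negbTE a0) => /eqP.
suff : forall l, dominated 0 g.[1] (aff g x (1 - x))`_l.
  move=> h l; have := h l; rewrite /g hornerZ.
  have -> : aff (a *: f) x (1 - x) = a *: aff f x (1 - x) by rewrite /aff comp_polyZ.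
  rewrite coefZ => /(domMr a^-1).
  by rewrite ![a * _]mulrC !mulfK.
set d := 1 - x.
have hd1 : vge k.+1 d by rewrite /d -opprB (vgeN hv).
have vgx : v g^`().[x] = k%:Z /\ g^`().[x] != 0.
  have [] := @v_eq _ _ hv _ g^`().[x] g'10; last by move=> -> ->.
  rewrite vg'; apply: vge_le (_ : vge k.+1 _); first by clear; lia.
  by apply: int_lip => //; [apply: intp_deriv | apply: vge1].
case: vgx => vgx gx0.
have hd0 : vge 0 d by apply: vge_le hd1; clear; lia.
(* Expanded at the root [x], the constant term vanishes and the linear term has valuation [v d + k],
   below that of all higher terms since [d] is divisible by [pi^(k+1)]. So the linear term alone
   gives the valuation of [g.[1]]. *)
have [r hr] := int_taylor hv hg hx hd0.
rewrite /d addrC subrK gx add0r -/d => g1.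
have g1' : g.[1] = d * (g^`().[x] + d * r) by rewrite g1; ring.
have [d0|d0] := eqVneq d 0.
  move=> l; rewrite g1' d0 mul0r /dominated eqxx coef_aff.
  case: l => [|l]; last by rewrite exprS mul0r mulr0.
  by rewrite nderivn0 gx mul0r.
have [n0 vn] : g^`().[x] + d * r != 0 /\ v (g^`().[x] + d * r) = k.
  rewrite -vgx; apply: v_addl => //; rewrite vgx mulrC; apply: vgeM0 => //.
  by apply: vge_le hd1; clear; lia.
have vg1 : v g.[1] = v d + k%:Z by rewrite g1' (vM hv) // vn.
move=> l; rewrite /dominated g1' mulf_eq0 (negbTE d0) (negbTE n0) /= -g1' vg1 subr0 coef_aff.
case: l => [|[|l]].
- by rewrite nderivn0 gx mul0r vge0.
- by rewrite nderivn1 expr1 vgeE ?mulf_neq0 // (vM hv) // vgx addrC.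
have : vge 0 g^`N(l.+2).[x].
  apply: int_horner => // i; rewrite coef_nderivn -mulr_natl.
  by apply: vgeM0 => //; apply: vge_nat.
move=> h; apply: vgeM0 => //.
rewrite 2!exprS.
apply: (vgeM hv); first exact: vge_self.
rewrite mulrC; apply: (vgeM0 hv); first by apply: vgeX.
by apply: vge_le hd1; clear; lia.
Qed.

(** After scaling so that the value at 1 has valuation [e], all coefficients are integral, and
    integral polynomials are 1-Lipschitz. *)
Lemma eqrv_of_dom (M e : nat) (f : {poly F}) eta : (forall l, dominated e f.[1] f`_l) ->
  vge 0 eta -> vge M%:Z (eta - 1) -> (e < M)%N -> eqrv (M - e) f.[1] f.[eta].
Proof.
move=> hf he hM eM; rewrite /eqrv; move: hf; rewrite /dominated.
case: (eqVneq f.[1] 0) => [_ hf|n0 hf].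
  have -> : f = 0 by apply/polyP => l; rewrite coef0; apply/eqP.
  by rewrite horner0.
have [pi [pi0 vpi]] := pv_unif hv.
pose a := pi ^ (e%:Z - v f.[1]).
have a0 : a != 0 by rewrite expfz_neq0.
have va : v a = e%:Z - v f.[1] by rewrite (vXz hv) // vpi mul1r.
have hg : intp (a *: f).
  by move=> l; rewrite coefZ (vge_mulf hv) // va; apply: vge_le (hf l); lia.
have := int_lip hv hg he (vge1 hv) hM.
by rewrite !hornerZ -mulrBr (vge_mulf hv) // va; apply: vge_le; lia.
Qed.

Lemma eqrv_v M x y : (0 < M)%N -> eqrv M x y -> x != 0 -> y != 0 /\ v y = v x.
Proof.
rewrite /eqrv => M0 h x0; rewrite (negbTE x0) in h.
by apply: v_eq => //; apply: vge_le h; lia.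
Qed.

Lemma eqrv_eq0 M x y : (0 < M)%N -> eqrv M x y -> (x == 0) = (y == 0).
Proof.
move=> M0 h; have [x0|x0] := eqVneq x 0.
  by move: h; rewrite /eqrv x0 eqxx => ->.
by have [/negbTE-> _] := eqrv_v M0 h x0.
Qed.

(** Multiplying [t - b] by [eta] rescales the terms of the expansion by powers of a factor close to
    1; bounded cancellation then keeps the leading term of the sum, at a loss of [e] digits. *)
Lemma gd_perturb (M e : nat) (p : {poly F}) b t eta : centred e p b t ->
  vge 0 eta -> vge M%:Z (eta - 1) -> (e < M)%N ->
  centred e p b (b + (t - b) * eta) /\ eqrv (M - e) p.[t] p.[b + (t - b) * eta].
Proof.
move=> h he hM eM.
have pt : (aff p b (t - b)).[1] = p.[t] by rewrite aff_horner mulr1 addrC subrK.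
have h' : forall l, dominated e (aff p b (t - b)).[1] (aff p b (t - b))`_l by rewrite pt.
have := eqrv_of_dom h' he hM eM; rewrite pt aff_horner => hr.
split=> // l; have := h l.
rewrite [b + _ - b]addrC addKr.
have -> : aff p b ((t - b) * eta) = aff (aff p b (t - b)) 0 eta.
  by rewrite aff_aff mulr0 addr0.
set f := aff p b (t - b).
have -> : aff f 0 eta = f \Po (eta *: 'X) by rewrite /aff addr0.
rewrite coef_comp_scaleX [_ * eta ^+ l]mulrC; move: hr; rewrite /dominated /eqrv.
case: eqVneq => [_ -> /eqP->|n0 hr]; first by rewrite mulr0.
have [] := @v_eq _ _ hv _ p.[b + (t - b) * eta] n0.
  by apply: vge_le hr; lia.
by move=> /negbTE-> -> h2; apply: vgeM0 => //; apply: vgeX.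
Qed.

(** Induction on the degree: a centre for all derivatives of positive order is found first, and
    [hensel_step] either accepts it for [p] or moves it to a root of [p]. The loss grows from [e] to
    [2(e + E)] per degree, uniformly in [p], [b0] and [t]. *)
Lemma center1 (D E : nat) : (forall l, (0 < l < D)%N -> v l%:R <= E%:Z) ->
  exists e : nat, forall p : {poly F}, (size p <= D)%N -> forall b0 t, exists b beta,
   [/\ vge 0 beta, b = b0 + (t - b0) * beta,
       b = b0 \/ (exists k, p^`(k) != 0 /\ p^`(k).[b] = 0) &
       forall k, centred e p^`(k) b t].
Proof.
move=> hE.
suff H n : (n <= D)%N -> exists e : nat, forall p : {poly F}, (size p <= n)%N ->
  forall b0 t, exists b beta,
   [/\ vge 0 beta, b = b0 + (t - b0) * beta,
       b = b0 \/ (exists k, p^`(k) != 0 /\ p^`(k).[b] = 0) &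
       forall k, centred e p^`(k) b t] by exact: H (leqnn D).
elim: n => [|n IH] hn.
  exists 0%N => p; rewrite leqn0 size_poly_eq0 => /eqP-> b0 t.
  exists b0, 0; split; [exact: vge0 | by rewrite mulr0 addr0 | by left | ].
  by move=> k l; rewrite linear0 /aff comp_poly0 coef0 dom0.
have [e he] := IH (ltnW hn).
exists (2 * (e + E))%N => p hp b0 t.
have hp' : (size p^`() <= n)%N.
  have [->|p0] := eqVneq p 0; first by rewrite deriv0 size_poly0.
  by have := lt_size_deriv p0; lia.
have [b1 [beta1 [hb1 hbe1 hr1 hg1]]] := he _ hp' b0 t.
have hr1' : b1 = b0 \/ (exists k, p^`(k) != 0 /\ p^`(k).[b1] = 0).
  by case: hr1 => [->|[k]]; [left | right; exists k.+1; rewrite derivSn].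
have [p0|p0] := eqVneq p 0.
  exists b1, beta1; split=> // k l.
  by rewrite p0 linear0 /aff comp_poly0 coef0 dom0.
set f := aff p b1 (t - b1).
have f1 : f.[1] = p.[t] by rewrite aff_horner mulr1 addrC subrK.
have f' : f^`() = aff p^`() b1 (t - b1) * (t - b1)%:P.
  rewrite /f /aff deriv_comp; congr (_ * _).
  by rewrite derivD derivZ derivX derivC addr0 -mul_polyC mulr1.
have hfE : forall l, (0 < l < size f)%N -> v l%:R <= E%:Z.
  move=> l hl; apply: hE; have : (size f <= size p)%N.
    rewrite /f /aff; apply/leq_sizeP => j hj.
    by rewrite -/(aff _ _ _) coef_aff nderivn_poly0 ?horner0 ?mul0r.
  by lia.
have hf' : forall l, dominated e f^`().[1] f^`()`_l.
  move=> l; rewrite f' coefMC !hornerE; apply: domMr.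
  have := hg1 0%N l; rewrite derivn0; congr (dominated _ _ _).
  by rewrite aff_horner mulr1 addrC subrK.
have hmono k : centred (2 * (e + E)) p^`(k.+1) b1 t.
  by move=> l; rewrite derivSn; apply: dom_le (hg1 k l); clear; lia.
have [hc|[x [hx fx hc]]] := hensel_step hfE hf'.
  exists b1, beta1; split=> //; case=> [|k] //.
  by move=> l; rewrite derivn0 -/f -f1.
(* Moving to the root of [p] does not spoil the centre for the derivatives: it is a move towards [t]
   by an integral factor, covered by [gd_closer]. *)
exists (b1 + (t - b1) * x), (beta1 + (1 - beta1) * x); split.
- apply: vgeD => //; apply: vgeM0 => //; apply: vgeB => //; exact: vge1.
- by rewrite hbe1; ring.
- right; exists 0%N; rewrite derivn0; split=> //.
  by rewrite -aff_horner.
case=> [|k]; last exact: gd_closer.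
move=> l; rewrite derivn0; have := hc l; rewrite f1 aff_aff.
have -> : t - (b1 + (t - b1) * x) = (t - b1) * (1 - x) by ring.
exact: dom_le.
Qed.

(** The members are treated one after the other, each starting from the centre reached so far. All
    moves are towards [t], so earlier members stay centred and [e] does not depend on the length of
    the list. *)
Lemma center (D E : nat) : (forall l, (0 < l < D)%N -> v l%:R <= E%:Z) ->
  exists e : nat, forall s : seq {poly F}, (forall p, p \in s -> (size p <= D)%N) ->
   forall b0 t, exists b beta,
   [/\ vge 0 beta, b = b0 + (t - b0) * beta,
       b = b0 \/ (exists p k, [/\ p \in s, p^`(k) != 0 & p^`(k).[b] = 0]) &
       forall p k, p \in s -> centred e p^`(k) b t].
Proof.
move=> hE; have [e he] := center1 hE; exists e.
elim=> [|p s IH] hs b0 t.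
  by exists b0, 0; rewrite vge0 mulr0 addr0; split=> //; left.
have hs' : forall q, q \in s -> (size (q : {poly F}) <= D)%N.
  by move=> q hq; apply: hs; rewrite in_cons hq orbT.
have [b1 [be1 [h1 h2 h3 h4]]] := IH hs' b0 t.
have [b [be [k1 k2 k3 k4]]] := he p (hs p (mem_head _ _)) b1 t.
exists b, (be1 + (1 - be1) * be); split.
- apply: vgeD => //; apply: vgeM0 => //; apply: vgeB => //; exact: vge1.
- by rewrite k2 h2; ring.
- case: k3 => [->|[k [hk1 hk2]]].
    case: h3 => [->|[q [k [hk1 hk2 hk3]]]]; first by left.
    by right; exists q, k; rewrite in_cons hk1 orbT.
  by right; exists p, k; rewrite mem_head.
move=> q k; rewrite in_cons => /orP[/eqP->//|hq].
by rewrite k2; apply: gd_closer => //; apply: h4.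
Qed.

Lemma nat_val_bound D : exists E : nat, forall l, (0 < l < D)%N -> v l%:R <= E%:Z.
Proof.
elim: D => [|D [E IH]]; first by exists 0%N; case.
exists (E + `|v D%:R|)%N => l hl.
have [->|hne] := eqVneq l D; first by lia.
by have := IH l; lia.
Qed.

End Centers.

(** * Definable predicates and elimination of integer quantifiers *)

Module Definable.

Lemma int_sgn_bound (a b c : int) :
  (0 <= a) != (0 <= a + b) -> `|b| = c -> `|a| <= c.
Proof. by case: (lerP 0 a); case: (lerP 0 (a + b)) => //; lia. Qed.

Lemma int_shift_mem (a : int) (c : nat) : `|a| <= c%:Z ->
  a \in [seq i%:Z - c%:Z | i <- iota 0 (2 * c).+1].
Proof.
move=> h; apply/mapP; exists (absz (a + c%:Z)); last by lia.
by rewrite mem_iota; lia.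
Qed.

Section Definable.
Variables (F : fieldType) (v : F -> int) (pi : F).

(** The angular component of [x] modulo [pi^M] is the class of [u]. For [M = 0] this merely says
    that [x] is nonzero and [u] integral. *)
Definition ac (M : nat) (u x : F) : bool :=
  (x != 0) && vge v M%:Z (x * pi ^ (- v x) - u).

Section Class.
Variables (R Y : Type) (ev : Y -> R -> F) (T : (Y -> int) -> Prop) (A : R -> Prop).

(* [Y] is a parameter space with integer coordinates [T]; [ev] evaluates ring elements on it, and only those
   in [A] may occur in atoms. *)
Inductive lin : (Y -> int) -> Prop :=
| lin_cst c : lin (fun=> c)
| lin_var t : T t -> lin t
| lin_val g : A g -> lin (fun y => v (ev y g))
| lin_add t1 t2 : lin t1 -> lin t2 -> lin (fun y => t1 y + t2 y)
| lin_opp t : lin t -> lin (fun y => - t y).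

Inductive definable : (Y -> Prop) -> Prop :=
| d_zero g : A g -> definable (fun y => ev y g = 0)
| d_ac M u g : A g -> definable (fun y => ac M u (ev y g))
| d_ge t : lin t -> definable (fun y => 0 <= t y)
| d_dvd (N : int) t : lin t -> definable (fun y => (N %| t y)%Z)
| d_and P Q : definable P -> definable Q -> definable (fun y => P y /\ Q y)
| d_not P : definable P -> definable (fun y => ~ P y)
| d_ext P Q : (forall y, P y <-> Q y) -> definable P -> definable Q.

Lemma lin_ext t1 t2 : t1 =1 t2 -> lin t1 -> lin t2.
Proof. by move=> /funext->. Qed.

Lemma lin_sub t1 t2 : lin t1 -> lin t2 -> lin (fun y => t1 y - t2 y).
Proof. by move=> h1 h2; apply: lin_add => //; apply: lin_opp. Qed.

Lemma lin_mulz c t : lin t -> lin (fun y => c * t y).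
Proof.
move=> ht; have hn (n : nat) : lin (fun y => n%:Z * t y).
  elim: n => [|n IH].
    by apply: lin_ext (lin_cst 0) => y; rewrite mul0r.
  by apply: lin_ext (lin_add ht IH) => y; rewrite intS mulrDl mul1r.
case: c => n; first exact: hn.
by apply: lin_ext (lin_opp (hn n.+1)) => y; rewrite NegzE mulNr.
Qed.

Lemma dfn_const (P : Prop) : definable (fun=> P).
Proof.
have hT : definable (fun=> True).
  by apply: d_ext (d_ge (lin_cst 0)) => y; split.
have [p|np] := pselect P.
  by apply: d_ext hT => y; split.
by apply: d_ext (d_not hT) => y; split.
Qed.

Lemma dfn_or P Q : definable P -> definable Q -> definable (fun y => P y \/ Q y).
Proof.
move=> hP hQ; apply: d_ext (d_not (d_and (d_not hP) (d_not hQ))) => y.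
split=> [h|[h|h] [h1 h2]//].
by have [p|np] := pselect (P y); [left|right; apply: contrapT => nq; apply: h].
Qed.

Lemma dfn_ex (I : eqType) (s : seq I) (P : I -> Y -> Prop) :
  (forall i, i \in s -> definable (P i)) -> definable (fun y => exists2 i, i \in s & P i y).
Proof.
elim: s => [|i s IH] h.
  by apply: d_ext (dfn_const False) => y; split=> // -[].
have h1 := h i (mem_head _ _).
have h2 : definable (fun y => exists2 j, j \in s & P j y).
  by apply: IH => j hj; apply: h; rewrite in_cons hj orbT.
apply: d_ext (dfn_or h1 h2) => y; split.
  case=> [p|[j hj p]]; first by exists i; rewrite ?mem_head.
  by exists j; rewrite // in_cons hj orbT.
case=> j; rewrite in_cons => /orP[/eqP->|hj] p; first by left.
by right; exists j.
Qed.

Lemma dfn_all (I : eqType) (s : seq I) (P : I -> Y -> Prop) :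
  (forall i, i \in s -> definable (P i)) -> definable (fun y => forall i, i \in s -> P i y).
Proof.
move=> h; have h' : definable (fun y => exists2 i, i \in s & ~ P i y).
  by apply: dfn_ex => i hi; apply: d_not; apply: h.
apply: d_ext (d_not h') => y; split=> [hn i hi|hn [i hi]]; last by apply; apply: hn.
by apply: contrapT => np; apply: hn; exists i.
Qed.

Lemma dfn_le t1 t2 : lin t1 -> lin t2 -> definable (fun y => t1 y <= t2 y).
Proof.
by move=> h1 h2; apply: d_ext (d_ge (lin_sub h2 h1)) => y; rewrite subr_ge0.
Qed.

Lemma dfn_eqz t1 t2 : lin t1 -> lin t2 -> definable (fun y => t1 y = t2 y).
Proof.
move=> h1 h2; apply: d_ext (d_and (dfn_le h1 h2) (dfn_le h2 h1)) => y.
by split=> [[a b]|->]; [apply/eqP; rewrite eq_le a b | rewrite lexx].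
Qed.

(** Integer functions that are linear on finitely many definable pieces. They are unavoidable
    because the valuation of a sum is linear in those of the summands only after a case
    distinction. *)
Inductive pwl (G : Y -> Prop) (l : Y -> int) : Prop :=
| pwl_lin t of lin t & (forall y, G y -> l y = t y)
| pwl_split D of definable D & pwl (fun y => G y /\ D y) l & pwl (fun y => G y /\ ~ D y) l.

Lemma pwl_sub (G G' : Y -> Prop) l : (forall y, G' y -> G y) -> pwl G l -> pwl G' l.
Proof.
move=> hG h; elim: h G' hG => {G l} [G l t ht hl|G l D hD _ IH1 _ IH2] G' hG.
  by apply: (pwl_lin ht) => y /hG /hl.
apply: (pwl_split hD).
  by apply: IH1 => y [/hG].
by apply: IH2 => y [/hG].
Qed.

Lemma pwl_add G a b : pwl G a -> pwl G b -> pwl G (fun y => a y + b y).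
Proof.
elim=> {G a} [G a t ht ha|G a D hD _ IH1 _ IH2] hb; last first.
  apply: (pwl_split hD).
    by apply: IH1; apply: pwl_sub hb => y [].
  by apply: IH2; apply: pwl_sub hb => y [].
elim: hb ha => {G b} [G b t' ht' hb|G b D hD _ IH1 _ IH2] ha.
  by apply: (pwl_lin (lin_add ht ht')) => y hy; rewrite ha // hb.
apply: (pwl_split hD).
  by apply: IH1 => y [/ha].
by apply: IH2 => y [/ha].
Qed.

Lemma pwl_opp G a : pwl G a -> pwl G (fun y => - a y).
Proof.
elim=> {G a} [G a t ht ha|G a D hD _ IH1 _ IH2].
  by apply: (pwl_lin (lin_opp ht)) => y hy; rewrite ha.
exact: pwl_split hD IH1 IH2.
Qed.

Lemma pwl_dfn (Q : Y -> int -> Prop) G l :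
  (forall t, lin t -> definable (fun y => Q y (t y))) ->
  definable G -> pwl G l -> definable (fun y => G y /\ Q y (l y)).
Proof.
move=> hQ hG h; elim: h hG => {G l} [G l t ht ha|G l D hD _ IH1 _ IH2] hG.
  by apply: d_ext (d_and hG (hQ _ ht)) => y; split=> -[hy]; rewrite ha.
have h1 := IH1 (d_and hG hD); have h2 := IH2 (d_and hG (d_not hD)).
apply: d_ext (dfn_or h1 h2) => y; split=> [[[[]]|[[]]]//|[hy hq]].
by have [d|d] := pselect (D y); [left|right].
Qed.

Lemma pwl_cover (I : eqType) (s : seq I) (D : I -> Y -> Prop) (tau : I -> Y -> int) G l :
  (forall i, i \in s -> definable (D i)) -> (forall i, i \in s -> lin (tau i)) ->
  (forall y, G y -> exists2 i, i \in s & D i y) ->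
  (forall y i, i \in s -> G y -> D i y -> l y = tau i y) ->
  pwl G l.
Proof.
elim: s G => [|i s IH] G hD hl hc he.
  by apply: (pwl_lin (lin_cst 0)) => y /hc [].
have hi := mem_head i s.
apply: (pwl_split (hD _ hi)).
  by apply: (pwl_lin (hl _ hi)) => y [gy dy]; apply: he.
apply: IH => [j hj|j hj|y [gy dy]|y j hj [gy _]].
- by apply: hD; rewrite in_cons hj orbT.
- by apply: hl; rewrite in_cons hj orbT.
- case: (hc _ gy) => j; rewrite in_cons => /orP[/eqP->//|hj] hdj.
  by exists j.
- by apply: he => //; rewrite in_cons hj orbT.
Qed.

End Class.

Lemma lin_mono R Y (ev : Y -> R -> F) T (A A' : R -> Prop) t :
  (forall g, A g -> A' g) -> lin ev T A t -> lin ev T A' t.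
Proof.
by move=> h; elim=> {t} [c|t ht|g /h hg|t1 t2 _ h1 _ h2|t _ ht];
  [apply: lin_cst|apply: lin_var|apply: lin_val|apply: lin_add|apply: lin_opp].
Qed.

Lemma dfn_mono R Y (ev : Y -> R -> F) T (A A' : R -> Prop) P :
  (forall g, A g -> A' g) -> definable ev T A P -> definable ev T A' P.
Proof.
move=> h; elim=> {P} [g /h hg|M u g /h hg|t ht|N t ht|P Q _ h1 _ h2|P _ h1|P Q e _ h1].
- exact: d_zero.
- exact: d_ac.
- by apply: d_ge; apply: lin_mono ht.
- by apply: d_dvd; apply: lin_mono ht.
- exact: d_and.
- exact: d_not.
- exact: d_ext h1.
Qed.

Lemma lin_fin (R : eqType) Y (ev : Y -> R -> F) T (A : R -> Prop) t :
  lin ev T A t -> exists s : seq R, (forall g, g \in s -> A g) /\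
    lin ev T (fun g => g \in s) t.
Proof.
elim=> {t} [c|t ht|g hg|t1 t2 _ [s1 [a1 h1]] _ [s2 [a2 h2]]|t _ [s [a h]]].
- by exists [::]; split=> //; apply: lin_cst.
- by exists [::]; split=> //; apply: lin_var.
- exists [:: g]; split; first by move=> g'; rewrite inE => /eqP->.
  by apply: (@lin_val _ _ ev T (fun g0 => g0 \in [:: g])); rewrite inE.
- exists (s1 ++ s2); split; first by move=> g; rewrite mem_cat => /orP[/a1|/a2].
  by apply: lin_add; [apply: lin_mono h1|apply: lin_mono h2] => g; rewrite mem_cat => ->; rewrite ?orbT.
- by exists s; split=> //; apply: lin_opp.
Qed.

Lemma dfn_fin (R : eqType) Y (ev : Y -> R -> F) T (A : R -> Prop) P :
  definable ev T A P -> exists s : seq R, (forall g, g \in s -> A g) /\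
    definable ev T (fun g => g \in s) P.
Proof.
elim=> {P} [g hg|M u g hg|t ht|N t ht|P Q _ [s1 [a1 h1]] _ [s2 [a2 h2]]|P _ [s [a h]]|P Q e _ [s [a h]]].
- exists [:: g]; split; first by move=> g'; rewrite inE => /eqP->.
  by apply: (@d_zero _ _ ev T (fun g0 => g0 \in [:: g])); rewrite inE.
- exists [:: g]; split; first by move=> g'; rewrite inE => /eqP->.
  by apply: (@d_ac _ _ ev T (fun g0 => g0 \in [:: g])); rewrite inE.
- by have [s [a h]] := lin_fin ht; exists s; split=> //; apply: d_ge.
- by have [s [a h]] := lin_fin ht; exists s; split=> //; apply: d_dvd.
- exists (s1 ++ s2); split; first by move=> g; rewrite mem_cat => /orP[/a1|/a2].
  by apply: d_and; [apply: dfn_mono h1|apply: dfn_mono h2] => g; rewrite mem_cat => ->; rewrite ?orbT.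
- by exists s; split=> //; apply: d_not.
- by exists s; split=> //; apply: d_ext h.
Qed.

(* Transport of definability along a map that is itself definable on [G]. *)
Lemma dfn_subst (R R' Y Y' : Type) (ev : Y -> R -> F) T A (ev' : Y' -> R' -> F) T' A'
    (s : Y -> Y') (G : Y -> Prop) (P : Y' -> Prop) :
  definable ev T A G ->
  (forall t, T' t -> pwl ev T A G (fun y => t (s y))) ->
  (forall g, A' g -> definable ev T A (fun y => G y /\ ev' (s y) g = 0)) ->
  (forall g M u, A' g -> definable ev T A (fun y => G y /\ ac M u (ev' (s y) g))) ->
  (forall g, A' g -> pwl ev T A G (fun y => v (ev' (s y) g))) ->
  definable ev' T' A' P -> definable ev T A (fun y => G y /\ P (s y)).
Proof.
move=> hG hT h0 hac hv.
have hlin t : lin ev' T' A' t -> pwl ev T A G (fun y => t (s y)).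
  elim=> {t} [c|t ht|g hg|t1 t2 _ h1 _ h2|t _ ht].
  - by apply: (pwl_lin (lin_cst _ _ _ c)).
  - exact: hT.
  - exact: hv.
  - exact: pwl_add.
  - exact: pwl_opp.
elim=> {P} [g hg|M u g hg|t ht|N t ht|P Q _ h1 _ h2|P _ h1|P Q e _ h1].
- exact: h0.
- exact: hac.
- apply: (@pwl_dfn _ _ ev T A (fun y z => 0 <= z)) => //; last exact: hlin.
  by move=> t'; apply: d_ge.
- apply: (@pwl_dfn _ _ ev T A (fun y z => (N %| z)%Z)) => //; last exact: hlin.
  by move=> t'; apply: d_dvd.
- by apply: d_ext (d_and h1 h2) => y; split=> [[[? ?] [? ?]]|[? [? ?]]].
- apply: d_ext (d_and hG (d_not h1)) => y; split=> -[gy np]; split=> // p.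
    by apply: np.
  by apply: np; case: p.
- by apply: d_ext h1 => y; rewrite e.
Qed.

Lemma dfn_pull (R Y Y' : Type) (ev : Y -> R -> F) T A (ev' : Y' -> R -> F) T'
    (s : Y -> Y') (P : Y' -> Prop) :
  (forall t, T' t -> lin ev T A (fun y => t (s y))) ->
  (forall y g, ev' (s y) g = ev y g) ->
  definable ev' T' A P -> definable ev T A (fun y => P (s y)).
Proof.
move=> hT he hP.
have hTr : definable ev T A (fun=> True) by apply: dfn_const.
suff h : definable ev T A (fun y => True /\ P (s y)).
  by apply: d_ext h => y; split=> [[]|].
apply: dfn_subst hP => //.
- by move=> t /hT h; apply: (pwl_lin h).
- by move=> g hg; apply: d_and => //; apply: d_ext (d_zero _ _ hg) => y; rewrite he.
- by move=> g M u hg; apply: d_and => //; apply: d_ext (d_ac _ _ M u hg) => y; rewrite he.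
- by move=> g hg; apply: (pwl_lin (lin_val _ _ hg)) => y _; rewrite he.
Qed.

(** * Integer quantifiers, by Cooper's procedure *)

Section IntegerQuantifier.
Variables (R Y : Type) (ev : Y -> R -> F) (T : (Y -> int) -> Prop) (A : R -> Prop).

Definition evZ (p : Y * int) := ev p.1.
Definition TZ (t : Y * int -> int) : Prop :=
  (exists2 t0, T t0 & t = (fun p => t0 p.1)) \/ t = snd.

Local Notation lin1 := (lin ev T A).
Local Notation dfn1 := (definable ev T A).
Local Notation lin2 := (lin evZ TZ A).
Local Notation dfn2 := (definable evZ TZ A).

Lemma linZ_split t : lin2 t -> exists tau c, lin1 tau /\ forall y k, t (y, k) = tau y + c * k.
Proof.
elim=> {t} [c|t [[t0 h0 ->]|->]|g hg|t1 t2 _ [a1 [c1 [l1 e1]]] _ [a2 [c2 [l2 e2]]]|t _ [a [c [l e]]]].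
- by exists (fun=> c), 0; split=> [|y k]; [apply: lin_cst|rewrite mul0r addr0].
- by exists t0, 0; split=> [|y k]; [apply: lin_var|rewrite mul0r addr0].
- by exists (fun=> 0), 1; split=> [|y k]; [apply: lin_cst|rewrite mul1r add0r].
- by exists (fun y => v (ev y g)), 0; split=> [|y k]; [apply: lin_val|rewrite mul0r addr0].
- exists (fun y => a1 y + a2 y), (c1 + c2); split; first exact: lin_add.
  by move=> y k; rewrite e1 e2; ring.
- exists (fun y => - a y), (- c); split; first exact: lin_opp.
  by move=> y k; rewrite e; ring.
Qed.

(** Ring atoms ignore the new integer variable. Inequalities see it only through finitely many
    signs, divisibilities only through its class modulo [N]. *)
Lemma dfnZ_thresholds P : dfn2 P -> exists (N : nat) (L : seq ((Y -> int) * int)),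
  [/\ (0 < N)%N, (forall p, List.In p L -> lin1 p.1) &
   forall y k k', (N%:Z %| k' - k)%Z ->
    (forall p, List.In p L -> (0 <= p.1 y + p.2 * k) = (0 <= p.1 y + p.2 * k')) ->
    P (y, k) <-> P (y, k')].
Proof.
elim=> {P} [g hg|M u g hg|t ht|N t ht|P Q _ [N1 [L1 [n1 l1 h1]]] _ [N2 [L2 [n2 l2 h2]]]|P _ [N [L [n l h]]]|P Q e _ [N [L [n l h]]]].
- by exists 1%N, [::].
- by exists 1%N, [::].
- have [a [c [la e]]] := linZ_split ht.
  exists 1%N, [:: (a, c)]; split=> // [p [<-|//]|y k k' _ h] //.
  by rewrite !e (h (a, c)) //; left.
- have [a [c [la e]]] := linZ_split ht.
  (* Divisibility by 0 is an equation, and two opposite inequalities detect it. *)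
  have [->|N0] := eqVneq N 0.
    exists 1%N, [:: (a, c); (fun y => - a y, - c)]; split=> //.
      by move=> p [<-//|[<-|//]]; apply: lin_opp.
    move=> y k k' _ h; rewrite !dvdzE !dvd0n !absz_eq0 !e.
    have h1 := h (a, c) (or_introl erefl).
    have h2 := h _ (or_intror (or_introl erefl)); rewrite /= in h1 h2.
    have e1 z : (a y + c * z == 0) = (0 <= a y + c * z) && (0 <= - a y + (- c) * z).
      by rewrite mulNr -opprD oppr_ge0 eq_le andbC.
    by rewrite !e1 h1 h2.
  exists `|N|%N, [::]; split=> //; first by rewrite absz_gt0.
  move=> y k k' hk _; rewrite !e.
  have hd : (N %| c * (k' - k))%Z by rewrite dvdz_mull // -(dvdz_abs N) .
  have -> : a y + c * k' = a y + c * k + c * (k' - k) by ring.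
  by rewrite [X in _ <-> is_true X](rpredDr _ hd).
- exists (N1 * N2)%N, (L1 ++ L2); split; first by rewrite muln_gt0 n1.
    by move=> p hp; case: (List.in_app_or _ _ _ hp) => hp'; [apply: l1|apply: l2].
  move=> y k k' hk hp.
  have hk1 : (N1%:Z %| k' - k)%Z by apply: dvdz_trans hk; rewrite PoszM dvdz_mulr.
  have hk2 : (N2%:Z %| k' - k)%Z by apply: dvdz_trans hk; rewrite PoszM dvdz_mull.
  rewrite (h1 _ _ _ hk1) ?(h2 _ _ _ hk2) // => p hin; apply: hp; apply: List.in_or_app; by [right|left].
- by exists N, L; split=> // y k k' hk hp; rewrite (h _ _ _ hk hp).
- by exists N, L; split=> // y k k' hk hp; rewrite -!e; apply: h.
Qed.

(** Once [c] is positive, an atom can be multiplied by [c]; then [c * t(y, tau y / c)] is again a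
    linear term on the set where the division is exact. *)
Lemma dfnZ_subst P tau c : dfn2 P -> lin1 tau -> c != 0 ->
  dfn1 (fun y => (c %| tau y)%Z /\ P (y, (tau y %/ c)%Z)).
Proof.
move=> hP ht c0.
wlog cp : tau c ht c0 / 0 < c.
  move=> H; have [cp|cn] := ltP 0 c; first exact: H.
  have := H (fun y => - tau y) (- c); rewrite oppr_eq0 oppr_gt0 lt_neqAle c0 cn.
  move=> /(_ (lin_opp ht) isT isT) h; apply: d_ext h => y.
  have -> : (- c %| - tau y)%Z = (c %| tau y)%Z by rewrite !dvdzE !abszN.
  have [/dvdzP[q ->]|hd] := boolP (c %| tau y)%Z; last by split=> -[].
  by rewrite -mulrN !mulzK ?oppr_eq0.
have hG : dfn1 (fun y => (c %| tau y)%Z) by apply: d_dvd.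
have key (t : Y * int -> int) : lin2 t -> exists2 t', lin1 t' &
    forall y, (c %| tau y)%Z -> c * t (y, (tau y %/ c)%Z) = t' y.
  move=> /linZ_split [a [d [la e]]].
  exists (fun y => c * a y + d * tau y).
    by apply: lin_add; apply: lin_mulz.
  by move=> y hd; rewrite e mulrDr mulrCA [c * (tau y %/ c)%Z]mulrC divzK.
elim: hP => {P} [g hg|M u g hg|t ht2|N t ht2|P Q _ h1 _ h2|P _ h1|P Q e _ h1].
- by apply: d_and => //; apply: d_zero.
- by apply: d_and => //; apply: d_ac.
- have [t' l' e] := key _ ht2.
  apply: d_ext (d_and hG (d_ge l')) => y; split=> -[hd]; rewrite -e // pmulr_rge0 //.
- have [t' l' e] := key _ ht2.
  apply: d_ext (d_and hG (d_dvd (c * N) l')) => y; split=> -[hd]; rewrite -e // dvdz_mul2l //.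
- by apply: d_ext (d_and h1 h2) => y; split=> [[[? ?] [? ?]]|[? [? ?]]].
- apply: d_ext (d_and hG (d_not h1)) => y; split=> -[gy np]; split=> // p.
    by apply: np.
  by apply: np; case: p.
- by apply: d_ext h1 => y; rewrite e.
Qed.

(** Either some solution lies within [N] steps of a threshold, hence among finitely many explicit
    quotients, or solutions can be moved by [N] without changing any sign, and then one lies in
    [[0, N)]. *)
Lemma dfnZ_ex P : dfn2 P -> dfn1 (fun y => exists k, P (y, k)).
Proof.
move=> hP; have [N [L [N0 hL hthr]]] := dfnZ_thresholds hP.
have hd (L' : seq ((Y -> int) * int)) : (forall p, List.In p L' -> lin1 p.1) ->
   dfn1 (fun y => exists p, List.In p L' /\ p.2 != 0 /\ exists2 r : int,
     r \in [seq i%:Z - (`|p.2| * N)%N%:Z | i <- iota 0 (2 * `|p.2| * N).+1] &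
     (p.2 %| r - p.1 y)%Z /\ P (y, ((r - p.1 y) %/ p.2)%Z)).
  elim: L' => [|p L' IH] hl.
    by apply: d_ext (dfn_const _ _ _ False) => y; split=> // -[p []].
  have h1 := IH (fun q hq => hl q (or_intror hq)).
  have [p0|p0] := eqVneq p.2 0.
    apply: d_ext h1 => y; split=> -[q [hq h]]; exists q; split=> //; first by right.
    by case: hq h => // <-; rewrite p0 eqxx => -[].
  have h2 : dfn1 (fun y => exists2 r : int,
     r \in [seq i%:Z - (`|p.2| * N)%N%:Z | i <- iota 0 (2 * `|p.2| * N).+1] &
     (p.2 %| r - p.1 y)%Z /\ P (y, ((r - p.1 y) %/ p.2)%Z)).
    apply: dfn_ex => r _; apply: (dfnZ_subst hP _ p0).
    by apply: lin_sub; [apply: lin_cst|apply: hl; left].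
  apply: d_ext (dfn_or h1 h2) => y; split.
    case=> [[q [hq h]]|h]; first by exists q; split; first right.
    by exists p; split; first left.
  by case=> q [[<-|hq] [hq0 h]]; [right|left; exists q].
have h2 : dfn1 (fun y => exists2 i : int, i \in [seq j%:Z | j <- iota 0 N] & P (y, i)).
  apply: dfn_ex => i _.
  apply: d_ext (dfnZ_subst hP (lin_cst _ _ _ i) (oner_neq0 _)) => y.
  by rewrite dvdzE dvd1n divz1; split=> [[]|].
apply: d_ext (dfn_or h2 (hd L hL)) => y; split.
  by case=> [[i _ h]|[p [_ [_ [r _ [_ h]]]]]]; [exists i|eexists; apply: h].
case=> k hk; apply: contrapT => /not_orP [n1 n2]; apply: n1.
(* A sign change between [k1] and [k2] would bound the threshold term at [k1] by [|p.2| * N], making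
   [k1] one of the quotients excluded by [n2]. *)
have sgn (k1 k2 : int) : P (y, k1) -> `|k2 - k1| = N%:Z ->
    forall p, List.In p L -> (0 <= p.1 y + p.2 * k1) = (0 <= p.1 y + p.2 * k2).
  move=> hk1 hk2 p hp; have [p0|p0] := eqVneq p.2 0; first by rewrite p0 !mul0r.
  apply: contrapT => hne; apply: n2; exists p; split=> //; split=> //.
  have hb : `|p.1 y + p.2 * k1| <= `|p.2| * N%:Z.
    apply: (@int_sgn_bound _ (p.2 * (k2 - k1))); last by rewrite normrM hk2.
    move/eqP: hne; congr (_ != (0 <= _)).
    by ring.
  exists (p.1 y + p.2 * k1).
    by rewrite -mulnA; apply: int_shift_mem; rewrite PoszM; apply: hb.
  have -> : p.1 y + p.2 * k1 - p.1 y = k1 * p.2 by ring.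
  by rewrite dvdz_mull // mulzK.
have step (k1 k2 : int) : P (y, k1) -> `|k2 - k1| = N%:Z -> P (y, k2).
  move=> hk1 hk2; apply: (proj1 (hthr y k1 k2 _ (sgn k1 k2 hk1 hk2)) hk1).
  have e : absz (k2 - k1) = N by apply/eqP; rewrite -eqz_nat abszE hk2.
  by rewrite dvdzE e.
have steps (n : nat) (k1 : int) : P (y, k1) -> P (y, k1 + n%:Z * N%:Z) /\ P (y, k1 - n%:Z * N%:Z).
  elim: n k1 => [|n IH] k1 h1; first by rewrite mul0r ?subr0 ?addr0.
  have [i1 i2] := IH _ h1; split.
    apply: step i1 _; rewrite intS; have -> : k1 + (1 + n%:Z) * N%:Z - (k1 + n%:Z * N%:Z) = N%:Z by ring. by rewrite ger0_norm.
  apply: step i2 _; rewrite intS; have -> : k1 - (1 + n%:Z) * N%:Z - (k1 - n%:Z * N%:Z) = - N%:Z by ring. by rewrite normrN ger0_norm.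
have hr : P (y, (k %% N%:Z)%Z).
  have -> : (k %% N%:Z)%Z = k - (k %/ N%:Z)%Z * N%:Z by rewrite {2}(divz_eq k N%:Z); ring.
  case: (k %/ N%:Z)%Z => q; first by have [] := steps q _ hk.
  have [h _] := steps q.+1 _ hk; move: h; rewrite NegzE.
  by have -> : k - - q.+1%:Z * N%:Z = k + q.+1%:Z * N%:Z by ring.
have h0 : 0 <= (k %% N%:Z)%Z by apply: modz_ge0; rewrite -lt0n.
have h1 : (k %% N%:Z)%Z < N%:Z by apply: ltz_pmod; rewrite ltz_nat.
exists (k %% N%:Z)%Z => //; apply/mapP; exists (absz (k %% N%:Z)%Z).
  by rewrite mem_iota /= add0n -ltz_nat gez0_abs.
by rewrite gez0_abs.
Qed.

End IntegerQuantifier.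
End Definable.

End Definable.
Import Definable.

(** * Leading terms of sums without cancellation *)

Section Residues.
Variables (F : fieldType) (v : F -> int).
Hypothesis hv : is_padic_val v.
Variable pi : F.
Hypotheses (pi0 : pi != 0) (vpi : v pi = 1).
Local Notation vge := (vge v).
Local Notation ac := (ac v pi).

Lemma vpiz z : v (pi ^ z) = z.
Proof. by rewrite (vXz hv) // vpi mul1r. Qed.

Lemma piz0 z : pi ^ z != 0.
Proof. exact: expfz_neq0. Qed.

Lemma vge_mulpi z w x : vge z (x * pi ^ w) = vge (z - w) x.
Proof. by rewrite mulrC (vge_mulf hv) ?piz0 // vpiz. Qed.

Lemma resid M : exists s : seq F, (forall x, x \in s -> vge 0 x) /\
  forall x, vge 0 x -> exists2 y, y \in s & vge M%:Z (x - y).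
Proof.
have [s1 [h1 h2]] := pv_res_fin hv.
elim: M => [|M [s [hs IH]]].
  exists [:: 0]; split=> [x|x hx]; first by rewrite inE => /eqP->; apply: vge0.
  by exists 0; rewrite ?inE // subr0.
exists [seq a + b * pi ^ M%:Z | a <- s, b <- s1]; split=> [x|x hx].
  case/allpairsP => -[a b] /= [ha hb ->]; apply: (vgeD hv); first exact: hs.
  rewrite vge_mulpi; apply: vge_le (_ : vge 0 b); first by lia.
  exact/inPn_vge/h1.
have [a ha hax] := IH x hx.
have [] := h2 ((x - a) * pi ^ (- M%:Z)).
  by apply/inPn_vge; rewrite vge_mulpi opprK add0r.
move=> b hb /inPn_vge hbx; exists (a + b * pi ^ M%:Z).
  by apply/allpairsP; exists (a, b).
have -> : x - (a + b * pi ^ M%:Z) = ((x - a) * pi ^ (- M%:Z) - b) * pi ^ M%:Z.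
  rewrite mulrBl -mulrA -expfzDr // addNr expr0z mulr1; ring.
by rewrite vge_mulpi; apply: vge_le hbx; lia.
Qed.

Lemma ac_ex M : (0 < M)%N -> exists s : seq F, (forall u, u \in s -> u != 0 /\ v u = 0) /\
  forall x, x != 0 -> exists2 u, u \in s & ac M u x.
Proof.
move=> M0; have [s [hs h]] := resid M.
exists [seq u <- s | (u != 0) && (v u == 0)]; split=> [u|x x0].
  by rewrite mem_filter => /andP[/andP[-> /eqP]].
have x'0 : x * pi ^ (- v x) != 0 by rewrite mulf_neq0 ?piz0.
have vx' : v (x * pi ^ (- v x)) = 0 by rewrite (vM hv) ?piz0 // vpiz subrr.
have [|u hu hux] := h (x * pi ^ (- v x)); first by rewrite vgeE // vx'.
have [u0 vu] : u != 0 /\ v u = v (x * pi ^ (- v x)).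
  apply: (v_eq hv) => //; rewrite -opprB (vgeN hv) vx'.
  by apply: vge_le hux; move: M0; clear; lia.
by exists u; rewrite ?mem_filter ?u0 ?vu ?vx' // /ac x0.
Qed.

Lemma ac_eqrv M M' u x y : (0 < M')%N -> (M <= M')%N -> eqrv v M' x y -> ac M u x = ac M u y.
Proof.
move=> M'0 MM' h; rewrite /ac -!(eqrv_eq0 hv M'0 h).
case: (eqVneq x 0) => //= x0; have [y0 vy] := eqrv_v hv M'0 h x0.
move: h; rewrite /eqrv (negbTE x0) => h; rewrite vy.
have hd : vge M%:Z ((y - x) * pi ^ (- v x)).
  by rewrite vge_mulpi; apply: vge_le h; move: MM' (v x); clear; lia.
have e : y * pi ^ (- v x) - u = (x * pi ^ (- v x) - u) + (y - x) * pi ^ (- v x) by ring.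
apply/idP/idP => h'; first by rewrite e; apply: (vgeD hv).
have -> : x * pi ^ (- v x) - u = (y * pi ^ (- v x) - u) - (y - x) * pi ^ (- v x) by ring.
exact: (vgeB hv).
Qed.

Lemma eqrv_le M M' x y : (M <= M')%N -> eqrv v M' x y -> eqrv v M x y.
Proof.
rewrite /eqrv => MM'; case: ifP => // _; apply: vge_le.
by move: MM' (v x); clear; lia.
Qed.

Lemma eqrv_refl M x : eqrv v M x x.
Proof. by rewrite /eqrv; case: ifP => // _; rewrite subrr vge0. Qed.

Lemma eqrv_vE M x y : (0 < M)%N -> eqrv v M x y -> v x = v y.
Proof.
move=> M0 h; have [x0|x0] := eqVneq x 0; last by have [_ ->] := eqrv_v hv M0 h x0.
by have /eqP -> : y == 0; [rewrite -(eqrv_eq0 hv M0 h) x0|rewrite x0].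
Qed.

Lemma lin_dep R Y (ev : Y -> R -> F) T A t : lin v ev T A t -> forall M y y', (0 < M)%N ->
  (forall t, T t -> t y = t y') -> (forall g, A g -> eqrv v M (ev y g) (ev y' g)) ->
  t y = t y'.
Proof.
move=> h M y y' M0 hT hA; elim: h => {t} [//|t /hT //|g /hA|t1 t2 _ -> _ ->|t _ ->] //.
exact: eqrv_vE.
Qed.

(* Definable predicates depend on finitely many leading terms only. *)
Lemma dfn_dep R Y (ev : Y -> R -> F) T A P : definable v pi ev T A P ->
  exists M : nat, (0 < M)%N /\ forall y y', (forall t, T t -> t y = t y') ->
    (forall g, A g -> eqrv v M (ev y g) (ev y' g)) -> P y <-> P y'.
Proof.
elim=> {P} [g hg|M u g hg|t ht|N t ht|P Q _ [M1 [p1 h1]] _ [M2 [p2 h2]]|P _ [M [p h]]|P Q e _ [M [p h]]].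
- exists 1%N; split=> // y y' _ hA; have := eqrv_eq0 hv (ltn0Sn 0) (hA _ hg).
  by split=> h; apply/eqP; [rewrite -H h|rewrite H h].
- exists M.+1; split=> // y y' _ hA; rewrite (ac_eqrv u (ltn0Sn M) (leqnSn M) (hA _ hg)).
  by [].
- by exists 1%N; split=> // y y' hT hA; rewrite (lin_dep ht (ltn0Sn 0) hT hA).
- by exists 1%N; split=> // y y' hT hA; rewrite (lin_dep ht (ltn0Sn 0) hT hA).
- exists (maxn M1 M2); split; first by rewrite leq_max p1.
  move=> y y' hT hA; rewrite (h1 y y') ?(h2 y y') // => g /hA.
    by apply: eqrv_le; rewrite leq_maxr.
  by apply: eqrv_le; rewrite leq_maxl.
- by exists M; split=> // y y' hT hA; rewrite (h y y').
- by exists M; split=> // y y' hT hA; rewrite -!e; apply: h.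
Qed.

Section Sums.
Variables (R Y : Type) (ev : Y -> R -> F) (T : (Y -> int) -> Prop) (A : R -> Prop).
Local Notation lin1 := (lin v ev T A).
Local Notation dfn1 := (definable v pi ev T A).

(** Functions into the field whose leading terms to every precision are definable, although the
    function itself need not be given by a ring element. *)
Definition definable_fun (a : Y -> F) := [/\ dfn1 (fun y => a y = 0),
  exists2 t, lin1 t & forall y, a y <> 0 -> v (a y) = t y &
  forall M u, dfn1 (fun y => ac M u (a y))].

Lemma mt_term g z u l : A g -> lin1 z -> u != 0 -> v u = 0 ->
  definable_fun (fun y => ev y g * (pi ^ z y * u) ^+ l).
Proof.
move=> hg hz u0 vu.
have n0 y : (pi ^ z y * u) ^+ l != 0 by rewrite expf_neq0 // mulf_neq0 // piz0.
have vn y : v ((pi ^ z y * u) ^+ l) = l%:Z * z y.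
  by rewrite (vX hv) ?mulf_neq0 ?piz0 // (vM hv) ?piz0 // vpiz vu addr0 mulrC.
split.
- apply: d_ext (d_zero v pi ev T hg) => y; split=> [->|/eqP]; first by rewrite mul0r.
  by rewrite mulf_eq0 (negbTE (n0 y)) orbF => /eqP.
- exists (fun y => v (ev y g) + l%:Z * z y).
    by apply: lin_add; [apply: lin_val|apply: lin_mulz].
  by move=> y /eqP; rewrite mulf_eq0 (negbTE (n0 y)) orbF => g0; rewrite (vM hv) ?vn.
move=> M w; apply: d_ext (d_ac v pi ev T M (w / u ^+ l) hg) => y.
rewrite /ac mulf_eq0 (negbTE (n0 y)) orbF.
case: (eqVneq (ev y g) 0) => //= g0.
rewrite (vM hv) // vn.
have -> : ev y g * (pi ^ z y * u) ^+ l * pi ^ (- (v (ev y g) + l%:Z * z y)) - w =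
   u ^+ l * (ev y g * pi ^ (- v (ev y g)) - w / u ^+ l).
  rewrite opprD expfzDr // exprMn mulrBr mulrC.
  have -> : (pi ^ z y) ^+ l = pi ^ (l%:Z * z y) by rewrite exprnP exprz_exp mulrC.
  have e : pi ^ (l%:Z * z y) * pi ^ (- (l%:Z * z y)) = 1 by rewrite -expfzDr // subrr expr0z.
  have -> : u ^+ l * (w / u ^+ l) = w by rewrite mulrCA divff ?mulr1 // expf_neq0.
  congr (_ - _); rewrite -[RHS]mulr1 -e; ring.
by rewrite (vge_mulf hv) ?expf_neq0 // (vX hv) // vu mul0r subr0.
Qed.

Lemma mt_vge a t : definable_fun a -> lin1 t -> dfn1 (fun y => vge (t y) (a y)).
Proof.
move=> [h0 [ta hta e] _] ht.
apply: d_ext (dfn_or h0 (d_and (d_not h0) (dfn_le pi ht hta))) => y.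
split=> [[->|[n0]]|]; first exact: vge0.
  by rewrite -e // => h; rewrite /Valuation.vge h orbT.
have [->|n0] := eqVneq (a y) 0; first by left.
by rewrite vgeE // => h; right; split; [exact/eqP|rewrite -e //; exact/eqP].
Qed.

(** A residue divisible by [pi^W] is a condition on the valuation. Any other residue, of valuation
    [j], prescribes the valuation exactly and then the angular component modulo [pi^(W - j)]. *)
Lemma mt_res a t W r : definable_fun a -> lin1 t -> vge 0 r ->
  dfn1 (fun y => vge (t y) (a y) /\ vge W%:Z (a y * pi ^ (- t y) - r)).
Proof.
move=> ha ht hr.
have [hW|hW] := boolP (vge W%:Z r).
  have hl : lin1 (fun y => t y + W%:Z) by apply: lin_add => //; apply: lin_cst.
  apply: d_ext (mt_vge ha hl) => y; split=> [h|[_ h]].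
    split; first by apply: vge_le h; lia.
    by apply: (vgeB hv) => //; rewrite vge_mulpi opprK addrC.
  by have := vgeD hv h hW; rewrite subrK vge_mulpi opprK addrC.
have r0 : r != 0 by apply: contraNneq hW => ->; rewrite vge0.
rewrite vgeE // in hr; rewrite vgeE // -ltNge in hW.
set j := absz (v r); have vr : v r = j%:Z by rewrite /j gez0_abs.
rewrite vr in hW.
have [h0 [ta hta e] hac] := ha.
have hl : lin1 (fun y => t y + j%:Z) by apply: lin_add => //; apply: lin_cst.
apply: d_ext (d_and (d_not h0) (d_and (dfn_eqz pi hta hl) (hac (W - j)%N (r * pi ^ (- j%:Z))))) => y.
have key : a y != 0 -> v (a y) = t y + j%:Z ->
    ac (W - j) (r * pi ^ (- j%:Z)) (a y) = vge W%:Z (a y * pi ^ (- t y) - r).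
  move=> a0 va; rewrite /ac a0 va /=.
  have -> : a y * pi ^ (- (t y + j%:Z)) - r * pi ^ (- j%:Z) = (a y * pi ^ (- t y) - r) * pi ^ (- j%:Z).
    by rewrite opprD expfzDr //; ring.
  by rewrite vge_mulpi; congr (Valuation.vge _ _ _); move: hW; clear; lia.
split=> [[/eqP a0]|[h1 h2]].
  rewrite -e; last by apply/eqP.
  move=> [va]; rewrite key // => ->; split=> //.
  by rewrite vgeE // va; clear; lia.
have [x0 vx] : a y * pi ^ (- t y) != 0 /\ v (a y * pi ^ (- t y)) = v r.
  by apply: (v_eq hv) => //; apply: vge_le h2; rewrite vr; move: hW; clear; lia.
have a0 : a y != 0 by apply: contraNneq x0 => ->; rewrite mul0r.
have va : v (a y) = t y + j%:Z.
  by move: vx; rewrite (vM hv) ?piz0 // vpiz vr; move: (v (a y)) (t y); clear; lia.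
split; first exact/eqP.
by rewrite key // -e //; apply/eqP.
Qed.

(** [phi] only sees the scaled sum modulo [pi^W], and each scaled term has finitely many residues.
    The last term is removed by a case distinction over these, its residue being absorbed into
    [c]. *)
Lemma sumdef n (a : nat -> Y -> F) t W (phi : F -> Prop) :
  (forall l, (l < n)%N -> definable_fun (a l)) -> lin1 t ->
  (forall x x', vge W%:Z (x - x') -> phi x -> phi x') ->
  forall c, dfn1 (fun y => (forall l, (l < n)%N -> vge (t y) (a l y)) /\
     phi (c + \sum_(l < n) a l y * pi ^ (- t y))).
Proof.
move=> ha ht hphi; elim: n ha => [|n IH] ha c.
  apply: d_ext (dfn_const _ _ _ _ _ (phi c)) => y.
  by rewrite big_ord0 addr0; split=> [|[]].
have [s [hs hex]] := resid W.
have IH' : forall r, dfn1 (fun y => (forall l, (l < n)%N -> vge (t y) (a l y)) /\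
     phi (c + r + \sum_(l < n) a l y * pi ^ (- t y))).
  by move=> r; apply: IH => l hl; apply: ha; apply: ltnW.
have H : dfn1 (fun y => exists2 r, r \in s & (vge (t y) (a n y) /\ vge W%:Z (a n y * pi ^ (- t y) - r))
   /\ ((forall l, (l < n)%N -> vge (t y) (a l y)) /\
     phi (c + r + \sum_(l < n) a l y * pi ^ (- t y)))).
  apply: dfn_ex => r hr; apply: d_and => //; apply: mt_res => //; last exact: hs.
  exact: ha.
apply: d_ext H => y; rewrite big_ord_recr /=; split.
  case=> r hr [[h1 h2] [h3 h4]]; split.
    by move=> l; rewrite ltnS leq_eqVlt => /orP[/eqP->//|]; apply: h3.
  apply: hphi h4; rewrite -opprB (vgeN hv).
  have -> // : c + (\sum_(i < n) a i y * pi ^ (- t y) + a n y * pi ^ (- t y)) -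
     (c + r + \sum_(l < n) a l y * pi ^ (- t y)) = a n y * pi ^ (- t y) - r by ring.
case=> h1 h2.
have [|r hr hr2] := hex (a n y * pi ^ (- t y)).
  by rewrite vge_mulpi opprK add0r; apply: h1.
exists r => //; split; first by split=> //; apply: h1.
split; first by move=> l hl; apply: h1; apply: ltnW.
apply: hphi h2.
have -> // : c + (\sum_(i < n) a i y * pi ^ (- t y) + a n y * pi ^ (- t y)) -
     (c + r + \sum_(l < n) a l y * pi ^ (- t y)) = a n y * pi ^ (- t y) - r by ring.
Qed.

Lemma argmin_v n (b : nat -> F) : (exists2 l, (l < n)%N & b l != 0) ->
  exists l0, [/\ (l0 < n)%N, b l0 != 0 & forall l, (l < n)%N -> vge (v (b l0)) (b l)].
Proof.
elim: n => [[l]//|n IH] [l hl bl].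
have [h|h] := pselect (exists2 l, (l < n)%N & b l != 0); last first.
  have ln : l = n.
    apply/eqP; move: hl; rewrite ltnS leq_eqVlt => /orP[//|hl].
    by case: h; exists l.
  exists n; rewrite -ln bl ltnSn; split=> // k; rewrite ltnS leq_eqVlt => /orP[/eqP->|hk].
    exact: vge_self.
  have [->|bk] := eqVneq (b k) 0; first exact: vge0.
  by case: h; exists k; rewrite // -ln.
have [l0 [h1 h2 h3]] := IH h.
have [hn|hn] := boolP (vge (v (b l0)) (b n)).
  exists l0; split=> //; first exact: ltnW.
  by move=> k; rewrite ltnS leq_eqVlt => /orP[/eqP->|] //; apply: h3.
have bn : b n != 0 by apply: contraNneq hn => ->; rewrite vge0.
move: hn; rewrite vgeE // -ltNge => hn.
exists n; split=> // k; rewrite ltnS leq_eqVlt => /orP[/eqP->|hk]; first exact: vge_self.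
by apply: vge_le (h3 _ hk); apply: ltW.
Qed.

Section SumOfTerms.
Variables (n : nat) (a : nat -> Y -> F).
Hypothesis ha : forall l, (l < n)%N -> definable_fun (a l).
Let S y := \sum_(l < n) a l y.

(** Here [l0] indexes a term of least valuation, and [phi] tests the sum scaled by that term. *)
Definition core l0 (phi : F -> Prop) y := a l0 y != 0 /\
  (forall l, (l < n)%N -> vge (v (a l0 y)) (a l y)) /\ phi (S y * pi ^ (- v (a l0 y))).

Lemma core_dfn l0 W (phi : F -> Prop) : (l0 < n)%N ->
  (forall x x', vge W%:Z (x - x') -> phi x -> phi x') -> dfn1 (core l0 phi).
Proof.
move=> hl0 hphi; have [h0 [t ht e] _] := ha hl0.
apply: d_ext (d_and (d_not h0) (sumdef ha ht hphi 0)) => y.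
rewrite /core -mulr_suml add0r.
by split=> -[/eqP n0]; [rewrite -e //; apply/eqP|rewrite e //; split=> //; apply/eqP].
Qed.

Definition no_cancellation e y := forall l, (l < n)%N -> dominated v e (S y) (a l y).

Lemma goodP e y : no_cancellation e y <-> (forall l, (l < n)%N -> a l y = 0) \/
  exists2 l0, l0 \in iota 0 n & core l0 (fun x => ~ vge e.+1%:Z x) y.
Proof.
split=> [h|].
  have [hz|hz] := pselect (forall l, (l < n)%N -> a l y = 0); first by left.
  right; have [|l0 [h1 h2 h3]] := @argmin_v n (a^~ y).
    apply: contrapT => hn; apply: hz => l hl; apply/eqP; apply: contraT => n0.
    by case: hn; exists l.
  exists l0; first by rewrite mem_iota.
  split=> //; split=> //; apply/negP; have := h _ h1; rewrite /dominated.
  case: eqVneq => [S0|S0]; first by rewrite (negbTE h2).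
  rewrite vge_mulpi opprK !vgeE //; move: (v (S y)) (v (a l0 y)) => p q; clear; lia.
case=> [hz l hl|[l0 _ [n0 [hm /negP hS]]] l hl]; first by rewrite (hz _ hl) dom0.
rewrite /dominated; case: eqVneq => [S0|S0].
  by move: hS; rewrite S0 mul0r vge0.
apply: vge_le (hm _ hl); move: hS; rewrite vge_mulpi opprK vgeE //.
by move: (v (S y)) (v (a l0 y)) => p q; clear; lia.
Qed.

Lemma allzero_dfn : dfn1 (fun y => forall l, (l < n)%N -> a l y = 0).
Proof.
apply: d_ext (dfn_all (s := iota 0 n) (P := fun l y => a l y = 0) _).
  by move=> y; split=> h l hl; apply: h; move: hl; rewrite mem_iota.
by move=> l; rewrite mem_iota /= => hl; have [] := ha hl.
Qed.

Lemma good_dfn e : dfn1 (no_cancellation e).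
Proof.
apply: d_ext (_ : dfn1 (fun y => _ \/ _)); first by move=> y; symmetry; apply: goodP.
apply: dfn_or; first exact: allzero_dfn.
apply: dfn_ex => l0; rewrite mem_iota /= => hl0; apply: (@core_dfn _ e.+1) => //.
move=> x x' h nx hx'; apply: nx.
by rewrite -(subrK x' x); apply: (vgeD hv).
Qed.

Lemma S_zero y : (forall l, (l < n)%N -> a l y = 0) -> S y = 0.
Proof. by move=> h; rewrite /S big1 // => i _; apply: h. Qed.

Lemma good_zero e : dfn1 (fun y => no_cancellation e y /\ S y = 0).
Proof.
apply: d_ext allzero_dfn => y; split=> [h|[hg S0] l hl].
  by split; [apply/goodP; left|apply: S_zero].
by apply/eqP; have := hg _ hl; rewrite /dominated S0 eqxx.
Qed.

(** Without cancellation the scaled sum has valuation at most [e], so its residue modulo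
    [pi^(e + 1 + M)] fixes its leading term to more than [M] digits. *)
Lemma good_ac e M u : dfn1 (fun y => no_cancellation e y /\ ac M u (S y)).
Proof.
have H : dfn1 (fun y => exists2 l0, l0 \in iota 0 n &
    core l0 (fun x => ~ vge e.+1%:Z x /\ ac M u x) y).
  apply: dfn_ex => l0; rewrite mem_iota /= => hl0; apply: (@core_dfn _ (e.+1 + M)) => //.
  move=> x x' h [nx hx].
  have x0 : x != 0 by apply/negP => /eqP x0; apply: nx; rewrite x0 vge0.
  have vx : v x <= e%:Z by move/negP: nx; rewrite vgeE //; lia.
  have he : eqrv v M.+1 x x'.
    rewrite /eqrv (negbTE x0) -opprB (vgeN hv); apply: vge_le h.
    by move: vx; move: (v x); clear; lia.
  split; last by rewrite -(ac_eqrv u (ltn0Sn M) (leqnSn M) he).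
  move=> hx'; apply: nx; rewrite -(subrK x' x); apply: (vgeD hv) => //.
  by apply: vge_le h; clear; lia.
have hac (l0 : nat) y : ac M u (S y * pi ^ (- v (a l0 y))) = ac M u (S y).
  rewrite /ac mulf_eq0 (negbTE (piz0 _)) orbF; case: eqVneq => //= S0.
  rewrite (vM hv) ?piz0 // vpiz -mulrA -expfzDr //.
  by congr (Valuation.vge _ _ (_ * pi ^ _ - _)); move: (v (S y)) (v (a l0 y)); clear; lia.
apply: d_ext H => y; split=> [[l0 hl0 [n0 [hm [h1 h2]]]]|[hg h]].
  split; first by apply/goodP; right; exists l0.
  by rewrite hac in h2.
move/goodP: hg => [hz|[l0 hl0 [n0 [hm h1]]]].
  by move: h; rewrite S_zero // /ac eqxx.
by exists l0 => //; split=> //; split=> //; rewrite hac.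
Qed.

(** The valuation of the sum exceeds that of a minimal term [l] by some [j <= e]; each pair [(l, j)]
    gives one linear piece. The piece [None], where all terms vanish, has the constant value
    [v 0]. *)
Lemma good_v e : pwl v pi ev T A (no_cancellation e) (fun y => v (S y)).
Proof.
pose tau (l : nat) : Y -> int := if pselect (exists t, lin1 t /\ forall y, a l y <> 0 -> v (a l y) = t y)
  is left h then projT1 (cid h) else fun=> 0.
have htau l : (l < n)%N -> lin1 (tau l) /\ forall y, a l y <> 0 -> v (a l y) = tau l y.
  move=> hl; rewrite /tau; case: pselect => [h|[]]; first by case: (cid h).
  by have [_ [t ht e'] _] := ha hl; exists t.
pose I := None :: [seq Some (l, j) | l <- iota 0 n, j <- iota 0 (e + 1)].
pose D (i : option (nat * nat)) y := if i is Some (l, j)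
  then core l (fun x => x != 0 /\ v x = j%:Z) y else forall l, (l < n)%N -> a l y = 0.
pose ta (i : option (nat * nat)) : Y -> int := if i is Some (l, j)
  then (fun y => tau l y + j%:Z) else fun=> v 0.
apply: (@pwl_cover _ _ _ _ _ _ _ _ _ I D ta).
- move=> i; rewrite inE => /orP[/eqP->|/allpairsP[[l j] /= [hl hj ->]]].
    exact: allzero_dfn.
  move: hl hj; rewrite !mem_iota /= => hl hj; apply: (@core_dfn _ e.+1) => //.
  move=> x x' h [x0 vx]; have [] := @v_eq _ _ hv x x' x0; last by move=> -> ->.
  by rewrite -opprB (vgeN hv); apply: vge_le h; rewrite vx; move: hj; clear; lia.
- move=> i; rewrite inE => /orP[/eqP->|/allpairsP[[l j] /= [hl hj ->]]].
    exact: lin_cst.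
  apply: lin_add; last exact: lin_cst.
  by move: hl; rewrite mem_iota /= => /htau [].
- move=> y /goodP [hz|[l0 hl0 [n0 [hm h1]]]]; first by exists None; rewrite ?inE.
  set x := S y * _ in h1.
  have x0 : x != 0 by apply/negP => /eqP x0; apply: h1; rewrite x0 vge0.
  have vx0 : 0 <= v x.
    rewrite -vgeE // /x vge_mulpi opprK add0r; apply: (vge_sum hv) => i _; exact: hm.
  exists (Some (l0, absz (v x))).
    rewrite inE /=; apply/allpairsP; exists (l0, absz (v x)); split=> //=.
    by rewrite !mem_iota /=; move/negP: h1; rewrite vgeE //; move: vx0; clear; lia.
  by split=> //; split=> //; rewrite gez0_abs.
- move=> y i hi hg hD; move: hi hD; rewrite inE => /orP[/eqP->|/allpairsP[[l j] /= [hl hj ->]]] /=.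
    by move=> hz; rewrite S_zero.
  case=> n0 [hm [x0 vx]].
  move: hl; rewrite mem_iota /= => /htau [_ e']; rewrite -e'; last exact/eqP.
  have S0 : S y != 0 by apply: contraNneq x0 => ->; rewrite mul0r.
  by move: vx; rewrite (vM hv) ?piz0 // vpiz; move: (v (S y)) (v (a l y)); clear; lia.
Qed.

End SumOfTerms.
End Sums.
End Residues.

(** * Elimination of field quantifiers *)

Module Specialization.

Section PolyPoints.
Variables (F : fieldType) (R : idomainType) (Y : Type) (ev : Y -> {rmorphism R -> F}).

Definition sp (y : Y) (g : {poly R}) : {poly F} := map_poly (ev y) g.

(** Polynomials stay over an abstract ring and are specialised at [y] only on evaluation: one finite
    family has to serve all [y], while degrees may drop under specialisation. *)
Definition evP (p : Y * F) : {rmorphism {poly R} -> F} := horner_eval p.2 \o map_poly (ev p.1).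

Definition TP (T : (Y -> int) -> Prop) (t : Y * F -> int) : Prop :=
  exists2 t0, T t0 & t = (fun p => t0 p.1).

Lemma evPE y c g : evP (y, c) g = (sp y g).[c].
Proof. by []. Qed.

Lemma size_sp y g : (size (sp y g) <= size g)%N.
Proof. exact: size_poly. Qed.

Lemma sp_derivn y g k : (sp y g)^`(k) = sp y g^`(k).
Proof. by rewrite /sp derivn_map. Qed.

Lemma size_derivn_le (K : nzRingType) (g : {poly K}) k : (size g^`(k) <= size g)%N.
Proof.
elim: k => [|k IH]; first by rewrite derivn0.
rewrite derivnS; have [->|n0] := eqVneq g^`(k) 0; first by rewrite deriv0 size_poly0.
by apply: leq_trans IH; apply: ltnW; apply: lt_size_deriv.
Qed.

Lemma derivn_size0 (K : nzRingType) (g : {poly K}) k : (size g <= k)%N -> g^`(k) = 0.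
Proof. exact: derivn_poly0. Qed.

End PolyPoints.

Section FieldQuantifier.
Variables (F : fieldType) (v : F -> int).
Hypothesis hv : is_padic_val v.
Variable pi : F.
Hypotheses (pi0 : pi != 0) (vpi : v pi = 1).
Local Notation vge := (vge v).
Local Notation ac := (ac v pi).

Section Step.
Variables (R : idomainType) (Y : Type) (ev : Y -> {rmorphism R -> F}).
Variable (T : (Y -> int) -> Prop).

Local Notation sp := (sp ev).
Local Notation dfn1 := (definable v pi (fun y => ev y : R -> F) T (fun=> True)).
Local Notation dfnPA A := (definable v pi (fun p => evP ev p : {poly R} -> F) (TP T) A).
Local Notation dfnP := (dfnPA (fun=> True)).
Local Notation dfn3 := (definable v pi (evZ (fun p => evP ev p : {poly R} -> F)) (TZ (TP T)) (fun=> True)).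

Definition units_for M (U : seq F) := (forall u, u \in U -> u != 0 /\ v u = 0) /\
  forall x, x != 0 -> exists2 u, u \in U & ac M u x.

Definition derivs D (s : seq {poly R}) := [seq g^`(k) | g <- s, k <- iota 0 D].

Lemma mem_derivs D s g k : g \in s -> (k < D)%N -> g^`(k) \in derivs D s.
Proof. by move=> hg hk; apply/allpairsP; exists (g, k); rewrite mem_iota. Qed.

Lemma sub_derivs D s g : (0 < D)%N -> g \in s -> g \in derivs D s.
Proof. by move=> D0 hg; rewrite -[g]derivn0; apply: mem_derivs. Qed.

(* Every [t] is [b + pi^z * u] up to a factor close to 1 on [pi^z * u], with [b] a root of a member of the family
   and [u] in a finite set: a quantifier over [t] becomes one over roots, integers and a finite set. *)
Lemma center_step (s : seq {poly R}) D : 'X \in s -> (forall g, g \in s -> (size g <= D)%N) ->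
  exists e : nat, forall M U, (e < M)%N -> units_for M U -> forall y t,
  exists2 g, g \in derivs D s & exists b, [/\ sp y g != 0, (sp y g).[b] = 0 &
    t = b \/ exists z u eta, [/\ u \in U, t != b, vge 0 eta /\ vge M%:Z (eta - 1),
      pi ^ z * u = (t - b) * eta &
      forall g, g \in derivs D s -> centred v e (sp y g) b (b + pi ^ z * u) /\
        eqrv v (M - e) (sp y g).[t] (sp y g).[b + pi ^ z * u]]].
Proof.
move=> hX hD; have [E hE] := nat_val_bound v D.
have [e he] := center hv hE; exists e => M U eM [hU1 hU2] y t.
have D0 : (0 < D)%N by apply: leq_trans (hD _ hX); rewrite size_polyX.
have hs : forall p, p \in [seq sp y g | g <- s] -> (size (p : {poly F}) <= D)%N.
  by move=> p /mapP[g hg ->]; apply: leq_trans (size_sp _ _ _) (hD _ hg).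
have [b [be [_ _ hb hgd]]] := he _ hs 0 t.
have hroot : exists2 g, g \in derivs D s & sp y g != 0 /\ (sp y g).[b] = 0.
  (* The search starts from the centre 0; if it never moves, 0 is a root of ['X]. *)
  case: hb => [->|[p [k [/mapP[g hg ->] hk1 hk2]]]].
    exists 'X; first exact: sub_derivs.
    by rewrite /sp map_polyX polyX_eq0 hornerX.
  exists g^`(k); last by rewrite -sp_derivn.
  apply: mem_derivs => //; rewrite ltnNge; apply: contra hk1 => hk.
  by rewrite derivn_size0 //; apply: leq_trans (size_sp _ _ _) (leq_trans (hD _ hg) hk).
have hgd' g : g \in derivs D s -> centred v e (sp y g) b t.
  case/allpairsP => -[g' k] /= [hg _ ->]; rewrite -sp_derivn; apply: hgd.
  by apply/mapP; exists g'.
case: hroot => g0 hg0 [hn hr]; exists g0 => //; exists b; split=> //.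
have [->|tb] := eqVneq t b; first by left.
right; have st0 : t - b != 0 by rewrite subr_eq0.
have [u hu hac] := hU2 _ st0.
have [u0 vu] := hU1 _ hu.
(* The product [pi^z * u] is [t - b] with its angular component replaced by a representative, so the
   quotient [eta] is congruent to 1 modulo [pi^M]. *)
exists (v (t - b)), u, (pi ^ v (t - b) * u / (t - b)).
set eta := _ / (t - b).
have he' : pi ^ v (t - b) * u = (t - b) * eta by rewrite /eta mulrCA divff // mulr1.
have heta : vge M%:Z (eta - 1).
  move: hac; rewrite /Definable.ac st0 /=.
  have -> : (t - b) * pi ^ (- v (t - b)) - u = (t - b) * pi ^ (- v (t - b)) * (1 - eta).
    rewrite mulrBr mulr1 /eta; congr (_ - _).
    have hp := piz0 pi0 (v (t - b)).
    by rewrite -invr_expz; field; rewrite st0 hp.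
  rewrite (vge_mulf hv); last by rewrite mulf_neq0 // piz0.
  by rewrite (vM hv) ?piz0 // (vpiz hv pi0 vpi) subrr subr0 -(vgeN hv) opprB.
have heta0 : vge 0 eta.
  by rewrite -(subrK 1 eta); apply: (vgeD hv) (vge1 hv); apply: vge_le heta.
split=> // g hg; rewrite he'.
exact: (gd_perturb hv (hgd' _ hg) heta0 heta eM).
Qed.

Definition term (g : {poly R}) u l (q : (Y * F) * int) : F := evP ev q.1 g^`N(l) * (pi ^ q.2 * u) ^+ l.

Lemma termE (g : {poly R}) u l y b z : term g u l ((y, b), z) = (aff (sp y g) b (pi ^ z * u))`_l.
Proof. by rewrite /term evPE coef_aff /Specialization.sp nderivn_map. Qed.

Lemma size_aff (p : {poly F}) b s : (size (aff p b s) <= size p)%N.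
Proof. by apply/leq_sizeP => j hj; rewrite coef_aff nderivn_poly0 ?horner0 ?mul0r. Qed.

Lemma term_sum (g : {poly R}) u y b z :
  \sum_(l < size g) term g u l ((y, b), z) = (sp y g).[b + pi ^ z * u].
Proof.
rewrite -[pi ^ z * u]mulr1 -aff_horner (@horner_coef_wide _ (size g)).
  by apply: eq_bigr => l _; rewrite termE expr1n mulr1.
exact: leq_trans (size_aff _ _ _) (size_sp _ _ _).
Qed.

Lemma mt_terms (g : {poly R}) u l : u != 0 -> v u = 0 ->
  definable_fun v pi (evZ (fun p => evP ev p : {poly R} -> F)) (TZ (TP T)) (fun=> True) (term g u l).
Proof.
move=> u0 vu; apply: (mt_term hv pi0 vpi (ev := evZ (fun p => evP ev p : {poly R} -> F))
  (T := TZ (TP T)) (A := fun=> True) (g := g^`N(l)) (z := snd) l) => //.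
by apply: lin_var; right.
Qed.

Definition no_cancellation_all e (Gs : seq {poly R}) u (q : (Y * F) * int) :=
  forall g, g \in Gs -> no_cancellation v (size g) (term g u) e q.

Lemma GoodE e Gs u y b z : no_cancellation_all e Gs u ((y, b), z) <->
  forall g, g \in Gs -> centred v e (sp y g) b (b + pi ^ z * u).
Proof.
have key (g : {poly R}) : no_cancellation v (size g) (term g u) e ((y, b), z) <-> centred v e (sp y g) b (b + pi ^ z * u).
  rewrite /no_cancellation term_sum /centred; split=> h l; last first.
    by move=> _; have := h l; rewrite [b + _]addrC addrK termE.
  rewrite [b + _ - b]addrAC subrr add0r.
  have [hl|hl] := ltnP l (size g); first by rewrite -termE; apply: h.
  rewrite nth_default ?dom0 //.
  exact: leq_trans (leq_trans (size_aff _ _ _) (size_sp _ _ _)) hl.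
by split=> h g hg; apply/key; apply: h.
Qed.

Lemma Good_dfn e Gs u : u != 0 -> v u = 0 -> dfn3 (no_cancellation_all e Gs u).
Proof.
move=> u0 vu; apply: dfn_all => g hg; apply: (good_dfn hv pi0 vpi) => l _.
exact: mt_terms.
Qed.

(** Where the expansions at [b] do not cancel, the leading terms of [g] at [b + pi^z * u] are those
    of a sum of terms monomial in [pi^z * u], hence definable in [y], [b] and [z]. *)
Lemma Good_subst e Gs u P : u != 0 -> v u = 0 -> dfnPA (fun g => g \in Gs) P ->
  dfn3 (fun q => no_cancellation_all e Gs u q /\ P (q.1.1, q.1.2 + pi ^ q.2 * u)).
Proof.
move=> u0 vu hP.
have hmt (g : {poly R}) l : definable_fun v pi (evZ (fun p => evP ev p : {poly R} -> F)) (TZ (TP T)) (fun=> True) (term g u l).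
  exact: mt_terms.
have hG := Good_dfn e Gs u0 vu.
have he g y b z : evP ev (y, b + pi ^ z * u) g = \sum_(l < size g) term g u l ((y, b), z).
  by rewrite term_sum evPE.
apply: dfn_subst hP => //.
- move=> t [t0 ht0 ->]; apply: pwl_lin (lin_var _ _ _ _) _; last first.
    by move=> q _; reflexivity.
  by left; exists (fun p => t0 p.1) => //; exists t0.
- move=> g hg; apply: d_ext (d_and hG (good_zero hv pi0 vpi (fun l _ => hmt g l) e)) => -[[y b] z].
  split=> [[h1 [_ h3]]|[h1 h2]]; split=> //; first exact: (etrans (he g y b z) h3).
  by split; [apply: h1|apply: (etrans (esym (he g y b z)) h2)].
- move=> g M w hg; apply: d_ext (d_and hG (good_ac hv pi0 vpi (fun l _ => hmt g l) e M w)) => -[[y b] z].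
  split=> [[h1 [_ h3]]|[h1 h2]]; split=> //; first exact: (etrans (congr1 (ac M w) (he g y b z)) h3).
  by split; [apply: h1|apply: (etrans (congr1 (ac M w) (esym (he g y b z))) h2)].
- move=> g hg; apply: (pwl_sub (G := no_cancellation v (size g) (term g u) e)); first by move=> q; apply.
  have := good_v hv pi0 vpi (fun l (_ : (l < size g)%N) => hmt g l) e.
  by congr (pwl _ _ _ _ _ _ _); apply/funext => -[[y b] z]; apply: (congr1 v (esym (he g y b z))).
Qed.

(** This allows evaluation to be changed to another rule, such as a pseudo-remainder divided by a
    power of the leading coefficient, as long as both agree on [H]. *)
Lemma dfn_agree R' Y' (ev1 ev2 : Y' -> R' -> F) T' A (H : Y' -> Prop) P :
  (forall y g, H y -> A g -> ev1 y g = ev2 y g) -> definable v pi ev1 T' A P ->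
  exists2 P2, definable v pi ev2 T' A P2 & forall y, H y -> P y <-> P2 y.
Proof.
move=> h.
have hl t : lin v ev1 T' A t -> exists2 t2, lin v ev2 T' A t2 & forall y, H y -> t y = t2 y.
  elim=> {t} [c|t ht|g hg|t1 t2 _ [a1 l1 e1] _ [a2 l2 e2]|t _ [a l e]].
  - by exists (fun=> c) => //; apply: lin_cst.
  - by exists t => //; apply: lin_var.
  - by exists (fun y => v (ev2 y g)); [apply: lin_val|move=> y hy; rewrite h].
  - by exists (fun y => a1 y + a2 y); [apply: lin_add|move=> y hy; rewrite e1 ?e2].
  - by exists (fun y => - a y); [apply: lin_opp|move=> y hy; rewrite e].
elim=> {P} [g hg|M u g hg|t ht|N t ht|P Q _ [P2 p2 e] _ [Q2 q2 e2]|P _ [P2 p2 e]|P Q e _ [P2 p2 e2]].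
- by exists (fun y => ev2 y g = 0); [apply: d_zero|move=> y hy; rewrite h].
- by exists (fun y => ac M u (ev2 y g)); [apply: d_ac|move=> y hy; rewrite h].
- by have [t2 l2 e] := hl _ ht; exists (fun y => 0 <= t2 y); [apply: d_ge|move=> y hy; rewrite e].
- by have [t2 l2 e] := hl _ ht; exists (fun y => (N %| t2 y)%Z); [apply: d_dvd|move=> y hy; rewrite e].
- exists (fun y => P2 y /\ Q2 y); first exact: d_and.
  by move=> y hy; rewrite e // e2.
- exists (fun y => ~ P2 y); first exact: d_not.
  by move=> y hy; rewrite e.
- by exists P2 => // y hy; rewrite -e e2.
Qed.

Lemma ac_int M u x : (0 < M)%N -> ac M u x -> vge 0 u.
Proof.
move=> M0 /andP[x0 h]; rewrite -[u](subKr (x * pi ^ (- v x))); apply: (vgeB hv).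
  by rewrite (vge_mulpi hv) // opprK add0r vge_self.
by apply: vge_le h; lia.
Qed.

(** Angular components are multiplicative, and that of [d] takes finitely many values [w]; in each
    case the condition on the quotient is one on [x]. *)
Lemma ac_quot M : (0 < M)%N -> exists s : seq F, (forall w, w \in s -> w != 0) /\
  forall u x d k, d != 0 -> ac M u (x / d ^+ k) <->
   exists2 w, w \in s & ac M w d /\ ac M (u * w ^+ k) x.
Proof.
move=> M0; have [s [hs hex]] := ac_ex hv pi0 vpi M0.
exists s; split=> [w /hs []//|u x d k d0].
have key w : vge 0 u -> w \in s -> ac M w d -> ac M u (x / d ^+ k) = ac M (u * w ^+ k) x.
  move=> hu hw hd; have [w0 vw] := hs _ hw.
  rewrite /Definable.ac mulf_eq0 invr_eq0 expf_eq0 (negbTE d0) andbF orbF.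
  case: (eqVneq x 0) => //= x0.
  have dk0 : d ^+ k != 0 by rewrite expf_neq0.
  set d' := d * pi ^ (- v d); set x' := x * pi ^ (- v x).
  have d'0 : d' != 0 by rewrite mulf_neq0 ?piz0.
  have vd' : v d' = 0 by rewrite (vM hv) ?piz0 // (vpiz hv pi0 vpi) subrr.
  have -> : x / d ^+ k * pi ^ (- v (x / d ^+ k)) = x' / d' ^+ k.
    rewrite (vM hv) ?invr_eq0 // (vV hv) // (vX hv) // opprD opprK expfzDr //.
    have -> : d' ^+ k = d ^+ k / pi ^ (v d * k%:Z).
      by rewrite exprMn -invr_expz exprVn exprnP exprz_exp.
    rewrite /x' [in RHS]invf_div; ring.
  move: hd; rewrite /Definable.ac d0 /= -/d' => hd.
  have hl : vge M%:Z (u * (d' ^+ k - w ^+ k)).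
    have hi : vge 0 d' by rewrite vgeE // vd'.
    have hwi : vge 0 w by rewrite vgeE // vw.
    have := int_lip hv (intp_exp hv k (intpX hv)) hi hwi hd.
    by rewrite !hornerXn; apply: (vgeM0 hv).
  have -> : vge M%:Z (x' / d' ^+ k - u) = vge M%:Z (x' - u * d' ^+ k).
    have -> : x' - u * d' ^+ k = d' ^+ k * (x' / d' ^+ k - u).
      by rewrite mulrBr [X in _ = X - _]mulrCA divff ?expf_neq0 // mulr1 [d' ^+ k * u]mulrC.
    by rewrite (vge_mulf hv) ?expf_neq0 // (vX hv) // vd' mul0r subr0.
  apply/idP/idP => h.
    have -> : x' - u * w ^+ k = (x' - u * d' ^+ k) + u * (d' ^+ k - w ^+ k) by ring.
    exact: (vgeD hv).
  have -> : x' - u * d' ^+ k = (x' - u * w ^+ k) - u * (d' ^+ k - w ^+ k) by ring.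
  exact: (vgeB hv).
split=> [h|[w hw [h1 h2]]].
  have [w hw hac] := hex _ d0; exists w => //; split=> //.
  by rewrite -(key w) //; apply: ac_int h.
rewrite (key w) //; have [w0 vw] := hs _ hw.
have := ac_int M0 h2; rewrite mulrC (vge_mulf hv) ?expf_neq0 //.
by rewrite (vX hv) // vw mul0r subr0.
Qed.

End Step.
End FieldQuantifier.

End Specialization.
Import Specialization.

(** * Roots close to a given point, and reduction modulo a polynomial *)

Section RootElimination.
Variables (F : fieldType) (v : F -> int).
Hypothesis hv : is_padic_val v.
Variable pi : F.
Hypotheses (pi0 : pi != 0) (vpi : v pi = 1).
Local Notation vge := (vge v).
Local Notation ac := (ac v pi).

Lemma deriv_aff (p : {poly F}) b s : (aff p b s)^`() = aff p^`() b s * s%:P.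
Proof.
rewrite /aff deriv_comp; congr (_ * _).
by rewrite derivD derivZ derivX derivC addr0 -mul_polyC mulr1.
Qed.

(** Bounded cancellation in the derivative keeps its value within [e + E] of the least valuation of
    a term, attained at positive degree. A value of [p] that is smaller by more than [2(e + E)]
    digits then triggers Hensel's lemma. *)
Lemma hensel_center (p : {poly F}) b s (e E M l1 : nat) :
  (forall l, (0 < l < size p)%N -> v l%:R <= E%:Z) ->
  centred v e p^`() b (b + s) -> (0 < l1)%N -> (aff p b s)`_l1 != 0 ->
  (forall l, vge (v (aff p b s)`_l1) (aff p b s)`_l) ->
  vge (v (aff p b s)`_l1 + M%:Z) p.[b + s] -> (2 * (e + E) < M)%N ->
  exists eta, [/\ vge 0 eta, vge (M - (e + E))%N%:Z (eta - 1) & p.[b + s * eta] = 0].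
Proof.
move=> hE hgd l10; set f := aff p b s; set m := v f`_l1 => f0 hm hM hlt.
have f1 : f.[1] = p.[b + s] by rewrite aff_horner mulr1.
have hd l : dominated v e f^`().[1] f^`()`_l.
  rewrite deriv_aff coefMC !hornerE; apply: (domMr hv).
  by have := hgd l; rewrite [b + s - b]addrAC subrr add0r aff_horner mulr1.
have hl1 : (l1 < size p)%N.
  by apply: leq_trans (size_aff p b s); rewrite ltnNge; apply: contra f0 => h; rewrite nth_default.
have e1 : f^`()`_l1.-1 = l1%:R * f`_l1 by rewrite coef_deriv prednK // mulr_natl.
have e10 : f^`()`_l1.-1 != 0 by rewrite e1 mulf_neq0 // (natf_neq0_padic hv).
have d0 : f^`().[1] != 0.
  by have := hd l1.-1; rewrite /dominated; case: ifP => // _; rewrite (negbTE e10).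
have dle : v f^`().[1] <= m + (e + E)%N%:Z.
  have := hd l1.-1; rewrite /dominated (negbTE d0) vgeE // e1 (vM hv) ?(natf_neq0_padic hv) //.
  rewrite -/m; have := hE l1; rewrite l10 hl1 => /(_ isT).
  by move: (v l1%:R) (v f^`().[1]) => w x; clear; lia.
have dge : m <= v f^`().[1].
  rewrite -vgeE //; apply: (vge_horner hv) (vge1 hv) => l.
  by rewrite coef_deriv -mulr_natl; apply: (vgeM0 hv) => //; apply: vge_nat.
set k := absz (v f^`().[1] - m).
have hk : v f^`().[1] - m = k%:Z by rewrite /k gez0_abs // subr_ge0.
have hkE : (k <= e + E)%N by move: dle hk; move: (v f^`().[1]) => x; clear; lia.
pose a := pi ^ (- m).
have a0 : a != 0 by apply: piz0.
have va : v a = - m by apply: vpiz.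
have hg : intp v (a *: f).
  by move=> l; rewrite coefZ (vge_mulf hv) // va opprK add0r; apply: hm.
have g'1 : (a *: f)^`().[1] = a * f^`().[1] by rewrite derivZ hornerZ.
have g'0 : (a *: f)^`().[1] != 0 by rewrite g'1 mulf_neq0.
have vg' : v (a *: f)^`().[1] = k%:Z by rewrite g'1 (vM hv) // va addrC.
have [||x [gx hx hx1]] := hensel hv (j := (M - k)%N) hg (vge1 hv) g'0 vg'.
- by move: hlt hkE; clear; lia.
- rewrite subnK; last by move: hlt hkE; clear; lia.
  by rewrite hornerZ f1 (vge_mulf hv) // va opprK addrC.
exists x; split=> //; first by apply: vge_le hx1; move: hkE hlt; clear; lia.
by move/eqP: gx; rewrite hornerZ mulf_eq0 (negbTE a0) aff_horner => /eqP.
Qed.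

(** The converse of [hensel_center]: close to a root, the value is small compared with the terms of
    positive degree. *)
Lemma root_taylor (f : {poly F}) eta m (M : nat) : f.[1] = 0 ->
  (forall l, (0 < l)%N -> vge m f`_l) -> vge 0 eta -> vge M%:Z (eta - 1) ->
  vge (m + M%:Z) f.[eta].
Proof.
move=> f1 hm h0 hM; pose a := pi ^ (- m).
have a0 : a != 0 by apply: piz0.
have va : v a = - m by apply: vpiz.
pose g := a *: (f - (f`_0)%:P).
have hg : intp v g.
  move=> l; rewrite coefZ (vge_mulf hv) // va opprK add0r coefB coefC.
  by case: l => [|l]; [rewrite subrr vge0|rewrite subr0; apply: hm].
have := int_lip hv hg h0 (vge1 hv) hM.
rewrite /g !hornerE f1.
have -> : a * (f.[eta] - f`_0) - a * (0 - f`_0) = a * f.[eta] by ring.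
by rewrite (vge_mulf hv) // va opprK addrC.
Qed.

Section Step.
Variables (R : idomainType) (Y : Type) (ev : Y -> {rmorphism R -> F}).
Variable (T : (Y -> int) -> Prop).

Local Notation sp := (sp ev).
Local Notation dfn1 := (definable v pi (fun y => ev y : R -> F) T (fun=> True)).
Local Notation dfnPA A := (definable v pi (fun p => evP ev p : {poly R} -> F) (TP T) A).
Local Notation dfnP := (dfnPA (fun=> True)).
Local Notation dfn3 := (definable v pi (evZ (fun p => evP ev p : {poly R} -> F)) (TZ (TP T)) (fun=> True)).

Lemma evPC y c a : evP ev (y, c) a%:P = ev y a.
Proof. by rewrite evPE /sp map_polyC hornerC. Qed.

(** At a root of [h], pseudo-division gives the value of [g] as that of a remainder divided by a
    power of the leading coefficient. The denominator contributes a linear term to valuations and is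
    handled by [ac_quot] in angular components. *)
Lemma reduce (h : {poly R}) P : (1 < size h)%N -> dfnP P -> exists (Gs : seq {poly R}) (Q : Y * F -> Prop),
  [/\ forall g, g \in Gs -> (size g < size h)%N, dfnPA (fun g => g \in Gs) Q,
    forall y c, ev y (lead_coef h) <> 0 -> (sp y h).[c] = 0 -> P (y, c) <-> Q (y, c) &
    forall y c, Q (y, c) -> ev y (lead_coef h) <> 0].
Proof.
move=> hs hP; set a := lead_coef h.
have h0 : h != 0 by rewrite -size_poly_gt0; apply: ltnW.
pose k (g : {poly R}) := scalp g h.
pose evm (p : Y * F) (g : {poly R}) : F := (sp p.1 (g %% h)).[p.2] / (ev p.1 a) ^+ k g.
have [|P2 hP2 e2] := @dfn_agree _ v pi _ _ (fun p => evP ev p : {poly R} -> F) evm (TP T) (fun=> True)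
   (fun p => ev p.1 a <> 0 /\ (sp p.1 h).[p.2] = 0) P _ hP.
  move=> [y c] g [/eqP ha hc] _; rewrite /evm evPE /=.
  have ak : ev y a ^+ k g != 0 by rewrite expf_neq0.
  apply: (mulIf ak); rewrite mulfVK //.
  have := congr1 (fun p => (sp y p).[c]) (Pdiv.Idomain.divp_eq g h).
  rewrite /Specialization.sp !rmorphD !rmorphM /= -mul_polyC rmorphM /= map_polyC /= !hornerE -/(Specialization.sp _ _ _) hc.
  by rewrite mulr0 add0r => <-; rewrite rmorphXn mulrC.
pose A (g : {poly R}) := (size g < size h)%N : Prop.
have hG : dfnPA A (fun p => ev p.1 a <> 0).
  apply: d_not; apply: d_ext (d_zero v pi _ _ (g := a%:P) _); first by move=> [y c]; rewrite evPC.
  by rewrite /A (leq_ltn_trans (size_polyC_leq1 _)).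
have hA g : A (g %% h) by rewrite /A ltn_modp.
have hdz g : dfnPA A (fun p => (sp p.1 (g %% h)).[p.2] = 0).
  by apply: d_ext (d_zero v pi _ _ (hA g)) => -[y c]; rewrite evPE.
have hQ : dfnPA A (fun p => ev p.1 a <> 0 /\ P2 p).
  apply: (dfn_subst (s := id) hG) hP2.
  - by move=> t [t0 ht0 ->]; apply: (@pwl_lin _ _ _ _ _ _ _ _ _ _ (fun p => t0 p.1)) => //; apply: lin_var; exists t0.
  - move=> g _; apply: d_ext (d_and hG (hdz g)) => -[y c] /=.
    split=> -[/eqP n0 e]; split; try exact/eqP; first by rewrite /evm /= e mul0r.
    by move/eqP: e; rewrite /evm mulf_eq0 invr_eq0 expf_eq0 (negbTE n0) andbF orbF => /eqP.
  (* [ac_quot] requires positive precision; at precision 0 the atom says that the value is nonzero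
     and [u] integral. *)
  - move=> g M u _; case: M => [|M].
      apply: d_ext (d_and hG (d_and (d_not (hdz g)) (dfn_const _ _ _ _ _ (vge 0 u)))) => -[y c] /=.
      have key : ev y a <> 0 -> ac 0 u (evm (y, c) g) <-> (sp y (g %% h)).[c] <> 0 /\ vge 0 u.
        move=> /eqP n0; rewrite /Definable.ac /evm /=; set x := _ / _.
        have -> : (x != 0) = ((sp y (g %% h)).[c] != 0).
          by rewrite /x mulf_eq0 invr_eq0 expf_eq0 (negbTE n0) andbF orbF.
        have hx : vge 0 (x * pi ^ (- v x)) by rewrite vge_mulpi // opprK add0r vge_self.
        split=> [/andP[/eqP h1 h2]|[/eqP h1 h2]].
          by split=> //; rewrite -[u](subKr (x * pi ^ (- v x))); apply: (vgeB hv).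
        by rewrite h1; apply: (vgeB hv).
      by split=> -[n0]; rewrite key.
    have [s [s0 hq]] := ac_quot hv pi0 vpi (ltn0Sn M).
    have hB : dfnPA A (fun p => exists2 w, w \in s & ac M.+1 w (evP ev p a%:P) /\
         ac M.+1 (u * w ^+ k g) (evP ev p (g %% h))).
      apply: dfn_ex => w hw; apply: d_and; apply: d_ac => //.
      by rewrite /A (leq_ltn_trans (size_polyC_leq1 _)).
    apply: d_ext (d_and hG hB) => -[y c]; split=> -[n0 H]; split=> //.
      case: H => w hw; rewrite evPC evPE => H; rewrite /evm; apply/hq; first exact/eqP.
      by exists w.
    move: H; rewrite /evm => /hq; case; first exact/eqP.
    by move=> w hw H; exists w; rewrite // evPC evPE.
  - move=> g _; apply: (pwl_split (hdz g)).
      apply: (@pwl_lin _ _ _ _ _ _ _ _ _ _ (fun=> v 0)); first exact: lin_cst.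
      by move=> [y c] [_ /= e]; rewrite /evm /= e mul0r.
    apply: (@pwl_lin _ _ _ _ _ _ _ _ _ _ (fun p => v (evP ev p (g %% h)) - (k g)%:Z * v (evP ev p a%:P))).
      apply: lin_sub; first exact: lin_val.
      by apply: lin_mulz; apply: lin_val; rewrite /A (leq_ltn_trans (size_polyC_leq1 _)).
    move=> [y c] [/eqP n0 /eqP e]; rewrite evPC evPE /evm.
    have n0' : ev y a ^+ k g != 0 by rewrite expf_neq0.
    rewrite (vM hv) ?invr_eq0 //; congr (_ + _).
    by rewrite (vV hv) // (vX hv) // mulrC.
have [Gs [hGs hfin]] := dfn_fin hQ.
exists Gs, (fun p => ev p.1 a <> 0 /\ P2 p); split=> //; last by move=> y c [].
by move=> y c ha hc; rewrite (e2 (y, c)) //; split=> [|[]].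
Qed.

End Step.
End RootElimination.

(** The conditions serve, in order: [ac_ex]; Hensel's lemma in [hensel_center]; [gd_perturb] at the
    factor produced by that lemma, and its final precision; finally [center_step] and its final
    precision. *)
Lemma precision_exists (M0 e E : nat) : exists M1 : nat,
  [/\ (0 < M1)%N, (2 * (e + E) < M1)%N, (e < M1 - (e + E))%N,
      (M0 <= M1 - (e + E) - e)%N & (e < M1)%N /\ (M0 <= M1 - e)%N].
Proof. by exists (M0 + 2 * (e + E) + e + 1)%N; split; lia. Qed.

Section FieldElimination.
Variables (F : fieldType) (v : F -> int).
Hypothesis hv : is_padic_val v.
Variable pi : F.
Hypotheses (pi0 : pi != 0) (vpi : v pi = 1).
Local Notation vge := (vge v).

Lemma aff_eq0 (p : {poly F}) b s : s != 0 -> aff p b s = 0 -> p = 0.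
Proof.
move=> s0 h; have : aff (aff p b s) (- b / s) s^-1 = p.
  rewrite aff_aff mulrCA divff // mulr1 subrr.
  by rewrite /aff scale1r addr0 comp_polyXr.
by rewrite h /aff comp_poly0.
Qed.

Section Step.
Variables (R : idomainType) (Y : Type) (ev : Y -> {rmorphism R -> F}).
Variable (T : (Y -> int) -> Prop).

Local Notation sp := (sp ev).
Local Notation dfn1 := (definable v pi (fun y => ev y : R -> F) T (fun=> True)).
Local Notation dfnPA A := (definable v pi (fun p => evP ev p : {poly R} -> F) (TP T) A).
Local Notation dfnP := (dfnPA (fun=> True)).
Local Notation dfn3 := (definable v pi (evZ (fun p => evP ev p : {poly R} -> F)) (TZ (TP T)) (fun=> True)).

(** Polynomials of degree 0 do not see the last coordinate, which may be set to 0. This is the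
    situation after reduction modulo a linear polynomial. *)
Lemma dfn_const_coef (Gs : seq {poly R}) Q :
  (forall g, g \in Gs -> (size g < 2)%N) -> dfnPA (fun g => g \in Gs) Q ->
  dfn1 (fun y => Q (y, 0)) /\ forall y c, Q (y, c) <-> Q (y, 0).
Proof.
move=> hGs hQ; split.
  have hT : dfn1 (fun=> True) by apply: dfn_const.
  suff h : dfn1 (fun y => True /\ Q (y, 0)) by apply: d_ext h => y; split=> [[]|].
  have e y g : evP ev (y, 0) g = ev y g`_0 by rewrite evPE horner_coef0 coef_map.
  apply: (dfn_subst (s := fun y => (y, 0)) hT) hQ => [t [t0 ht0 ->]|g _|g M u _|g _].
  - by apply: (@pwl_lin _ _ _ _ _ _ _ _ _ _ t0) => //; apply: lin_var.
  - by apply: d_and => //; apply: d_ext (d_zero v pi _ _ (g := g`_0) _) => // y; rewrite e.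
  - by apply: d_and => //; apply: d_ext (d_ac v pi _ _ M u (g := g`_0) _) => // y; rewrite e.
  - apply: (@pwl_lin _ _ _ _ _ _ _ _ _ _ (fun y => v (ev y g`_0))); first exact: lin_val.
    by move=> y _; rewrite e.
have [M [M0 h]] := dfn_dep hv pi0 vpi hQ.
move=> y c; apply: h => [t [t0 _ ->]//|g /hGs hg].
have [a ->] : exists a, g = a%:P by exists g`_0; apply: size1_polyC.
by rewrite !evPC eqrv_refl.
Qed.

(* Modulo [h] all polynomials have smaller degree, hence so have the polynomials whose roots serve as centres;
   whether [h] has a root near [b + pi^z * u] is decided by [hensel_center]. *)
Lemma root_lead (n : nat) :
  (forall h : {poly R}, (size h <= n)%N -> forall P, dfnP P ->
    dfn1 (fun y => exists c, [/\ sp y h != 0, (sp y h).[c] = 0 & P (y, c)])) ->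
  forall h : {poly R}, (size h <= n.+1)%N -> (1 < size h)%N -> forall P, dfnP P ->
    dfn1 (fun y => ev y (lead_coef h) <> 0 /\ exists c, (sp y h).[c] = 0 /\ P (y, c)).
Proof.
move=> IH h hn h1 P hP.
have [Gs [Q [hGs hQ e1 e2]]] := reduce hv pi0 vpi h1 hP.
suff H : dfn1 (fun y => exists c, (sp y h).[c] = 0 /\ Q (y, c)).
  apply: d_ext H => y; split=> [[c [hc q]]|[a0 [c [hc p]]]].
    have a0 := e2 _ _ q; split=> //; exists c; split=> //.
    exact/(e1 _ _ a0 hc).
  by exists c; split=> //; apply/(e1 _ _ a0 hc).
have lead0 y : ev y (lead_coef h) <> 0 -> sp y h != 0.
  move=> a0; apply/negP => /eqP h0; apply: a0.
  by rewrite lead_coefE -(coef_map (ev y)) -/(Specialization.sp ev y h) h0 coef0.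
have [h2|h2] := eqVneq (size h) 2%N.
  have [d1 d2] := @dfn_const_coef Gs Q (fun g hg => eq_ind (size h) (fun k => (size g < k)%N) (hGs g hg) 2%N h2) hQ.
  apply: d_ext d1 => y; split=> [q|[c [_ q]]]; last exact: (proj1 (d2 y c) q).
  have /eqP a0 := e2 _ _ q.
  exists (- ev y h`_0 / ev y (lead_coef h)); split; last exact: (proj2 (d2 y _) q).
  rewrite (@horner_coef_wide _ 2); last by apply: leq_trans (size_sp _ _ _) _; rewrite h2.
  rewrite big_ord_recl big_ord1 /= expr0 expr1 mulr1 !coef_map /= lead_coefE h2 /=.
  by rewrite lead_coefE h2 /= in a0; rewrite mulrC divfK // subrr.
have h3 : (2 < size h)%N by rewrite ltn_neqAle eq_sym h2.
(* ['X] is demanded by [center_step], and the derivative of [h] by [hensel_center]. Leaving [h]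
   itself out keeps all sizes at most [n], so that the induction hypothesis applies to the roots
   used as centres. *)
pose s0 : seq {poly R} := 'X :: h^`() :: Gs.
have hs0 g : g \in s0 -> (size g <= n)%N.
  rewrite !inE => /or3P[/eqP->|/eqP->|/hGs hg]; last by move: hg hn; clear; lia.
    by rewrite size_polyX; move: h3 hn; clear; lia.
  have hh : h != 0 by rewrite -size_poly_gt0; apply: ltnW.
  by have := lt_size_deriv hh; move: hn; clear; lia.
have n0 : (0 < n)%N by move: h3 hn; clear; lia.
have [e he] := center_step hv pi0 vpi ev (mem_head _ _ : 'X \in s0) hs0.
have [E hE] := nat_val_bound v n.+1.
have [M0 [M0p hM0]] := dfn_dep hv pi0 vpi hQ.
have [M1 [M1p M1a M1b M1c [M1d M1e]]] := precision_exists M0 e E.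
have [U [hU1 hU2]] := ac_ex hv pi0 vpi M1p.
pose DS := derivs n s0.
have subDS g : g \in Gs -> g \in DS by move=> hg; apply: sub_derivs => //; rewrite !inE hg !orbT.
(* The test for a root of [h] near [b + pi^z * u]: a term of positive degree has least valuation,
   and the value of [h] is smaller than it by [M1] digits. *)
pose Nh u (q : (Y * F) * int) := exists2 l1, l1 \in iota 1 (size h).-1 &
   core v pi (size h) (term pi ev h u) l1 (fun x => vge M1%:Z x) q.
pose Phi (p : Y * F) := ((sp p.1 h).[p.2] = 0 /\ Q p) \/
   exists z, exists2 u, u \in U & (no_cancellation_all v pi ev e DS u (p, z) /\ Q (p.1, p.2 + pi ^ z * u)) /\ Nh u (p, z).
have hPhi : dfnP Phi.
  apply: dfn_or.
    apply: d_and; last by apply: dfn_mono hQ.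
    by apply: d_ext (d_zero v pi _ _ (g := h) _) => // -[y c]; rewrite evPE.
  apply: (dfnZ_ex (P := fun q => exists2 u, u \in U & (no_cancellation_all v pi ev e DS u q /\
     Q (q.1.1, q.1.2 + pi ^ q.2 * u)) /\ Nh u q)).
  apply: dfn_ex => u /hU1 [u0 vu]; apply: d_and.
    by apply: Good_subst => //; apply: dfn_mono hQ.
  apply: dfn_ex => l1; rewrite mem_iota => hl1.
  apply: (@core_dfn _ _ hv _ pi0 vpi _ _ _ _ _ _ _ _ l1 M1).
  - by move=> l _; apply: mt_terms.
  - by move: hl1 h3; clear; lia.
  - by move=> x x' hx hx'; rewrite -[x'](subKr x); apply: (vgeB hv).
have H : dfn1 (fun y => exists2 g, g \in DS & exists b, [/\ sp y g != 0, (sp y g).[b] = 0 & Phi (y, b)]).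
  apply: dfn_ex => g /allpairsP[[g' k] /= [hg' _ ->]]; apply: IH => //.
  by apply: leq_trans (size_derivn_le _ _) _; apply: hs0.
apply: d_ext H => y; split.
  case=> g hg [b [hg0 hgb]]; case=> [[hb q]|[z [u hu [[hG hQt] [l1 hl1 [n1 [hmin hM]]]]]]].
    by exists b.
  move/GoodE: hG => hG; rewrite /= in hQt.
  set s := pi ^ z * u in hG hQt.
  rewrite termE -/s in n1 hmin hM.
  set f := aff (sp y h) b s in n1 hmin hM.
  have hmin' l : vge (v f`_l1) f`_l.
    have [hl|hl] := ltnP l (size h); first by have := hmin _ hl; rewrite termE.
    rewrite [f`_l]nth_default ?vge0 //; exact: leq_trans (leq_trans (size_aff _ _ _) (size_sp _ _ _)) hl.
  have hM' : vge (v f`_l1 + M1%:Z) (sp y h).[b + s].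
    by move: hM; rewrite term_sum vge_mulpi // opprK addrC.
  have [||||eta [eta0 heta hroot]] := hensel_center hv pi0 vpi (e := e) (E := E) (M := M1) _ _ _ n1 hmin' hM'.
  - move=> l /andP[l0 hl]; apply: hE; rewrite l0 /=.
    exact: leq_trans hl (leq_trans (size_sp _ _ _) hn).
  - rewrite -derivn1 sp_derivn derivn1; apply: hG.
    by apply: sub_derivs => //; rewrite !inE eqxx orbT.
  - by move: hl1; rewrite mem_iota => /andP[].
  - exact: M1a.
  exists (b + s * eta); split=> //.
  apply: (proj1 (hM0 (y, b + s) _ _ _) hQt) => [t [t0 _ ->]//|g' hg'].
  have := gd_perturb hv (hG _ (subDS _ hg')) eta0 heta.
  rewrite [b + s - b]addrAC subrr add0r => /(_ M1b) [_].
  by rewrite !evPE => h2'; exact: (eqrv_le M1c h2').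
case=> c [hc q]; have a0 := e2 _ _ q; have p0 := lead0 _ a0.
have [g hg [b [hg0 hgb hcase]]] := he M1 U M1d (conj hU1 hU2) y c.
exists g => //; exists b; split=> //.
case: hcase => [cb|[z [u [eta [hu cb [eta0 heta] es hall]]]]]; first by left; rewrite -cb.
right; exists z, u => //.
have hQt : Q (y, b + pi ^ z * u).
  apply: (proj1 (hM0 (y, c) _ _ _) q) => [t [t0 _ ->]//|g' hg'].
  have [_ h'] := hall _ (subDS _ hg'); rewrite !evPE; exact: (eqrv_le M1e h').
split; first by split=> //; apply/GoodE => g' hg'; have [] := hall _ hg'.
have s0' : c - b != 0 by rewrite subr_eq0.
set fc := aff (sp y h) b (c - b).
have fc1 : fc.[1] = 0 by rewrite aff_horner mulr1 addrC subrK.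
have fcN l : (size h <= l)%N -> fc`_l = 0.
  move=> hl; rewrite nth_default //; exact: leq_trans (leq_trans (size_aff _ _ _) (size_sp _ _ _)) hl.
have [eta_n0 veta] : eta != 0 /\ v eta = 0.
  have [] := @v_eq _ _ hv 1 eta (oner_neq0 _); last by rewrite (v1 hv).
  by rewrite (v1 hv) add0r; apply: vge_le heta; move: M1p; clear; lia.
have ef l : (aff (sp y h) b (pi ^ z * u))`_l = fc`_l * eta ^+ l.
  by rewrite es !coef_aff exprMn mulrA.
(* The constant term is masked by 0 because the index must be positive; its own valuation is
   controlled afterwards by the vanishing of the whole sum at 1. *)
have [|l1 [hl1 n1 hmin]] := @argmin_v _ v (size h) (fun l => if l == 0%N then 0 else fc`_l).
  apply: contrapT => hno; move/eqP: p0; apply; apply: (aff_eq0 (b := b) s0').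
  have hz l : fc`_l.+1 = 0.
    have [hl|hl] := ltnP l.+1 (size h); last exact: fcN.
    by apply/eqP; apply: contraT => nz; case: hno; exists l.+1.
  rewrite -/fc; have fcC : fc = (fc`_0)%:P by apply/polyP => -[|l]; rewrite coefC //= hz.
  have c0 : fc`_0 = 0 by rewrite -[RHS]fc1 [in RHS]fcC hornerC.
  by rewrite fcC c0 polyC0.
move: n1 hmin; case: (eqVneq l1 0%N) => [_|l10 n1 hmin]; first by rewrite eqxx.
have hm l : (0 < l)%N -> vge (v fc`_l1) fc`_l.
  move=> l0; have [hl|hl] := ltnP l (size h); last by rewrite (fcN l hl) vge0.
  by have := hmin _ hl; rewrite (gtn_eqF l0).
have hm0 : vge (v fc`_l1) fc`_0.
  have -> : fc`_0 = - (fc - (fc`_0)%:P).[1] by rewrite !hornerE fc1 sub0r opprK.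
  rewrite (vgeN hv); apply: (vge_horner hv) (vge1 hv) => -[|l].
    by rewrite coefB coefC subrr vge0.
  by rewrite coefB coefC subr0; apply: hm.
have vf l : v (eta ^+ l) = 0 by rewrite (vX hv) // veta mul0r.
have en l : eta ^+ l != 0 by rewrite expf_neq0.
exists l1; first by rewrite mem_iota; move: l10 hl1; clear; lia.
rewrite /core termE ef; split; first by rewrite mulf_neq0.
rewrite (vM hv) // vf addr0; split.
  move=> l _; rewrite termE ef mulrC; apply: (vgeM0 hv); first by rewrite vgeE // vf.
  by case: l => [|l] //; apply: hm.
rewrite term_sum vge_mulpi // opprK es addrC.
have := root_taylor hv pi0 vpi fc1 hm eta0 heta.
by rewrite aff_horner.
Qed.

(** Where the leading coefficient vanishes at [y], the leading monomial may be dropped and the size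
    decreases; elsewhere [root_lead] applies. *)
Lemma root_elim (n : nat) (h : {poly R}) : (size h <= n)%N -> forall P, dfnP P ->
    dfn1 (fun y => exists c, [/\ sp y h != 0, (sp y h).[c] = 0 & P (y, c)]).
Proof.
elim: n h => [|n IH] h hn P hP.
  apply: d_ext (dfn_const _ _ _ _ _ False) => y; split=> // -[c [p0 _ _]].
  move: hn p0; rewrite leqn0 size_poly_eq0 => /eqP->.
  by rewrite /Specialization.sp rmorph0 eqxx.
pose a := lead_coef h; pose h' := h - a%:P * 'X^((size h).-1).
have hh' : (size h' <= n)%N.
  apply/leq_sizeP => j hj; rewrite coefB coefCM coefXn.
  have [->|jn] := eqVneq j (size h).-1; first by rewrite mulr1 -lead_coefE subrr.
  rewrite mulr0 subr0 nth_default //; move: (size h) hj jn hn => k; clear; lia.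
have da : dfn1 (fun y => ev y a = 0) by apply: d_zero.
have H1 := d_and da (IH _ hh' _ hP).
have H2 : dfn1 (fun y => ev y a <> 0 /\ exists c, (sp y h).[c] = 0 /\ P (y, c)).
  have [h1|h1] := leqP (size h) 1; last exact: root_lead IH _ hn h1 _ hP.
  apply: d_ext (dfn_const _ _ _ _ _ False) => y; split=> // -[a0 [c [hc _]]].
  apply: a0; move: hc; rewrite /a (size1_polyC h1) /Specialization.sp map_polyC hornerC.
  by rewrite lead_coefC.
apply: d_ext (dfn_or H1 H2) => y.
have e0 : ev y a = 0 -> sp y h = sp y h'.
  move=> e; rewrite /h' /Specialization.sp rmorphB rmorphM /= map_polyC /= e.
  by rewrite polyC0 mul0r subr0.
have en0 : ev y a <> 0 -> sp y h != 0.
  move=> e; apply/negP => /eqP h0; apply: e.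
  by rewrite /a lead_coefE -(coef_map (ev y)) -/(Specialization.sp ev y h) h0 coef0.
split.
  case=> [[e [c H]]|[e [c [hc p]]]]; first by exists c; rewrite e0.
  by exists c; split=> //; apply: en0.
case=> c [p0 hc p]; have [e|e] := pselect (ev y a = 0); [left|right]; split=> //.
  by exists c; rewrite -e0.
by exists c.
Qed.

Theorem dfnF_ex P : dfnP P -> dfn1 (fun y => exists t, P (y, t)).
Proof.
move=> hP; have [Gs [_ hQ]] := dfn_fin hP.
pose s0 : seq {poly R} := 'X :: Gs.
pose n := (\max_(g <- s0) size g)%N.
have hs0 g : g \in s0 -> (size g <= n)%N by move=> hg; apply: leq_bigmax_seq.
have n0 : (0 < n)%N by apply: leq_trans (hs0 _ (mem_head _ _)); rewrite size_polyX.
have [e he] := center_step hv pi0 vpi ev (mem_head _ _ : 'X \in s0) hs0.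
have [M0 [M0p hM0]] := dfn_dep hv pi0 vpi hQ.
have [M1 [M1p _ _ _ [M1d M1e]]] := precision_exists M0 e 0.
have [U [hU1 hU2]] := ac_ex hv pi0 vpi M1p.
pose DS := derivs n s0.
have subDS g : g \in Gs -> g \in DS by move=> hg; apply: sub_derivs => //; rewrite !inE hg !orbT.
pose Phi (p : Y * F) := P p \/
   exists z, exists2 u, u \in U & no_cancellation_all v pi ev e DS u (p, z) /\ P (p.1, p.2 + pi ^ z * u).
have hPhi : dfnP Phi.
  apply: dfn_or => //.
  apply: (dfnZ_ex (P := fun q => exists2 u, u \in U & no_cancellation_all v pi ev e DS u q /\
     P (q.1.1, q.1.2 + pi ^ q.2 * u))).
  apply: dfn_ex => u /hU1 [u0 vu].
  by apply: Good_subst => //; apply: dfn_mono hQ.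
have H : dfn1 (fun y => exists2 g, g \in DS & exists b, [/\ sp y g != 0, (sp y g).[b] = 0 & Phi (y, b)]).
  apply: dfn_ex => g _; exact: (@root_elim (size g)).
apply: d_ext H => y; split.
  case=> g hg [b [_ _ [p|[z [u _ [_ p]]]]]]; first by exists b.
  by eexists; apply: p.
case=> t p.
have [g hg [b [hg0 hgb hcase]]] := he M1 U M1d (conj hU1 hU2) y t.
exists g => //; exists b; split=> //.
case: hcase => [tb|[z [u [eta [hu tb _ es hall]]]]]; first by left; rewrite -tb.
right; exists z, u => //; split; first by apply/GoodE => g' hg'; have [] := hall _ hg'.
apply: (proj1 (hM0 (y, t) _ _ _) p) => [t' [t0 _ ->]//|g' hg'].
have [_ h'] := hall _ (subDS _ hg'); rewrite !evPE; exact: (eqrv_le M1e h').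
Qed.

End Step.
End FieldElimination.

(** * A p-adic form of Thom's lemma *)

Section Thom.
Variables (F : fieldType) (v : F -> int).
Hypothesis hv : is_padic_val v.
Local Notation vge := (vge v).
Variables (PP : seq {poly F}) (M : nat) (t : F).
Hypothesis hder : forall p, p \in PP -> p^`() != 0 -> p^`() \in PP.
Hypothesis hM : forall p l, p \in PP -> (l <= size p)%N -> v (l`!)%:R + 1 <= M%:Z.
Hypothesis hnz : forall p, p \in PP -> p.[t] != 0.

(** Passing from [l] to [l + 1] multiplies the term by [s] times a ratio of consecutive derivatives
    at [t], and the hypothesis on [s] gives this factor valuation at least [M]. *)
Lemma chain_bound p s : p \in PP ->
  (forall k, p^`(k.+1) != 0 -> vge (M%:Z + v p^`(k).[t] - v p^`(k.+1).[t]) s) ->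
  forall l, vge (v p.[t] + l%:Z * M%:Z) (p^`(l).[t] * s ^+ l).
Proof.
move=> hp hs.
have hin k : p^`(k) != 0 -> p^`(k) \in PP.
  elim: k => [|k IH]; first by rewrite derivn0.
  rewrite derivnS => h; apply: hder => //; apply: IH.
  by apply: contraNneq h => ->; rewrite deriv0.
elim=> [|l IH]; first by rewrite derivn0 expr0 mulr1 mul0r addr0 vge_self.
have [->|p0] := eqVneq p^`(l.+1) 0; first by rewrite horner0 mul0r vge0.
have pl0 : p^`(l) != 0 by apply: contraNneq p0 => h; rewrite derivnS h deriv0.
have n1 := hnz (hin _ p0); have n0 := hnz (hin _ pl0).
have [->|s0] := eqVneq s 0; first by rewrite expr0n mulr0 vge0.
have := hs l p0; move: IH.
rewrite !vgeE ?mulf_neq0 ?expf_neq0 // !(vM hv) ?expf_neq0 // !(vX hv) //.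
move: (v p.[t]) (v p^`(l).[t]) (v p^`(l.+1).[t]) (v s) => a b c d; rewrite intS.
move=> h1 h2; rewrite !mulrDl !mulrDr !mul1r mulr1; move: (d * l%:Z) (l%:Z * M%:Z) h1 => x y h1.
by clear -h1 h2; lia.
Qed.

Lemma fact_split (p : {poly F}) l s : p^`(l).[t] * s ^+ l = (l`!)%:R * (aff p t s)`_l.
Proof. by rewrite coef_aff nderivn_def hornerMn -mulr_natl mulrA. Qed.

(** The Taylor term of order [l] gains [l * M] by [chain_bound] and loses at most [M - 1] to the
    factorial, and nothing for [l = 1]; every term beyond the constant one is thus smaller by [M]
    digits. *)
Lemma thom_dir p s : p \in PP ->
  (forall k, p^`(k.+1) != 0 -> vge (M%:Z + v p^`(k).[t] - v p^`(k.+1).[t]) s) ->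
  eqrv v M p.[t] p.[t + s].
Proof.
move=> hp hs; rewrite /eqrv (negbTE (hnz hp)).
have -> : p.[t + s] - p.[t] = (aff p t s - p.[t]%:P).[1].
  by rewrite hornerD hornerN hornerC aff_horner mulr1.
apply: (vge_horner hv) (vge1 hv) => l; rewrite coefB coefC.
have [hl|hl] := ltnP (size p) l.
  rewrite nth_default; last by apply: leq_trans (size_aff _ _ _) (ltnW hl).
  by case: l hl => // l _; rewrite subr0 vge0.
case: l hl => [|l] hl /=.
  by rewrite coef_aff nderivn0 expr0 mulr1 subrr vge0.
rewrite subr0; have := chain_bound hp hs l.+1.
rewrite fact_split (vge_mulf hv) ?(natf_neq0_padic hv) ?fact_gt0 //.
apply: vge_le.
have e1 : v (1`!)%:R = 0 by exact: (v1 hv).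
case: l hl => [|l] hl; first by rewrite e1 subr0 mul1r.
have := hM hp hl; move: (v _%:R) (v p.[t]) => w x.
rewrite intS mulrDl mul1r; have : M%:Z <= l.+1%:Z * M%:Z by rewrite ler_peMl.
by move: (_ * _) => y h1 h2; clear -h1 h2; lia.
Qed.

(** Induction on the degree. The bounds on [s] coming from the higher derivatives make the linear
    term dominate [p.[t + s] - p.[t]], so closeness of the two values bounds the linear term, hence
    [s]. *)
Lemma thom_conv s : (forall p, p \in PP -> eqrv v M p.[t] p.[t + s]) ->
  forall p, p \in PP -> p^`() != 0 -> vge (M%:Z + v p.[t] - v p^`().[t]) s.
Proof.
move=> hs p; have [n] := ubnP (size p); elim: n p => // n IH p hn hp p'0.
have hp' := hder hp p'0.
have hlt (q : {poly F}) : q^`() != 0 -> (size q^`() < size q)%N.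
  by move=> h; apply: lt_size_deriv; apply: contraNneq h => ->; rewrite deriv0.
have hch k : p^`()^`(k) != 0 -> p^`()^`(k) \in PP /\ (size p^`()^`(k) < n)%N.
  elim: k => [|k IHk]; first by move=> _; rewrite derivn0; split=> //; apply: leq_trans (hlt _ p'0) _.
  rewrite derivnS => h; have h' : p^`()^`(k) != 0 by apply: contraNneq h => ->; rewrite deriv0.
  have [h1 h2] := IHk h'; split; first exact: hder.
  exact: ltn_trans (hlt _ h) h2.
have hs' k : p^`()^`(k.+1) != 0 ->
    vge (M%:Z + v p^`()^`(k).[t] - v p^`()^`(k.+1).[t]) s.
  move=> h; have h' : p^`()^`(k) != 0.
    by apply: contraNneq h => h'; rewrite derivnS h' deriv0.
  have [h1 h2] := hch k h'; rewrite derivnS in h *; exact: IH.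
have hb := chain_bound hp' hs'.
have [->|s0] := eqVneq s 0; first exact: vge0.
have n1 := hnz hp'; have n0 := hnz hp.
have Mp : 1 <= M%:Z.
  have e0 : v (0`!)%:R = 0 by exact: (v1 hv).
  by have := hM hp (leq0n _); rewrite e0.
have hdiff : vge (v (p^`().[t] * s) + 1) (p.[t + s] - p.[t] - p^`().[t] * s).
  have -> : p.[t + s] - p.[t] - p^`().[t] * s = (aff p t s - p.[t]%:P - (p^`().[t] * s)%:P * 'X).[1].
    by rewrite !hornerE aff_horner mulr1.
  apply: (vge_horner hv) (vge1 hv) => l; rewrite !coefB coefC coefCM coefX.
  case: l => [|[|l]] /=.
  - by rewrite coef_aff nderivn0 expr0 mulr1 mulr0 subr0 subrr vge0.
  - by rewrite coef_aff nderivn1 expr1 mulr1 subr0 subrr vge0.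
  rewrite mulr0 !subr0.
  have [hl|hl] := ltnP (size p) l.+2.
    by rewrite nth_default ?vge0 //; apply: leq_trans (size_aff _ _ _) (ltnW hl).
  have e : p^`()^`(l.+1).[t] * s ^+ l.+1 * s = ((l.+2)`!)%:R * (aff p t s)`_l.+2.
    by rewrite -fact_split -mulrA -exprSr -derivSn.
  have hq : ((l.+2)`!)%:R != 0 :> F by rewrite (natf_neq0_padic hv) ?fact_gt0.
  have := vgeM hv (hb l.+1) (vge_self v s).
  rewrite e (vge_mulf hv) //; apply: vge_le.
  have := hM hp hl; rewrite (vM hv) //; move: (v _%:R) (v _.[t]) (v s) => w x y.
  have : M%:Z <= l.+1%:Z * M%:Z by rewrite ler_peMl.
  by move: (_ * _) => z h1 h2; clear -h1 h2; lia.
have m0 : p^`().[t] * s != 0 by rewrite mulf_neq0.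
have [d0 vd] := v_eq hv m0 hdiff.
have := hs p hp; rewrite /eqrv (negbTE n0) vgeE // vd (vM hv) // vgeE //.
by move: (v p.[t]) (v _.[t]) (v s) => a b c; clear; lia.
Qed.

End Thom.

(** * Towers of delineated families *)

Module Tower.

(* [RI K k] is [K[x_1]...[x_k]], evaluated on points that are nested pairs with the last coordinate outermost. *)
Fixpoint RI (K : fieldType) (k : nat) : idomainType :=
  if k is k'.+1 then {poly (RI K k')} else K.

Fixpoint pt (F : Type) (k : nat) : Type := if k is k'.+1 then (pt F k' * F)%type else unit.

Fixpoint evk (K F : fieldType) (iota : {rmorphism K -> F}) (k : nat) :
    pt F k -> {rmorphism RI K k -> F} :=
  if k is k'.+1 then fun p => evP (@evk K F iota k') p else fun=> iota.

(* At each level, a finite family of polynomials and a precision for the comparison of leading terms. *)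
Fixpoint tower (K : fieldType) (k : nat) : Type :=
  if k is k'.+1 then (tower K k' * (seq (RI K k) * nat))%type else unit.

Section Towers.
Variables (K F : fieldType) (v : F -> int) (iota : {rmorphism K -> F}).
Hypothesis hv : is_padic_val v.
Variable pi : F.
Hypotheses (pi0 : pi != 0) (vpi : v pi = 1).
Local Notation vge := (vge v).
Local Notation ac := (ac v pi).
Local Notation env := (nat -> int).
Local Notation RI := (RI K).
Local Notation pt := (pt F).
Local Notation evk := (@evk K F iota).
Local Notation tower := (tower K).

Definition Tk k (t : env * pt k -> int) := exists i, t = (fun y => y.1 i).
Definition Dk k : (env * pt k -> Prop) -> Prop :=
  definable v pi (fun y : env * pt k => evk y.2 : RI k -> F) (@Tk k) (fun=> True).

Lemma Dk_ex k (P : env * pt k.+1 -> Prop) : Dk P ->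
  Dk (fun y : env * pt k => exists t, P (y.1, (y.2, t))).
Proof.
move=> hP.
apply: (dfnF_ex hv pi0 vpi (ev := fun y : env * pt k => evk y.2)
  (P := fun p => P (p.1.1, (p.1.2, p.2)))).
apply: (dfn_pull (s := fun p : (env * pt k) * F => (p.1.1, (p.1.2, p.2)) : env * pt k.+1)) hP => //.
move=> t [i ->]; apply: (@lin_var _ _ _ _ _ _ _ (fun p : (env * pt k) * F => p.1.1 i)).
by exists (fun y => y.1 i) => //; exists i.
Qed.

(* [idx] numbers the leading terms, so that [eqrv] becomes equality of two integers. *)
Definition ulist (M : nat) : seq F :=
  if pselect (exists s : seq F, (forall u, u \in s -> u != 0 /\ v u = 0) /\
     forall x, x != 0 -> exists2 u, u \in s & ac M u x) is left h then projT1 (cid h) else [::].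

Lemma ulistP M x : (0 < M)%N -> x != 0 -> has (fun u => ac M u x) (ulist M).
Proof.
move=> M0 x0; rewrite /ulist; case: pselect => [h|[]]; last exact: ac_ex.
by case: (cid h) => s [_ /(_ x x0) [u hu hx]] /=; apply/hasP; exists u.
Qed.

Definition idx (M : nat) (x : F) : nat := find (fun u => ac M u x) (ulist M).

Lemma idx0 M : idx M 0 = size (ulist M).
Proof.
apply/eqP; rewrite eqn_leq find_size leqNgt -has_find.
by apply/hasPn => u _; rewrite /Definable.ac eqxx.
Qed.

Lemma eqrv_idx M x y : (0 < M)%N -> eqrv v M x y <-> v x = v y /\ idx M x = idx M y.
Proof.
move=> M0; split=> [h|[vxy ixy]].
  split; first exact: eqrv_vE h.
  by apply: eq_find => u; apply: ac_eqrv h.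
have [x0|x0] := eqVneq x 0.
  rewrite /eqrv x0 eqxx; apply: contraT => y0.
  by have := ulistP M0 y0; rewrite has_find -/(idx M y) -ixy x0 idx0 ltnn.
have [y0|y0] := eqVneq y 0.
  by have := ulistP M0 x0; rewrite has_find -/(idx M x) ixy y0 idx0 ltnn.
have := nth_find 0 (ulistP M0 x0); have := nth_find 0 (ulistP M0 y0).
rewrite -/(idx M y) -/(idx M x) -ixy /Definable.ac y0 x0 /= => hy hx.
rewrite /eqrv (negbTE x0); have := vgeB hv hy hx; rewrite -vxy.
have -> : y * pi ^ (- v x) - nth 0 (ulist M) (idx M x) - (x * pi ^ (- v x) - nth 0 (ulist M) (idx M x)) =
  (y - x) * pi ^ (- v x) by ring.
by rewrite vge_mulpi // opprK addrC.
Qed.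

Lemma dfn_idx R Y (ev : Y -> R -> F) T (A : R -> Prop) M g j : A g ->
  definable v pi ev T A (fun y => idx M (ev y g) = j).
Proof.
move=> hg; rewrite /idx; elim: (ulist M) j => [|u s IH] [|j] /=.
- exact: dfn_const.
- exact: dfn_const.
- apply: d_ext (d_ac v pi ev T M u hg) => y; by case: ifP.
- apply: d_ext (d_and (d_not (d_ac v pi ev T M u hg)) (IH j)) => y.
  case: ifP => h; first by split=> [[/(_ isT)]|].
  by split=> [[_ ->]|[->]].
Qed.

Lemma eqrv_sym M x y : (0 < M)%N -> eqrv v M x y -> eqrv v M y x.
Proof. by move=> M0 /(eqrv_idx _ _ M0) [a b]; apply/(eqrv_idx _ _ M0). Qed.

Lemma eqrv_trans M x y z : (0 < M)%N -> eqrv v M x y -> eqrv v M y z -> eqrv v M x z.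
Proof.
move=> M0 /(eqrv_idx _ _ M0) [a b] /(eqrv_idx _ _ M0) [a' b']; apply/(eqrv_idx _ _ M0).
by split; [rewrite a|rewrite b].
Qed.

Fixpoint tower_eq (k : nat) : tower k -> pt k -> pt k -> Prop :=
  if k is k'.+1 then fun tau x y => tower_eq tau.1 x.1 y.1 /\
    forall g, g \in tau.2.1 -> eqrv v tau.2.2 (@Tower.evk _ _ iota k'.+1 x g) (@Tower.evk _ _ iota k'.+1 y g)
  else fun _ _ _ => True.

Fixpoint nonvanishing (k : nat) : tower k -> pt k -> Prop :=
  if k is k'.+1 then fun tau x => nonvanishing tau.1 x.1 /\
    forall g, g \in tau.2.1 -> @Tower.evk _ _ iota k'.+1 x g != 0
  else fun _ _ => True.

(** With ['X] as a member, integrality of the last coordinate depends on the class only. The last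
    condition makes the precision large enough to absorb the factorials of Taylor expansions. *)
Definition thom_family k (G : seq (RI k.+1)) (M : nat) : Prop :=
  [/\ (0 < M)%N, ('X : {poly RI k}) \in G,
   forall g : {poly RI k}, g \in G -> g != 0,
   forall g : {poly RI k}, g \in G -> g^`() != 0 -> g^`() \in G &
   forall (g : {poly RI k}) l, g \in G -> (l <= size g)%N -> v (l`!)%:R + 1 <= M%:Z].

(** The last clause is a p-adic counterpart of delineability in cylindrical decompositions:
    equivalent base points carry the same classes above them. *)
Fixpoint delineated (k : nat) : tower k -> Prop :=
  if k is k'.+1 then fun tau => [/\ delineated tau.1, thom_family tau.2.1 tau.2.2 &
    forall x y, tower_eq tau.1 x y -> forall t, exists s, forall g, g \in tau.2.1 ->
      eqrv v tau.2.2 (@Tower.evk _ _ iota k'.+1 (x, t) g) (@Tower.evk _ _ iota k'.+1 (y, s) g)]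
  else fun _ => True.

Lemma fact_bound (n : nat) : exists M : nat, (0 < M)%N /\
  forall l, (l <= n)%N -> v (l`!)%:R + 1 <= M%:Z.
Proof.
elim: n => [|n [M [M0 IH]]].
  by exists (absz (v (0`!)%:R + 1)%R).+1; split=> // l; rewrite leqn0 => /eqP->; lia.
exists (M + absz (v (n.+1`!)%:R + 1)%R)%N; split; first by rewrite addn_gt0 M0.
move=> l; rewrite leq_eqVlt => /orP[/eqP->|hl]; first by lia.
by have := IH l hl; move: (v _ + 1) (v _ + 1) => a b; clear; lia.
Qed.

Lemma own_ex k (G0 : seq (RI k.+1)) M0 : exists G M, thom_family G M /\ (M0 <= M)%N /\
  forall g : RI k.+1, g \in G0 -> g != 0 -> g \in G.
Proof.
pose s0 : seq {poly RI k} := 'X :: G0.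
pose D := (\max_(g <- s0) size g)%N.
have hD g : g \in s0 -> (size g <= D)%N by move=> hg; apply: leq_bigmax_seq.
have D0 : (0 < D)%N by apply: leq_trans (hD _ (mem_head _ _)); rewrite size_polyX.
have [M1 [M10 hM1]] := fact_bound D.
exists [seq g <- derivs D s0 | g != 0], (maxn M0 M1); split; last first.
  split; first by rewrite leq_maxl.
  by move=> g hg g0; rewrite mem_filter g0; apply: sub_derivs => //; rewrite inE hg orbT.
split.
- by rewrite leq_max M10 orbT.
- by rewrite mem_filter polyX_eq0 /=; apply: sub_derivs => //; rewrite mem_head.
- by move=> g; rewrite mem_filter => /andP[].
- move=> g; rewrite !mem_filter => /andP[g0 /allpairsP[[g' j] /= [hg' hj e]]] hd.
  rewrite hd e -derivnS; apply: mem_derivs => //.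
  rewrite ltnNge; apply: contra hd => hj'.
  by rewrite e -derivnS derivn_size0 //; apply: leq_trans (hD _ hg') hj'.
- move=> g l; rewrite mem_filter => /andP[_ /allpairsP[[g' j] /= [hg' _ ->]]] hl.
  have hl' : (l <= D)%N by apply: leq_trans hl (leq_trans (size_derivn_le _ _) (hD _ hg')).
  by have := hM1 l hl'; have : (M1 <= maxn M0 M1)%N by [rewrite leq_maxr]; move: (v _) (maxn M0 M1); clear; lia.
Qed.

Definition codep (G : seq F) M (E : env) := forall i, (i < size G)%N ->
  E (2 * i)%N = v (nth 0 G i) /\ E (2 * i).+1 = (idx M (nth 0 G i))%:Z.

Lemma codep_ex G M : exists E, codep G M E.
Proof.
exists (fun j => if odd j then (idx M (nth 0 G j./2))%:Z else v (nth 0 G j./2)).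
move=> i _; rewrite mul2n odd_double doubleK /= odd_double /=.
by rewrite uphalf_double.
Qed.

(* The projection of each class is a union of classes: this is where quantifier elimination enters. *)
Lemma tower_ex k (G0 : seq (RI k)) (M0 : nat) : exists tau : tower k, delineated tau /\
  forall x y, tower_eq tau x y -> forall g, g \in G0 -> eqrv v M0 (evk x g) (evk y g).
Proof.
elim: k G0 M0 => [|k IH] G0 M0.
  by exists tt; split=> // -[] [] _ g _; apply: eqrv_refl.
have [G [M [hG [hM hsub]]]] := own_ex G0 M0.
have [Mp hX _ _ _] := hG.
pose B (y : env * pt k.+1) := codep [seq evk y.2 g | g <- G] M y.1.
have hB : Dk B.
  have h : Dk (fun y : env * pt k.+1 => forall i, i \in seq.iota 0 (size G) ->
      y.1 (2 * i)%N = v (evk y.2 (nth 0 G i)) /\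
      exists2 j, j \in seq.iota 0 (size (ulist M)).+1 & idx M (evk y.2 (nth 0 G i)) = j /\ y.1 (2 * i).+1 = j%:Z).
    apply: dfn_all => i _; apply: d_and.
      apply: dfn_eqz; last exact: (lin_val v (fun y : env * pt k.+1 => evk y.2 : RI k.+1 -> F)).
      by apply: lin_var; exists (2 * i)%N.
    apply: dfn_ex => j _; apply: d_and.
      exact: (dfn_idx (fun y : env * pt k.+1 => evk y.2 : RI k.+1 -> F)).
    apply: dfn_eqz; last exact: lin_cst.
    by apply: lin_var; exists (2 * i).+1.
  apply: d_ext h => -[E z]; rewrite /B /codep size_map; split=> h i hi.
    have [|h1 [j _ [<- h2]]] := h i; first by rewrite mem_iota.
    by rewrite (nth_map 0).
  have [|h1 h2] := h i; first by move: hi; rewrite mem_iota.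
  rewrite mem_iota /= add0n in hi; rewrite (nth_map 0) // in h1 h2.
  split=> //; exists (idx M (evk z (nth 0 G i))) => //.
  by rewrite mem_iota /= add0n ltnS /idx find_size.
(* That a code [E] occurs above [x] is, after elimination of the top coordinate, a condition on
   finitely many polynomials in [x]. The tower below is built so as to fix their leading terms to
   the required precision [M']. *)
have [H [_ hH]] := dfn_fin (Dk_ex hB).
have [M' [M'0 hdep]] := dfn_dep hv pi0 vpi hH.
have [tau' [hg' he']] := IH H M'.
exists (tau', (G, M)); split.
  split=> //= x y hxy t.
  have [E hE] := codep_ex [seq evk ((x, t) : pt k.+1) g | g <- G] M.
  have : exists t, B (E, (x, t)) by exists t.
  move=> /(hdep (E, x) (E, y)) [].
  - by move=> t' [i ->].
  - by move=> g hg; apply: he'.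
  move=> s hs; exists s => g hg.
  have hi : (index g G < size G)%N by rewrite index_mem.
  have := hE (index g G); have := hs (index g G).
  rewrite !size_map => /(_ hi) [a1 a2] /(_ hi) [b1 b2].
  rewrite !(nth_map 0) // !nth_index // in a1 a2 b1 b2.
  apply/eqrv_idx => //; split; first by rewrite -[LHS]b1 -[RHS]a1.
  by apply/eqP; rewrite -eqz_nat -b2 -a2.
move=> x y [_ /= h] g hg; have [->|g0] := eqVneq g 0; first by rewrite !rmorph0 eqrv_refl.
by apply: eqrv_le hM _; apply: h; apply: hsub.
Qed.

(** The start value is the contribution of ['X], whose derivative is 1. Adding the precision to this
    number gives the exponent of the ball in [fibre]. *)
Definition radius k (G : seq (RI k.+1)) (z : pt k.+1) : int :=
  \big[Num.max/v (@Tower.evk _ _ iota k.+1 z ('X : {poly RI k}))]_(g <- G | (g : {poly RI k})^`() != 0)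
     (v (@Tower.evk _ _ iota k.+1 z g) - v (@Tower.evk _ _ iota k.+1 z (g : {poly RI k})^`())).

Lemma rad_ge k (G : seq (RI k.+1)) z (g : {poly RI k}) : g \in G -> g^`() != 0 ->
  v (evk z (g : RI k.+1)) - v (evk z (g^`() : RI k.+1)) <= radius G z.
Proof. by move=> hg g0; apply: (Order.TotalTheory.bigmax_sup_seq _ g). Qed.

(** The two halves of Thom's lemma for the family specialised at [x]. No formally nonzero derivative
    is lost by the specialisation, since it belongs to [G] and does not vanish at [(x, t)]. *)
Lemma fibre k (G : seq (RI k.+1)) M x t s : thom_family G M ->
  (forall g, g \in G -> evk ((x, t) : pt k.+1) g != 0) ->
  (forall g, g \in G -> eqrv v M (evk ((x, t) : pt k.+1) g) (evk ((x, s) : pt k.+1) g)) <->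
  vge (M%:Z + radius G (x, t)) (s - t).
Proof.
move=> [M0 hX hnz hder hM] hn.
pose PP := [seq sp (@Tower.evk _ _ iota k) x g | g <- (G : seq {poly RI k})].
have p1 p : p \in PP -> p^`() != 0 -> p^`() \in PP.
  case/mapP => g hg ->; rewrite -derivn1 sp_derivn derivn1 => h.
  by apply/mapP; exists g^`() => //; apply: hder => //; apply: contraNneq h => ->; rewrite /sp rmorph0.
have p2 p l : p \in PP -> (l <= size p)%N -> v (l`!)%:R + 1 <= M%:Z.
  by case/mapP => g hg -> hl; apply: (hM g) => //; apply: leq_trans hl (size_sp _ _ _).
have p3 p : p \in PP -> p.[t] != 0 by case/mapP => g hg ->; apply: hn.
have es : t + (s - t) = s by rewrite addrC subrK.
have dn (g : {poly RI k}) j : g \in G -> (sp (@Tower.evk _ _ iota k) x g)^`(j) != 0 -> g^`(j) \in G /\ g^`(j) != 0.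
  move=> hg; rewrite sp_derivn => h; have h' : g^`(j) != 0.
    by apply: contraNneq h => ->; rewrite /sp rmorph0.
  split=> //; elim: j h' {h} => [|j IH]; first by rewrite derivn0.
  rewrite derivnS => h; apply: hder => //; apply: IH.
  by apply: contraNneq h => ->; rewrite deriv0.
split=> [h|h g hg]; last first.
  have := @thom_dir F v hv PP M t p1 p2 p3 (sp (@Tower.evk _ _ iota k) x g) (s - t).
  rewrite es; apply; first by apply/mapP; exists g.
  move=> j hj; apply: vge_le h.
  have [h1 h2] := dn g j.+1 hg hj.
  have hj' : (sp (@Tower.evk _ _ iota k) x g)^`(j) != 0.
    by apply: contraNneq hj => e; rewrite derivnS e deriv0.
  have [h3 h4] := dn g j hg hj'.
  have := @rad_ge k G (x, t) g^`(j) h3; rewrite -derivnS => /(_ h2).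
  rewrite !sp_derivn /=; move: (v _) (v _) (radius _ _) => a b c; clear; lia.
have hc := @thom_conv F v hv PP M t p1 p2 p3 (s - t).
rewrite es in hc.
have hc' (g : {poly RI k}) : g \in G -> g^`() != 0 ->
    vge (M%:Z + v (evk ((x, t) : pt k.+1) g) - v (evk ((x, t) : pt k.+1) (g^`() : RI k.+1))) (s - t).
  move=> hg g0; have := hc _ (sp (@Tower.evk _ _ iota k) x g).
  rewrite -derivn1 sp_derivn derivn1; apply.
  - by move=> p /mapP[g' hg' ->]; apply: h.
  - by apply/mapP; exists g.
  have : evk ((x, t) : pt k.+1) (g^`() : RI k.+1) != 0 by apply: hn; apply: hder.
  apply: contraNneq => e; apply/eqP.
  have : (sp (@Tower.evk _ _ iota k) x g^`()).[t] = 0 by rewrite e horner0.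
  by apply.
rewrite /radius big_seq_cond; elim/big_ind: _ => [|a b ha hb|g /andP[hg g0]].
- have := hc' 'X hX; rewrite derivX oner_eq0 => /(_ isT).
  by rewrite rmorph1 (v1 hv) subr0.
- by rewrite /Num.max; case: ifP.
- by rewrite addrA; apply: hc'.
Qed.

End Towers.

End Tower.
Import Tower.

(** * Counting residue classes *)

Module Counting.

Fixpoint pall (F : Type) (P : F -> Prop) k : pt F k -> Prop :=
  if k is k'.+1 then fun x => @pall F P k' x.1 /\ P x.2 else fun=> True.

Fixpoint pall2 (F : Type) (P : F -> F -> Prop) k : pt F k -> pt F k -> Prop :=
  if k is k'.+1 then fun x y => @pall2 F P k' x.1 y.1 /\ P x.2 y.2 else fun _ _ => True.

Definition is_digits (F : fieldType) (v : F -> int) (ds : seq F) :=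
  [/\ uniq ds, forall a, a \in ds -> vge v 0 a,
      forall a b, a \in ds -> b \in ds -> vge v 1 (a - b) -> a = b &
      forall x, vge v 0 x -> exists2 a, a \in ds & vge v 1 (x - a)].

Section Counting.
Variables (F : fieldType) (v : F -> int).
Hypothesis hv : is_padic_val v.
Variable pi : F.
Hypotheses (pi0 : pi != 0) (vpi : v pi = 1).
Local Notation vge := (vge v).

Lemma digits_ex : exists ds : seq F, is_digits v ds.
Proof.
have [s [hs hc]] := pv_res_fin hv.
have {}hs y : y \in s -> vge 0 y by move=> /hs h; apply/inPn_vge.
suff [ds [h1 h2 h3 h4]] : exists ds, [/\ uniq ds, {subset ds <= s},
    forall a b, a \in ds -> b \in ds -> vge 1 (a - b) -> a = b &
    forall x, x \in s -> exists2 a, a \in ds & vge 1 (x - a)].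
  exists ds; split=> // [a /h2 /hs //|x /inPn_vge /hc [y hy /inPn_vge hxy]].
  have [a ha hya] := h4 y hy; exists a => //.
  by rewrite -(subrKA y); apply: (vgeD hv).
elim: s {hs hc} => [|x s [ds [h1 h2 h3 h4]]]; first by exists [::]; split.
have [[a ha hxa]|hn] := pselect (exists2 a, a \in ds & vge 1 (x - a)).
  exists ds; split=> // [b /h2|y]; rewrite in_cons; first by move=> ->; rewrite orbT.
  by case/orP => [/eqP->|/h4 //]; exists a.
exists (x :: ds); split.
- rewrite /= h1 andbT; apply/negP => hx; apply: hn; exists x => //.
  by rewrite subrr vge0.
- by move=> b; rewrite !in_cons => /orP[->//|/h2 ->]; rewrite orbT.
- move=> a b; rewrite !in_cons => /orP[/eqP->|ha] /orP[/eqP->|hb] // hab; last exact: h3.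
    by case: hn; exists b.
  by case: hn; exists a => //; rewrite -opprB (vgeN hv).
- move=> y; rewrite in_cons => /orP[/eqP->|/h4 [a ha hya]].
    by exists x; rewrite ?mem_head // subrr vge0.
  by exists a => //; rewrite in_cons ha orbT.
Qed.

Variable ds : seq F.
Hypothesis hds : is_digits v ds.
Let q := size ds.

Fixpoint reps (N : nat) : seq F :=
  if N is N'.+1 then [seq a + b * pi ^ N'%:Z | a <- reps N', b <- ds] else [:: 0].

Lemma reps_int N a : a \in reps N -> vge 0 a.
Proof.
have [_ hi _ _] := hds.
elim: N a => [|N IH] a /=; first by rewrite inE => /eqP->; apply: vge0.
case/allpairsP => -[x b] /= [hx hb ->]; apply: (vgeD hv); first exact: IH.
by rewrite vge_mulpi //; apply: vge_le (hi _ hb); lia.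
Qed.

Lemma reps_cover N x : vge 0 x -> exists2 a, a \in reps N & vge N%:Z (x - a).
Proof.
have [_ _ _ hc] := hds => hx.
elim: N => [|N [a ha hxa]]; first by exists 0; rewrite /= ?inE // subr0.
have [|b hb hxb] := hc ((x - a) * pi ^ (- N%:Z)).
  by rewrite vge_mulpi // opprK add0r.
exists (a + b * pi ^ N%:Z); first by apply/allpairsP; exists (a, b).
have -> : x - (a + b * pi ^ N%:Z) = ((x - a) * pi ^ (- N%:Z) - b) * pi ^ N%:Z.
  rewrite mulrBl -mulrA -expfzDr // addNr expr0z mulr1; ring.
by rewrite vge_mulpi //; apply: vge_le hxb; lia.
Qed.

Lemma reps_sep N a b : a \in reps N -> b \in reps N -> vge N%:Z (a - b) -> a = b.
Proof.
have [_ hi hs _] := hds.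
elim: N a b => [|N IH] a b /=; first by rewrite !inE => /eqP-> /eqP->.
case/allpairsP => -[x c] /= [hx hc ->] /allpairsP [[y d]] /= [hy hd ->] h.
have e : x + c * pi ^ N%:Z - (y + d * pi ^ N%:Z) = (x - y) + (c - d) * pi ^ N%:Z by ring.
have hcd : vge N%:Z ((c - d) * pi ^ N%:Z).
  rewrite vge_mulpi // subrr; apply: (vgeB hv); exact: hi.
have exy : x = y.
  apply: IH => //; rewrite -[x - y](addrK ((c - d) * pi ^ N%:Z)) -e.
  by apply: (vgeB hv) => //; apply: vge_le h; lia.
move: h; rewrite e exy subrr add0r vge_mulpi // => h.
congr (_ + _ * _); apply: hs => //; apply: vge_le h; lia.
Qed.

Lemma reps_uniq N : uniq (reps N).
Proof.
have [hu hi hs _] := hds.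
elim: N => [|N IH] //=; apply: allpairs_uniq => //.
move=> [x c] [y d] /allpairsP [[x' c']] /= [hx hc [-> ->]] /allpairsP [[y' d']] /= [hy hd [-> ->]] e.
have e' : x' + c' * pi ^ N%:Z - (y' + d' * pi ^ N%:Z) = (x' - y') + (c' - d') * pi ^ N%:Z by ring.
have hcd : vge N%:Z ((c' - d') * pi ^ N%:Z).
  rewrite vge_mulpi // subrr; apply: (vgeB hv); exact: hi.
have h0 : vge N.+1%:Z ((x' - y') + (c' - d') * pi ^ N%:Z) by rewrite -e' e subrr vge0.
have exy : x' = y'.
  apply: (@reps_sep N) => //; rewrite -[x' - y'](addrK ((c' - d') * pi ^ N%:Z)).
  by apply: (vgeB hv) => //; apply: vge_le h0; lia.
move: h0; rewrite exy subrr add0r vge_mulpi // => h.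
by congr (_, _); apply: hs => //; apply: vge_le h; lia.
Qed.

Lemma size_reps N : size (reps N) = (q ^ N)%N.
Proof. by elim: N => //= N IH; rewrite size_allpairs IH expnSr. Qed.

Lemma digits_gt0 : (0 < q)%N.
Proof.
have [_ _ _ hc] := hds; have [a ha _] := hc 0 (vge0 _ _).
by rewrite /q; case: ds ha.
Qed.

Lemma repsum_inv n i (f : F -> nat) :
  (forall a b, vge 0 a -> vge 0 b -> vge n%:Z (a - b) -> f a = f b) ->
  (\sum_(a <- reps (n + i)) f a = q ^ i * \sum_(a <- reps n) f a)%N.
Proof.
move=> hf; have [_ hi _ _] := hds.
elim: i => [|i IH]; first by rewrite addn0 mul1n.
rewrite addnS /= big_allpairs_dep expnS -mulnA -IH big_distrr /= big_seq [RHS]big_seq.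
apply: eq_bigr => a ha; rewrite big_seq.
rewrite (eq_bigr (fun=> f a)); last first.
  move=> b hb; have ha0 := reps_int ha.
  have hb0 : vge (n + i)%N%:Z (b * pi ^ (n + i)%N%:Z).
    by rewrite vge_mulpi // subrr; apply: hi.
  apply: hf => //; first by apply: (vgeD hv) => //; apply: vge_le hb0; lia.
  by rewrite addrAC subrr add0r; apply: vge_le hb0; lia.
by rewrite -big_seq big_const_seq count_predT iter_addn_0 mulnC.
Qed.

Lemma ball_cnt N R s0 : (R <= N)%N -> vge 0 s0 ->
  (\sum_(s <- reps N) (vge R%:Z (s - s0) : nat) = q ^ (N - R))%N.
Proof.
move=> hRN h0; rewrite -{1}(subnKC hRN) repsum_inv; last first.
  move=> a b _ _ hab; congr nat_of_bool; apply/idP/idP => h.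
    have -> : b - s0 = (a - s0) - (a - b) by ring.
    exact: (vgeB hv).
  have -> : a - s0 = (b - s0) + (a - b) by ring.
  exact: (vgeD hv).
have [a ha hsa] := reps_cover R h0.
rewrite (eq_big_seq (fun s => (s == a) : nat)); last first.
  move=> s hs; congr nat_of_bool; apply/idP/eqP => [h|->].
    apply: (reps_sep hs ha); have -> : s - a = (s - s0) + (s0 - a) by ring.
    exact: (vgeD hv).
  by rewrite -opprB (vgeN hv).
have -> : (\sum_(s <- reps R) (s == a : nat) = count_mem a (reps R))%N.
  by rewrite -sum1_count [RHS]big_mkcond /=; apply: eq_bigr => s _; case: (s == a).
by rewrite count_uniq_mem ?reps_uniq // ha muln1.
Qed.

Fixpoint pts k N : seq (pt F k) :=
  if k is k'.+1 then [seq (x, a) | x <- pts k' N, a <- reps N] else [:: tt].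

(** Divided by [q^(N * k)], this is the volume of the integral points of [A] as soon as these form a
    union of classes modulo [pi^N]; [cnt_inv] shows the independence of [N]. *)
Definition cnt k N (A : pt F k -> Prop) : nat := \sum_(x <- pts k N) `[< A x >].

Local Notation pint := (pall (fun x : F => vge 0 x)).
Local Notation pcong n := (pall2 (fun x y : F => vge n%:Z (x - y))).

Lemma psumS k N (f : pt F k.+1 -> nat) :
  (\sum_(x <- pts k.+1 N) f x = \sum_(x <- pts k N) \sum_(a <- reps N) f (x, a))%N.
Proof. by rewrite /= big_allpairs. Qed.

Lemma psum_le_seq k N (f g : pt F k -> nat) : (forall x, pint x -> f x <= g x)%N ->
  (\sum_(x <- pts k N) f x <= \sum_(x <- pts k N) g x)%N.
Proof.
elim: k f g => [|k IH] f g h; first by rewrite !big_seq1; apply: h.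
rewrite !psumS; apply: IH => x hx; rewrite big_seq [X in (_ <= X)%N]big_seq.
by apply: leq_sum => a ha; apply: h; split=> //; apply: (reps_int ha).
Qed.

Lemma psum_eq k N (f g : pt F k -> nat) : (forall x, pint x -> f x = g x) ->
  (\sum_(x <- pts k N) f x = \sum_(x <- pts k N) g x)%N.
Proof.
move=> h; apply/eqP; rewrite eqn_leq !psum_le_seq // => x hx; by rewrite h.
Qed.

Lemma psum_inv k n i (f : pt F k -> nat) :
  (forall x y, pint x -> pint y -> pcong n x y -> f x = f y) ->
  (\sum_(x <- pts k (n + i)) f x = q ^ (i * k) * \sum_(x <- pts k n) f x)%N.
Proof.
elim: k f => [|k IH] f hf; first by rewrite muln0 mul1n.
rewrite !psumS.
have prefl (x : pt F k) : pcong n x x.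
  by elim: k x {IH f hf} => //= k IH x; split=> //; rewrite subrr vge0.
rewrite (@psum_eq k (n + i) _ (fun x => (q ^ i * \sum_(a <- reps n) f (x, a))%N)); last first.
  move=> x hx; apply: repsum_inv => a b ha hb hab; apply: hf; split=> //=.
rewrite -big_distrr /= IH; first by rewrite mulnA -expnD mulnS.
move=> x y hx hy hxy; apply: eq_big_seq => a ha; apply: hf; split=> //=.
- exact: (reps_int ha).
- exact: (reps_int ha).
- by rewrite subrr vge0.
Qed.

Lemma cnt_inv k n i (A : pt F k -> Prop) :
  (forall x y, pint x -> pint y -> pcong n x y -> A x -> A y) ->
  cnt (n + i) A = (q ^ (i * k) * cnt n A)%N.
Proof.
move=> hA; apply: psum_inv => x y hx hy hxy; congr nat_of_bool.
have hyx : pcong n y x.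
  elim: k x y {hx hy A hA} hxy => //= k IH x y [/IH h1 h2]; split=> //.
  by rewrite -opprB (vgeN hv).
by apply/asboolP/asboolP; apply: hA.
Qed.

Lemma cnt_total k N : cnt N (fun _ : pt F k => True) = (q ^ (N * k))%N.
Proof.
rewrite /cnt; elim: k => [|k IH]; first by rewrite big_seq1 muln0 asboolT.
rewrite psumS; under eq_bigr do under eq_bigr do rewrite asboolT //.
under eq_bigr do rewrite sum1_size size_reps.
rewrite (eq_bigr (fun _ => (1 * q ^ N)%N)); last by move=> *; rewrite mul1n.
rewrite -big_distrl /= mulnS expnD mulnC; congr (_ * _)%N; rewrite -IH.
by apply: eq_bigr => x _; rewrite asboolT.
Qed.

Lemma cnt_mono k N (A B : pt F k -> Prop) : (forall x, pint x -> A x -> B x) ->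
  (cnt N A <= cnt N B)%N.
Proof.
move=> h; apply: psum_le_seq => x hx; case: asboolP => // a.
by rewrite asboolT //; apply: h.
Qed.

Lemma cnt_or k N (A B : pt F k -> Prop) :
  (cnt N (fun x => A x \/ B x) <= cnt N A + cnt N B)%N.
Proof.
rewrite /cnt -big_split; apply: psum_le_seq => x _ /=.
case: asboolP => // -[a|b]; first by rewrite (asboolT a) addSn.
by rewrite (asboolT b) addn1.
Qed.

Lemma cnt_disj (I : eqType) (r : seq I) k N (A : I -> pt F k -> Prop) (B : pt F k -> Prop) :
  uniq r -> (forall i j x, i \in r -> j \in r -> A i x -> A j x -> i = j) ->
  (forall i x, i \in r -> pint x -> A i x -> B x) ->
  (\sum_(i <- r) cnt N (A i) <= cnt N B)%N.
Proof.
move=> hu hd hB; rewrite /cnt exchange_big; apply: psum_le_seq => x hx /=.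
have [[i hi hA]|hn] := pselect (exists2 i, i \in r & A i x); last first.
  rewrite big1_seq // => i /andP[_ hi]; rewrite asboolF // => h; apply: hn.
  by exists i.
rewrite (asboolT (hB i x hi hx hA)) (bigD1_seq i) //= (asboolT hA).
rewrite big1_seq ?addn0 // => j /andP[ji hj]; rewrite asboolF // => h.
by move: ji; rewrite (hd _ _ _ hj hi h hA) eqxx.
Qed.

(* Away from a zero [s] of [p - p.[s]], smallness of [p] passes to the quotient by [X - s]. *)
Lemma onedim d (p : {poly F}) (J' J : int) (N j : nat) (S : seq F) :
  (size p <= d.+1)%N -> ~ vge J' p`_d -> J' + (d * j)%N%:Z <= J -> (j <= N)%N ->
  uniq S -> {subset S <= reps N} -> (forall s, s \in S -> vge J p.[s]) ->
  (size S <= d * q ^ (N - j))%N.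
Proof.
elim: d p J S => [|d IH] p J S hp hlead hJ hj hu hS hall.
  case: S hu hS hall => // s S _ _ hall; case: hlead.
  have := hall s (mem_head _ _); rewrite (size1_polyC hp) hornerC coefC /=.
  by apply: vge_le; move: hJ; clear; lia.
case: S hu hS hall => // s S; set S' := s :: S => hu hS hall.
have hs : s \in S' by exact: mem_head.
rewrite -(count_predC (fun a => vge j%:Z (a - s)) S') -!size_filter mulSn.
apply: leq_add.
  rewrite -(ball_cnt hj (reps_int (hS _ hs))) -sum1_size.
  have -> : (\sum_(a <- reps N) (vge j%:Z (a - s) : nat) =
      size [seq a <- reps N | vge j%:Z (a - s)])%N.
    rewrite size_filter -sum1_count [RHS]big_mkcond /=.
    by apply: eq_bigr => a _; case: (Valuation.vge _ _ _).
  rewrite sum1_size; apply: uniq_leq_size; first exact: filter_uniq.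
  by move=> a; rewrite !mem_filter => /andP[-> /hS].
have /factor_theorem [p1 e1] : root (p - p.[s]%:P) s by rewrite /root !hornerE subrr.
have ep : p = p1 * ('X - s%:P) + p.[s]%:P by rewrite -e1 subrK.
have hp1 : (size p1 <= d.+1)%N.
  have [->|p10] := eqVneq p1 0; first by rewrite size_poly0.
  have := size_Mmonic p10 (monicXsubC s); rewrite -e1 size_XsubC addnS /= addn1 => e2.
  have : (size (p - p.[s]%:P)%R <= d.+2)%N.
    apply: leq_trans (size_polyD _ _) _; rewrite geq_max hp size_polyN.
    by apply: leq_trans (size_polyC_leq1 _) _.
  by rewrite e2.
apply: (IH p1 (J - j%:Z)) => //.
- have -> // : p1`_d = p`_d.+1.
  rewrite ep coefD coefC addr0 mulrBr coefB coefMX coefMC /=.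
  by rewrite [p1`_d.+1]nth_default // mul0r subr0.
- by move: hJ; rewrite mulSn; move: (d * j)%N => x; clear; lia.
- exact: filter_uniq.
- by move=> a; rewrite mem_filter => /andP[_ /hS].
move=> a; rewrite mem_filter => /andP[/= ha /hall hJa].
have h1 : vge J (p1.[a] * (a - s)).
  have -> : p1.[a] * (a - s) = p.[a] - p.[s] by rewrite {1}ep !hornerE addrK.
  by apply: (vgeB hv) => //; apply: hall.
have as0 : a - s != 0 by apply: contraNneq ha => ->; rewrite vge0.
move: ha h1; rewrite mulrC (vge_mulf hv) // vgeE // -ltNge => ha.
by apply: vge_le; move: ha; move: (v _) => x; clear; lia.
Qed.

Variables (K : fieldType) (io : {rmorphism K -> F}).
Local Notation evk := (@evk K F io).

(** Induction on the number of variables: either the leading coefficient is small, which is rare by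
    induction, or [onedim] covers the fibre by [d] balls of radius exponent [j]. Valuation
    [D' * (j + 1)] is spent on the former and at least [d * j] on the latter. *)
Lemma small_set_count k (g : RI K k) : g != 0 -> exists c D : nat, (0 < D)%N /\ forall j N,
  (D * j.+1 <= N)%N ->
  (cnt N (fun x => vge (D * j.+1)%N%:Z (evk x g)) * q ^ j <= c * q ^ (N * k))%N.
Proof.
elim: k g => [|k IH] g g0.
  exists 0%N, (absz (v (io g))).+1; split=> // j N hN.
  rewrite /cnt big_seq1 asboolF // /= vgeE ?fmorph_eq0 //.
  by move: (v _) => x; have := leq_pmulr (absz x).+1 (ltn0Sn j); move: (_ * _)%N => y; clear; lia.
set a := lead_coef (g : {poly RI K k}).
have a0 : a != 0 by rewrite lead_coef_eq0.
have [c' [D' [D'0 hsm]]] := IH a a0.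
pose d := (size (g : {poly RI K k})).-1.
exists (c' + d)%N, (D' + d)%N; split=> [|j N hN]; first by rewrite addn_gt0 D'0.
have hN' : (D' * j.+1 <= N)%N by apply: leq_trans hN; rewrite leq_mul2r leq_addr orbT.
have hjN : (j <= N)%N.
  by apply: leq_trans hN'; apply: leq_trans (leq_pmull _ D'0); apply: leqnSn.
have hstep : (cnt N (fun x : pt F k.+1 => vge ((D' + d) * j.+1)%N%:Z (evk x g)) <=
    cnt N (fun x : pt F k => vge (D' * j.+1)%N%:Z (evk x a)) * q ^ N + d * q ^ (N - j) * q ^ (N * k))%N.
  rewrite /cnt psumS -(cnt_total k N) /cnt.
  rewrite big_distrl big_distrr -big_split /=; apply: psum_le_seq => x hx /=.
  have [hB|hB] := boolP (vge (D' * j.+1)%N%:Z (evk x a)).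
    rewrite [X in (_ <= X * _ + _)%N](_ : _ = 1%N) ?mul1n; last by rewrite asboolb.
    apply: leq_trans (leq_addr _ _).
    rewrite -(size_reps N) -sum1_size; apply: leq_sum => s _; exact: leq_b1.
  rewrite [X in (_ <= X * q ^ N + _)%N](_ : _ = 0%N); last by rewrite asboolb.
  rewrite asboolT // mul0n add0n muln1.
  have -> : (\sum_(s <- reps N) (`[< vge ((D' + d) * j.+1)%N%:Z (horner_eval s (map_poly (evk x) g)) >] : nat) =
     size [seq s <- reps N | vge ((D' + d) * j.+1)%N%:Z (sp (@Tower.evk _ _ io k) x g).[s]])%N.
    rewrite size_filter -sum1_count [RHS]big_mkcond /=; apply: eq_bigr => s _.
    by rewrite asboolb; case: (Valuation.vge _ _ _).
  apply: (@onedim d (sp (@Tower.evk _ _ io k) x g) (D' * j.+1)%N%:Z ((D' + d) * j.+1)%N%:Z) => //.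
  - apply: leq_trans (size_sp _ _ _) _; rewrite /d prednK // lt0n size_poly_eq0 //.
  - by rewrite /sp coef_map -lead_coefE; apply/negP.
  - by rewrite mulnDl [(d * j.+1)%N]mulnS; move: (D' * _)%N (d * j)%N => x1 x2; clear; lia.
  - by apply: filter_uniq; apply: reps_uniq.
  - by move=> s; rewrite mem_filter => /andP[].
  - by move=> s; rewrite mem_filter => /andP[].
apply: leq_trans (leq_mul hstep (leqnn _)) _.
rewrite mulnDl [(N * k.+1)%N]mulnS expnD [X in (_ <= X)%N]mulnDl; apply: leq_add.
  rewrite mulnAC (mulnC (q ^ N)%N) [X in (_ <= X)%N]mulnA leq_mul2r hsm ?orbT //.
by rewrite -!mulnA leq_mul2l (mulnC (q ^ (N * k))%N) mulnA -expnD subnK // leqnn orbT.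
Qed.

End Counting.

End Counting.
Import Counting.

(** * Volumes of classes *)

Module ClassVolume.

Section ClassCount.
Variables (K F : fieldType) (v : F -> int) (io : {rmorphism K -> F}).
Hypothesis hv : is_padic_val v.
Variable pi : F.
Hypotheses (pi0 : pi != 0) (vpi : v pi = 1).
Local Notation vge := (vge v).
Local Notation evk := (@evk K F io).
Local Notation tower_eq := (@Tower.tower_eq K F v io _).
Local Notation nonvanishing := (@Tower.nonvanishing K F io _).
Local Notation delineated := (@Tower.delineated K F v io _).
Local Notation radius := (@Tower.radius K F v io _).
Local Notation thom_family := (@Tower.thom_family K F v _).
Local Notation pint := (pall (fun x : F => vge 0 x)).

(** The exponent [t] for which the class of [x] has volume [q^-t]: the sum of the exponents of the
    fibre balls over all levels. *)
Fixpoint total_radius k : tower K k -> pt F k -> int :=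
  if k is k'.+1 then fun tau x => @total_radius k' tau.1 x.1 + (tau.2.2%:Z + @Tower.radius K F v io k' tau.2.1 x)
  else fun _ _ => 0.

Fixpoint radii_le (N : nat) k : tower K k -> pt F k -> Prop :=
  if k is k'.+1 then fun tau x => @radii_le N k' tau.1 x.1 /\
    tau.2.2%:Z + @Tower.radius K F v io k' tau.2.1 x <= N%:Z
  else fun _ _ => True.

Lemma own_X_int k (G : seq (RI K k.+1)) M (z z' : pt F k.+1) : thom_family G M ->
  (forall g, g \in G -> eqrv v M (evk z g) (evk z' g)) -> vge 0 z.2 -> vge 0 z'.2.
Proof.
move=> [M0 hX _ _ _] h; have := h 'X hX.
have eX (w : pt F k.+1) : evk w ('X : {poly RI K k}) = w.2.
  by rewrite /= /horner_eval /= map_polyX hornerX.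
rewrite !eX => hX'; have := eqrv_vE hv M0 hX'; have := eqrv_eq0 hv M0 hX'.
by rewrite /Valuation.vge => -> ->.
Qed.

Lemma level_ge0 k (G : seq (RI K k.+1)) M (z : pt F k.+1) : thom_family G M ->
  (forall g, g \in G -> evk z g != 0) -> vge 0 z.2 -> 0 <= M%:Z + radius G z.
Proof.
move=> [M0 hX _ _ _] h hz; have := h 'X hX.
have eX : evk z ('X : {poly RI K k}) = z.2 by rewrite /= /horner_eval /= map_polyX hornerX.
have : v z.2 <= radius G z by rewrite -eX; apply: Order.TotalTheory.bigmax_ge_id.
by rewrite eX => h1 z0; move: hz; rewrite vgeE //; move: h1; move: (v _) (radius _ _) => a b; clear; lia.
Qed.

Lemma rad_eqrv k (G : seq (RI K k.+1)) M (z z' : pt F k.+1) : thom_family G M ->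
  (forall g, g \in G -> eqrv v M (evk z g) (evk z' g)) -> radius G z = radius G z'.
Proof.
move=> [M0 hX _ hd _] h.
have e g : g \in G -> v (evk z g) = v (evk z' g) by move=> /h; apply: eqrv_vE.
rewrite /Tower.radius (e _ hX) big_seq_cond [RHS]big_seq_cond.
by apply: eq_bigr => g /andP[hg g0]; rewrite !e //; apply: hd.
Qed.

Lemma teq_tr k (tau : tower K k) x y : delineated tau -> tower_eq tau x y -> total_radius tau x = total_radius tau y.
Proof.
elim: k tau x y => //= k IH tau x y [h1 ho _] [e1 e2]; rewrite (IH _ _ _ h1 e1).
by rewrite (rad_eqrv ho e2).
Qed.

Lemma tr_ge0 k (tau : tower K k) x : delineated tau -> nonvanishing tau x -> pint x -> 0 <= total_radius tau x.
Proof.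
elim: k tau x => //= k IH tau x [h1 ho _] [n1 n2] [p1 p2]; apply: addr_ge0; first exact: IH.
exact: level_ge0 ho n2 p2.
Qed.

Lemma fibre2 k (G : seq (RI K k.+1)) M (z : pt F k.+1) y s0 s : thom_family G M ->
  (forall g, g \in G -> evk z g != 0) ->
  (forall g, g \in G -> eqrv v M (evk z g) (evk ((y, s0) : pt F k.+1) g)) ->
  (forall g, g \in G -> eqrv v M (evk z g) (evk ((y, s) : pt F k.+1) g)) <->
  vge (M%:Z + radius G z) (s - s0).
Proof.
move=> ho hn h0; have [M0 _ _ _ _] := ho.
rewrite (rad_eqrv ho h0) -(@fibre K F v io hv k G M y s0 s ho); last first.
  by move=> g hg; rewrite -(eqrv_eq0 hv M0 (h0 g hg)); apply: hn.
split=> h g hg.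
  by apply: (eqrv_trans hv pi0 vpi M0 _ (h g hg)); apply: (eqrv_sym hv pi0 vpi M0); apply: h0.
exact: (eqrv_trans hv pi0 vpi M0 (h0 g hg) (h g hg)).
Qed.

Variable ds : seq F.
Hypothesis hds : is_digits v ds.
Let q := size ds.
Local Notation cnt := (@cnt F pi ds _).

(** By delineation the fibre over every point of the class one level below is nonempty, hence a
    ball, and its exponent is constant on the class; the counts multiply. *)
Lemma class_cnt k (tau : tower K k) x N : delineated tau -> nonvanishing tau x -> pint x -> radii_le N tau x ->
  (cnt N (tower_eq tau x) * q ^ (absz (total_radius tau x)) = q ^ (N * k))%N.
Proof.
elim: k tau x => [|k IH] tau x.
  by move=> _ _ _ _; rewrite /Counting.cnt big_seq1 asboolT // muln0.
case=> h1 ho hdel [n1 n2] [p1 p2] [l1 l2].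
set R := absz (tau.2.2%:Z + radius tau.2.1 x).
have hR0 := level_ge0 ho n2 p2.
have hR : tau.2.2%:Z + radius tau.2.1 x = R%:Z by rewrite /R gez0_abs.
have hRN : (R <= N)%N by move: l2; rewrite hR.
have -> : (cnt N (tower_eq tau x) = cnt N (tower_eq tau.1 x.1) * q ^ (N - R))%N.
  rewrite /Counting.cnt psumS big_distrl /=; apply: (psum_eq hv pi0 vpi hds) => y hy.
  have [hyx|hyx] := pselect (tower_eq tau.1 x.1 y); last first.
    rewrite (asboolF hyx) mul0n big1 // => s _; rewrite asboolF // => -[h _]; exact: hyx.
  rewrite (asboolT hyx) mul1n; have [s0 hs0] := hdel _ _ hyx x.2.
  have hs0' : forall g, g \in tau.2.1 -> eqrv v tau.2.2 (evk x g) (evk ((y, s0) : pt F k.+1) g).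
    by move: hs0; rewrite -surjective_pairing.
  have hi0 : vge 0 s0 by apply: own_X_int ho hs0' p2.
  rewrite -(ball_cnt hv pi0 vpi hds hRN hi0); apply: eq_bigr => s _; congr nat_of_bool.
  rewrite -hR; apply/asboolP/idP => [[_ h]|h].
    by apply/(fibre2 s ho n2 hs0').
  by split=> //; apply/(fibre2 s ho n2 hs0').
have ht : absz (total_radius tau x) = (absz (total_radius tau.1 x.1) + R)%N.
  by rewrite /= hR; have := tr_ge0 h1 n1 p1; move: (total_radius _ _) => a; clear; lia.
rewrite ht expnD mulnACA IH // -!expnD; congr (_ ^ _)%N.
by rewrite subnK // mulnS addnC.
Qed.

Section SubField.
Variables (vK : K -> int) (e : nat).
Hypothesis hvK : is_padic_val vK.
Variable piK : K.
Hypotheses (piK0 : piK != 0) (vpiK : vK piK = 1).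
Hypothesis e0 : (0 < e)%N.
Hypothesis hve : forall a, a != 0 -> v (io a) = e%:Z * vK a.
Variable dsK : seq K.
Hypothesis hdsK : is_digits vK dsK.
Let qK := size dsK.

Fixpoint emb k : pt K k -> pt F k :=
  if k is k'.+1 then fun x => (@emb k' x.1, io x.2) else fun=> tt.

(** This is where coefficients in [K] matter: values at points of [K^k] lie in [K], so their
    valuations over [F] are [e] times those over [K]. *)
Lemma evk_emb k (x : pt K k) (g : RI K k) : evk (emb x) g = io (@Tower.evk K K idfun k x g).
Proof.
elim: k x g => // k IH [x t] g.
have h : map_poly (evk (emb x)) (g : {poly RI K k}) = map_poly io (map_poly (@Tower.evk K K idfun k x) g).
  by rewrite -map_poly_comp_id0 ?rmorph0 //; apply: eq_map_poly => a; apply: IH.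
rewrite /= /horner_eval /= h horner_map.
by [].
Qed.

(* A ball [v (s - s0) >= R] of [F] meets [K] in a ball [vK (s - s0) >= R / e]. *)
Lemma class_cnt_sub k (tau : tower K k) x N : delineated tau -> nonvanishing tau x -> pint x -> radii_le N tau x ->
  ((Counting.cnt piK dsK N (fun y => tower_eq tau x (emb y))) ^ e * qK ^ (absz (total_radius tau x)) <= qK ^ (N * k * e))%N.
Proof.
elim: k tau x => [|k IH] tau x.
  by move=> _ _ _ _; rewrite /Counting.cnt big_seq1 asboolT // exp1n muln0.
case=> h1 ho hdel [n1 n2] [p1 p2] [l1 l2].
set R := absz (tau.2.2%:Z + radius tau.2.1 x).
have hR0 := level_ge0 ho n2 p2.
have hR : tau.2.2%:Z + radius tau.2.1 x = R%:Z by rewrite /R gez0_abs.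
have hRN : (R <= N)%N by move: l2; rewrite hR.
(* The quotient of [R] by [e] rounded up. *)
pose R' := ((R + e.-1) %/ e)%N.
have eR' : (R <= e * R')%N.
  rewrite mulnC; have := divn_eq (R + e.-1) e; have := ltn_pmod (R + e.-1) e0.
  by rewrite -/R'; move: (_ * _)%N (_ %% _)%N => a b; move: e0; clear; lia.
have R'min (z : nat) : (R <= e * z)%N -> (R' <= z)%N.
  move=> hz; rewrite leqNgt; apply/negP => hlt.
  have : (z.+1 * e <= R + e.-1)%N by rewrite -leq_divRL.
  rewrite mulSn (mulnC z).
  by move: hz e0; move: (e * z)%N => a; clear; lia.
have R'R : (R' <= R)%N by apply: R'min; apply: leq_pmull.
have R'N : (R' <= N)%N by apply: leq_trans hRN.
have hc : (Counting.cnt piK dsK N (fun y : pt K k.+1 => tower_eq tau x (emb y)) <=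
    Counting.cnt piK dsK N (fun y => tower_eq tau.1 x.1 (emb y)) * qK ^ (N - R'))%N.
  rewrite /Counting.cnt psumS big_distrl /=; apply: (psum_le_seq hvK piK0 vpiK hdsK) => y hy.
  have [hyx|hyx] := pselect (tower_eq tau.1 x.1 (emb y)); last first.
    rewrite (asboolF hyx) mul0n big1 // => s _; rewrite asboolF // => -[h _]; exact: hyx.
  rewrite (asboolT hyx) mul1n.
  (* Delineation provides a point of the fibre in [F] only. The fibre may miss [K], which is why an
     upper bound is all that holds. *)
  have [[s0 [hs0r hs0]]|hno] := pselect (exists s0, s0 \in reps piK dsK N /\
      forall g, g \in tau.2.1 -> eqrv v tau.2.2 (evk x g) (evk ((emb y, io s0) : pt F k.+1) g)); last first.
    rewrite big1_seq // => s /= hs; rewrite asboolF // => -[_ h]; apply: hno.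
    by exists s.
  rewrite -(ball_cnt hvK piK0 vpiK hdsK R'N (reps_int hvK piK0 vpiK hdsK hs0r)).
  apply: leq_sum => s _; case: asboolP => // -[_ /= hs].
  have := proj1 (fibre2 (io s) ho n2 hs0) hs; rewrite hR -rmorphB.
  have [->|ss0] := eqVneq (s - s0) 0; first by rewrite rmorph0 !vge0.
  rewrite !vgeE ?fmorph_eq0 // hve // => h.
  have hz : 0 <= vK (s - s0).
    rewrite leNgt; apply/negP => hn; move: h hn e0; move: (vK _) => a; clear; nia.
  have hz' : vK (s - s0) = (absz (vK (s - s0)))%:Z by rewrite gez0_abs.
  rewrite hz'; have : (R' <= absz (vK (s - s0)))%N.
    by apply: R'min; move: h; rewrite hz' -PoszM lez_nat.
  by rewrite lez_nat => ->.
have ht : absz (total_radius tau x) = (absz (total_radius tau.1 x.1) + R)%N.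
  by rewrite /= hR; have := tr_ge0 h1 n1 p1; move: (total_radius _ _) => a; clear; lia.
have q0 : (0 < qK)%N := digits_gt0 hdsK.
rewrite ht; apply: (@leq_trans ((Counting.cnt piK dsK N (fun y => tower_eq tau.1 x.1 (emb y)) * qK ^ (N - R')) ^ e * qK ^ (absz (total_radius tau.1 x.1) + R))%N).
  by rewrite leq_mul2r leq_exp2r // hc orbT.
rewrite expnMn expnD mulnACA; apply: (@leq_trans (qK ^ (N * k * e) * ((qK ^ (N - R')) ^ e * qK ^ R))%N).
  by rewrite leq_mul2r IH ?orbT.
rewrite -expnM -!expnD leq_pexp2l //.
have : ((N - R') * e + R <= N * e)%N.
  rewrite mulnBl.
  have : (R' * e <= N * e)%N by rewrite leq_mul2r R'N orbT.
  by rewrite (mulnC e) in eR'; move: eR'; move: (R' * e)%N (N * e)%N => a b; clear; lia.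
by rewrite mulnS mulnDl; move: (_ * e + R)%N (N * e)%N (N * k * e)%N => a b c; clear; lia.
Qed.

End SubField.
End ClassCount.

End ClassVolume.
Import ClassVolume.

(** * Rational generating functions over orthants *)

Section RationalSequences.
Variable R : fieldType.
Implicit Types (a b : nat -> R) (A B : {poly R}).

Definition conv B a n := \sum_(k < n.+1) B`_k * a (n - k)%N.

(** The generating series of [a] is [A / B] with [B] invertible as a power series; [conv B a] lists
    the coefficients of its product with [B]. *)
Definition ratl a := exists B A, B.[0] != 0 /\ forall n, conv B a n = A`_n.

Lemma convE B a n N : (n <= N)%N -> conv B a n = (B * \poly_(i < N.+1) a i)`_n.
Proof.
move=> hn; rewrite coefM; apply: eq_bigr => k _; rewrite coef_poly.
by rewrite ltnS (leq_trans (leq_subr _ _) hn).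
Qed.

Lemma conv_mul B1 B2 a n : conv B1 (conv B2 a) n = conv (B1 * B2) a n.
Proof.
rewrite (@convE (B1 * B2) _ _ n) // -mulrA coefM; apply: eq_bigr => k _.
by rewrite (@convE B2 _ _ n) // leq_subr.
Qed.

Lemma eq_conv B a b n : (forall m, (m <= n)%N -> a m = b m) -> conv B a n = conv B b n.
Proof. by move=> h; apply: eq_bigr => k _; rewrite h // leq_subr. Qed.

Lemma conv_coef B A n : conv B (fun k => A`_k) n = (B * A)`_n.
Proof. by rewrite coefM. Qed.

Lemma convDr B a b n : conv B (fun k => a k + b k) n = conv B a n + conv B b n.
Proof. by rewrite /conv -big_split; apply: eq_bigr => k _; rewrite mulrDr. Qed.

Lemma convZr B c a n : conv B (fun k => c * a k) n = c * conv B a n.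
Proof. by rewrite /conv mulr_sumr; apply: eq_bigr => k _; rewrite mulrCA. Qed.

Lemma ratl_ext a b : a =1 b -> ratl a -> ratl b.
Proof. by move=> e [B [A [B0 h]]]; exists B, A; split=> // n; rewrite -h; apply: eq_conv. Qed.

Lemma ratl0 : ratl (fun=> 0).
Proof.
exists 1, 0; rewrite hornerC oner_eq0; split=> // n.
by rewrite coef0 /conv big1 // => k _; rewrite mulr0.
Qed.

Lemma ratl_add a b : ratl a -> ratl b -> ratl (fun n => a n + b n).
Proof.
move=> [B1 [A1 [h1 e1]]] [B2 [A2 [h2 e2]]].
exists (B1 * B2), (B2 * A1 + B1 * A2); split; first by rewrite hornerM mulf_neq0.
move=> n; rewrite convDr coefD -!conv_coef; congr (_ + _).
  by rewrite mulrC -conv_mul; apply: eq_conv.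
by rewrite -conv_mul; apply: eq_conv.
Qed.

Lemma ratl_scale c a : ratl a -> ratl (fun n => c * a n).
Proof.
move=> [B [A [h e]]]; exists B, (c *: A); split=> // n.
by rewrite convZr coefZ e.
Qed.

Lemma ratl_delta s c : ratl (fun n => if n == s then c else 0).
Proof.
exists 1, (c *: 'X^s); rewrite hornerC oner_eq0; split=> // n.
rewrite coefZ coefXn /conv big_ord_recl big1 ?addr0; last first.
  by move=> k _; rewrite coefC /= mul0r.
by rewrite coefC /= mul1r subn0; case: eqP => _; rewrite ?mulr1 ?mulr0.
Qed.

Lemma ratl_rec a b p w : (0 < p)%N -> ratl b ->
  (forall n, a n = b n + (if (p <= n)%N then w * a (n - p)%N else 0)) -> ratl a.
Proof.
move=> p0 [B [A [h e]]] ha.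
exists (B * (1 - w *: 'X^p)), A; split.
  by rewrite hornerM !hornerE ?hornerXn expr0n (gtn_eqF p0) mulr0 oppr0 addr0 mulr1.
move=> n; rewrite -conv_mul -e; apply: eq_conv => m _.
have -> : b m = a m - (if (p <= m)%N then w * a (m - p)%N else 0) by rewrite ha addrK.
rewrite (@convE _ _ _ m) // mulrBl mul1r coefB coef_poly ltnSn; congr (_ - _).
rewrite -scalerAl coefZ coefXnM coef_poly ltnS leq_subr ltnNge.
by case: (leqP p m) => hp /=; rewrite ?mulr0.
Qed.

End RationalSequences.

(** * Weighted sums over orthants and their changes of variables *)

Section Orthants.
Variable R : realType.
Local Notation env := (nat -> nat).
Variable s : nat.

(** Natural coefficients: these functions serve as substitutions and gradings, which must preserve
    orthants and grow by a fixed amount when a coordinate is incremented. Inequalities use [iaff],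
    with integer coefficients. *)
Inductive aff1 : (env -> nat) -> Prop :=
| aff_cst c : aff1 (fun=> c)
| aff_crd j : (j < s)%N -> aff1 (fun k => k j)
| aff_add f g : aff1 f -> aff1 g -> aff1 (fun k => f k + g k)%N.

Inductive mul1 : (env -> R) -> Prop :=
| mul_cst c : 0 < c -> mul1 (fun=> c)
| mul_pow w j : 0 < w -> (j < s)%N -> mul1 (fun k => w ^+ k j)
| mul_mul f g : mul1 f -> mul1 g -> mul1 (fun k => f k * g k).

Inductive iaff : (env -> int) -> Prop :=
| iaff_cst c : iaff (fun=> c)
| iaff_crd j : (j < s)%N -> iaff (fun k => (k j)%:Z)
| iaff_add f g : iaff f -> iaff g -> iaff (fun k => f k + g k)
| iaff_opp f : iaff f -> iaff (fun k => - f k).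

Definition affmap (phi : env -> env) := forall j, (j < s)%N -> aff1 (fun k => phi k j).

Lemma aff1_comp f phi : aff1 f -> affmap phi -> aff1 (fun k => f (phi k)).
Proof.
move=> h hp; elim: h => [c|j hj|f1 g1 _ h1 _ h2]; [exact: aff_cst|exact: hp|exact: aff_add].
Qed.

Lemma pow_aff1 w f : 0 < w -> aff1 f -> mul1 (fun k => w ^+ f k).
Proof.
move=> w0; elim=> [c|j hj|f1 g1 _ h1 _ h2].
- by apply: mul_cst; rewrite exprn_gt0.
- exact: mul_pow.
- have -> : (fun k => w ^+ (f1 k + g1 k)) = (fun k => w ^+ f1 k * w ^+ g1 k).
    by apply/funext => k; rewrite exprD.
  exact: mul_mul.
Qed.

Lemma mul1_comp f phi : mul1 f -> affmap phi -> mul1 (fun k => f (phi k)).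
Proof.
move=> h hp; elim: h => [c c0|w j w0 hj|f1 g1 _ h1 _ h2].
- exact: mul_cst.
- by apply: pow_aff1 => //; apply: hp.
- exact: mul_mul.
Qed.

Lemma iaff_aff1 f : aff1 f -> iaff (fun k => (f k)%:Z).
Proof.
elim=> [c|j hj|f1 g1 _ h1 _ h2]; [exact: iaff_cst|exact: iaff_crd|].
have -> : (fun k => (f1 k + g1 k)%N%:Z) = (fun k => (f1 k)%:Z + (g1 k)%:Z).
  by apply/funext => k; rewrite PoszD.
exact: iaff_add.
Qed.

Lemma iaff_comp f phi : iaff f -> affmap phi -> iaff (fun k => f (phi k)).
Proof.
move=> h hp; elim: h => [c|j hj|f1 g1 _ h1 _ h2|f1 _ h1].
- exact: iaff_cst.
- by apply: iaff_aff1; apply: hp.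
- exact: iaff_add.
- exact: iaff_opp.
Qed.

Lemma mul1_gt0 f k : mul1 f -> 0 < f k.
Proof.
elim=> [c //|w j w0 _|f1 g1 _ h1 _ h2]; first by rewrite exprn_gt0.
exact: mulr_gt0.
Qed.

Definition upd (k : env) i x : env := fun j => if j == i then x else k j.

Lemma aff1_succ f i : aff1 f -> exists p, forall k, f (upd k i (k i).+1) = (f k + p)%N.
Proof.
elim=> [c|j hj|f1 g1 _ [p1 h1] _ [p2 h2]].
- by exists 0%N => k; rewrite addn0.
- exists (j == i : nat) => k; rewrite /upd; case: eqP => [->|]; by rewrite ?addn1 ?addn0.
- by exists (p1 + p2)%N => k; rewrite h1 h2 addnACA.
Qed.

Lemma mul1_succ f i : mul1 f -> exists2 w, 0 < w & forall k, f (upd k i (k i).+1) = w * f k.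
Proof.
elim=> [c c0|w j w0 hj|f1 g1 _ [w1 h1 e1] _ [w2 h2 e2]].
- by exists 1 => // k; rewrite mul1r.
- exists (if j == i then w else 1); first by case: ifP.
  by move=> k; rewrite /upd; case: eqP => [->|]; rewrite ?exprS ?mul1r.
- exists (w1 * w2); first exact: mulr_gt0.
  by move=> k; rewrite e1 e2 mulrACA.
Qed.

Definition supp (D : seq nat) (k : env) := forall i, i \notin D -> k i = 0%N.

Local Open Scope classical_set_scope.
Local Open Scope ereal_scope.

Lemma esumZ (T : choiceType) (S : set T) (w : R) (a : T -> \bar R) : (0 < w)%R ->
  (forall i, 0 <= a i) -> \esum_(i in S) (w%:E * a i) = w%:E * \esum_(i in S) a i.
Proof.
move=> w0 a0.
have key (w' : R) (b : T -> \bar R) : (0 < w')%R -> (forall i, 0 <= b i) ->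
    \esum_(i in S) (w'%:E * b i) <= w'%:E * \esum_(i in S) b i.
  move=> w'0 b0; rewrite ge_ereal_sup => //= _ [X [finX XS]] <-.
  rewrite -ge0_mule_fsumr //; apply: lee_wpmul2l; first by rewrite lee_fin ltW.
  by apply: esum_ge; exists X.
apply/eqP; rewrite eq_le key //=.
have wa i : 0 <= w%:E * a i by rewrite mule_ge0 // lee_fin ltW.
have := key w^-1%R (fun i => w%:E * a i); rewrite invr_gt0 => /(_ w0 wa).
rewrite (eq_esum (b := a)); last first.
  by move=> i _; rewrite muleA -EFinM mulVf ?gt_eqF // mul1e.
move=> h; have w0' : 0 <= w%:E by rewrite lee_fin ltW.
have := lee_wpmul2l w0' h.
by rewrite muleA -EFinM divff ?gt_eqF // mul1e.
Qed.

Definition wsum D (P : env -> Prop) (d : env -> nat) (wt : env -> R) (n : nat) : \bar R :=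
  \esum_(k in [set k | [/\ supp D k, P k & d k = n]]) (wt k)%:E.

(* [D] lists the free coordinates, all others being 0. *)
Definition Rsum D P := forall d wt, aff1 d -> mul1 wt ->
  (forall n, wsum D P d wt n < +oo) -> ratl (fun n => fine (wsum D P d wt n)).

Lemma wsum_ge0 D P d wt n : mul1 wt -> 0 <= wsum D P d wt n.
Proof. by move=> h; apply: esum_ge0 => k _; rewrite lee_fin ltW // mul1_gt0. Qed.

Lemma wsum_fin D P d wt n : mul1 wt -> wsum D P d wt n < +oo -> wsum D P d wt n \is a fin_num.
Proof. by move=> h1 h2; rewrite ge0_fin_numE // wsum_ge0. Qed.

Lemma wsum_ext D P Q d wt n : (forall k, supp D k -> P k <-> Q k) -> wsum D P d wt n = wsum D Q d wt n.
Proof.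
move=> h; rewrite /wsum; congr (esum _ _); apply/seteqP; split=> k [h1 h2 h3]; split=> //; exact/h.
Qed.

Lemma Rsum_ext D P Q : (forall k, supp D k -> P k <-> Q k) -> Rsum D P -> Rsum D Q.
Proof.
move=> h hP d wt hd hw hfin.
have e n : wsum D P d wt n = wsum D Q d wt n by apply: wsum_ext.
by apply: ratl_ext (hP d wt hd hw _) => n; rewrite e.
Qed.

Lemma Rsum_false D : Rsum D (fun=> False).
Proof.
move=> d wt hd hw _; apply: ratl_ext (ratl0 R) => n.
rewrite /wsum (_ : [set k | _] = classical_sets.set0) ?esum_set0 //.
by apply/seteqP; split=> k [].
Qed.

(* Splitting the index set according to the value of a classifying function. *)
Lemma Rsum_split N D P (cl : env -> nat) (D' : nat -> seq nat) (phi : nat -> env -> env) :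
  (forall k, supp D k -> (cl k < N)%N) ->
  (forall c, (c < N)%N -> affmap (phi c)) ->
  (forall c, (c < N)%N -> set_bij [set k | supp (D' c) k] [set k | supp D k /\ cl k = c] (phi c)) ->
  (forall c, (c < N)%N -> Rsum (D' c) (fun k => P (phi c k))) -> Rsum D P.
Proof.
move=> hcl hphi hbij hR d wt hd hw hfin.
have H m : (m <= N)%N -> (forall n, wsum D (fun k => P k /\ (cl k < m)%N) d wt n < +oo) /\
    ratl (fun n => fine (wsum D (fun k => P k /\ (cl k < m)%N) d wt n)).
  elim: m => [|m IH] hm.
    have e n : wsum D (fun k => P k /\ (cl k < 0)%N) d wt n = 0.
      rewrite /wsum (_ : [set k | _] = classical_sets.set0) ?esum_set0 //.
      by apply/seteqP; split=> k [] // _ [].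
    split=> [n|]; first by rewrite e.
    by apply: ratl_ext (ratl0 R) => n; rewrite e.
  have [f1 r1] := IH (ltnW hm).
  have eb n : wsum D (fun k => P k /\ cl k = m) d wt n =
      wsum (D' m) (fun k => P (phi m k)) (fun k => d (phi m k)) (fun k => wt (phi m k)) n.
    rewrite /wsum; apply: reindex_esum.
    have [h1 h2 h3] := hbij _ hm; split.
    - move=> k /= [k1 k2 k3]; have [] := h1 k k1.
      by move=> ? ?; split.
    - move=> k k' /=; rewrite !inE => -[k1 _ _] [k1' _ _]; apply: h2; rewrite inE //.
    - move=> k /= [k1 [k2 k3] k4]; have [k' hk' e] := h3 k (conj k1 k3).
      by exists k' => //=; rewrite e; split.
  have es n : wsum D (fun k => P k /\ (cl k < m.+1)%N) d wt n =
      wsum D (fun k => P k /\ (cl k < m)%N) d wt n + wsum D (fun k => P k /\ cl k = m) d wt n.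
    rewrite /wsum (esumID [set k | (cl k < m)%N]); last first.
      by move=> k _; rewrite lee_fin ltW // mul1_gt0.
    congr (_ + _); congr (esum _ _); apply/seteqP; split=> k /=.
    - by case=> -[k1 [k2 _] k3] k4; split.
    - by case=> k1 [k2 k3] k4; do 2!split=> //; rewrite ltnS ltnW.
    - case=> -[k1 [k2 k3] k4] /negP k5; split=> //; split=> //.
      by move: k3 k5; clear; lia.
    - by case=> k1 [k2 k3] k4; rewrite k3 ltnn; split=> //; split=> //; rewrite k3.
  have f2 n : wsum D (fun k => P k /\ cl k = m) d wt n < +oo.
    apply: le_lt_trans (hfin n); rewrite /wsum (esumID [set k | cl k = m] [set k | [/\ supp D k, P k & d k = n]]).
      rewrite (_ : [set k | _] `&` [set k | cl k = m] = [set k | [/\ supp D k, P k /\ cl k = m & d k = n]]).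
        by apply: leeDl; apply: esum_ge0 => k _; rewrite lee_fin ltW // mul1_gt0.
      by apply/seteqP; split=> k /=; [case=> -[k1 k2 k3] k4|case=> k1 [k2 k3] k4].
    by move=> k _; rewrite lee_fin ltW // mul1_gt0.
  split=> [n|]; first by rewrite es lte_add_pinfty.
  have r2 : ratl (fun n => fine (wsum D (fun k => P k /\ cl k = m) d wt n)).
    apply: ratl_ext (hR _ hm _ _ (aff1_comp hd (hphi _ hm)) (mul1_comp hw (hphi _ hm)) _) => n.
      by rewrite eb.
    by rewrite -eb.
  apply: ratl_ext (ratl_add r1 r2) => n; rewrite es fineD //; exact: wsum_fin.
have [_ h] := H N (leqnn N).
apply: ratl_ext h => n; congr fine; apply: wsum_ext => k hk.
by split=> [[]|hp] //; split=> //; apply: hcl.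
Qed.

Lemma supp_upd D i k x : i \in D -> supp D k -> supp D (upd k i x).
Proof. by move=> hi h j hj; rewrite /upd; case: eqP => [e|_]; [rewrite e hi in hj|apply: h]. Qed.

Lemma aff_upd i f : (i < s)%N -> aff1 f -> affmap (fun k => upd k i (f k)).
Proof.
move=> hi hf j hj; rewrite /upd; case: (j == i) => //; exact: aff_crd.
Qed.

Lemma bij_succ D i : i \in D -> uniq D ->
  set_bij [set k | supp D k] [set k | supp D k /\ (k i != 0%N : nat) = 1%N] (fun k => upd k i (k i).+1).
Proof.
move=> hi _; split.
- by move=> k /= hk; split; [apply: supp_upd|rewrite /upd eqxx].
- move=> k k' /=; rewrite !inE => hk hk' e; apply/funext => j.
  have := congr1 (fun f : env => f j) e; rewrite /upd; case: eqP => [->|] //.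
  by case.
- move=> k /= [hk hk0]; exists (upd k i (k i).-1); first exact: supp_upd.
  apply/funext => j; rewrite /upd; case: eqP => [->|] //.
  by rewrite eqxx prednK // lt0n; case: (k i) hk0.
Qed.

Lemma bij_zero D i : i \in D -> uniq D ->
  set_bij [set k | supp (rem i D) k] [set k | supp D k /\ (k i != 0%N : nat) = 0%N] id.
Proof.
move=> hi hu; split=> //.
- move=> k /= hk; split; last by rewrite hk ?eqxx // mem_rem_uniq // inE eqxx.
  by move=> j hj; apply: hk; apply: contra hj; apply: mem_rem.
- move=> k /= [hk hk0]; exists k => // j; rewrite mem_rem_uniq // inE negb_and negbK => /orP[/eqP->|/hk //].
  by case: (k i) hk0.
Qed.

Lemma Rsum_zero_succ D i P : uniq D -> i \in D -> (i < s)%N ->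
  Rsum (rem i D) P -> Rsum D (fun k => P (upd k i (k i).+1)) -> Rsum D P.
Proof.
move=> hu hi his h0 h1.
apply: (@Rsum_split 2 D P (fun k => (k i != 0%N : nat)) (fun c => if c == 0%N then rem i D else D)
   (fun c => if c == 0%N then id else fun k => upd k i (k i).+1)).
- by move=> k _; case: (k i != 0)%N.
- move=> [|[|]] //= _; first by move=> j hj; apply: aff_crd.
  apply: aff_upd => //; have -> : (fun k : env => (k i).+1) = (fun k => k i + 1)%N.
    by apply/funext => k; rewrite addn1.
  by apply: aff_add; [apply: aff_crd|apply: aff_cst].
- by move=> [|[|]] //= _; [apply: bij_zero|apply: bij_succ].
- by move=> [|[|]].
Qed.

(** Each of the cases [k j <= k i] and [k i < k j] is an orthant with the difference as new
    coordinate. In a linear form this adds one of the two coefficients to the other, which is how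
    coefficients get cancelled. *)
Lemma Rsum_cmp D i j P : i \in D -> j \in D -> i != j -> (i < s)%N -> (j < s)%N ->
  Rsum D (fun k => P (upd k i (k i + k j)%N)) -> Rsum D (fun k => P (upd k j (k j + k i + 1)%N)) -> Rsum D P.
Proof.
move=> hi hj ij his hjs h0 h1.
apply: (@Rsum_split 2 D P (fun k => (k i < k j : nat)%N) (fun=> D)
   (fun c => if c == 0%N then fun k => upd k i (k i + k j)%N else fun k => upd k j (k j + k i + 1)%N)).
- by move=> k _; case: (k i < k j)%N.
- move=> [|[|]] //= _; apply: aff_upd => //.
    by apply: aff_add; apply: aff_crd.
  by apply: aff_add; [apply: aff_add; apply: aff_crd|apply: aff_cst].
- move=> [|[|]] //= _; split.
  + move=> k /= hk; split; first exact: supp_upd.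
    by rewrite /upd eqxx eq_sym (negbTE ij) ltnNge leq_addl.
  + move=> k k' /=; rewrite !inE => hk hk' e; apply/funext => l.
    have ej := congr1 (fun f : env => f j) e; have := congr1 (fun f : env => f l) e.
    rewrite /upd eq_sym (negbTE ij) in ej *; case: eqP => [->|] //.
    by rewrite ej => /addIn.
  + move=> k /= [hk hlt]; exists (upd k i (k i - k j)%N); first exact: supp_upd.
    apply/funext => l; rewrite /upd eqxx (eq_sym j) (negbTE ij); case: eqP => [->|] //.
    by rewrite subnK // leqNgt; case: ltnP hlt.
  + move=> k /= hk; split; first exact: supp_upd.
    by rewrite /upd eqxx (negbTE ij) addn1 ltnS leq_addl.
  + move=> k k' /=; rewrite !inE => hk hk' e; apply/funext => l.
    have ej := congr1 (fun f : env => f i) e; have := congr1 (fun f : env => f l) e.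
    rewrite /upd (negbTE ij) in ej *; case: eqP => [->|] //.
    by rewrite ej -!addnA => /addIn.
  + move=> k /= [hk hlt]; exists (upd k j (k j - k i - 1)%N); first exact: supp_upd.
    apply/funext => l; rewrite /upd eqxx (negbTE ij); case: eqP => [->|] //.
    by move: hlt; case: ltnP => // h _; rewrite -addnA -subnDA subnK // addn1.
- by move=> [|[|]].
Qed.

Lemma aff_mulc c f : aff1 f -> aff1 (fun k => c * f k)%N.
Proof.
move=> hf; elim: c => [|c IH].
  by have -> : (fun k => 0 * f k)%N = (fun=> 0%N) by []; apply: aff_cst.
have -> : (fun k => c.+1 * f k)%N = (fun k => f k + c * f k)%N.
  by apply/funext => k; rewrite mulSn.
exact: aff_add.
Qed.

Lemma Rsum_mod D i N P : i \in D -> (i < s)%N -> (0 < N)%N ->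
  (forall c, (c < N)%N -> Rsum D (fun k => P (upd k i (N * k i + c)%N))) -> Rsum D P.
Proof.
move=> hi his N0 h.
apply: (@Rsum_split N D P (fun k => k i %% N)%N (fun=> D) (fun c k => upd k i (N * k i + c)%N)) => //.
- by move=> k _; rewrite ltn_mod.
- move=> c _; apply: aff_upd => //; apply: aff_add; last exact: aff_cst.
  by apply: aff_mulc; apply: aff_crd.
move=> c hc; split.
- move=> k /= hk; split; first exact: supp_upd.
  by rewrite /upd eqxx mulnC modnMDl modn_small.
- move=> k k' /=; rewrite !inE => hk hk' e; apply/funext => l.
  have := congr1 (fun f : env => f l) e; rewrite /upd; case: eqP => [->|] //.
  by move=> /addIn /eqP; rewrite eqn_pmul2l // => /eqP.
- move=> k /= [hk hkc]; exists (upd k i (k i %/ N)%N); first exact: supp_upd.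
  apply/funext => l; rewrite /upd eqxx; case: eqP => [->|] //.
  by rewrite mulnC -{1}hkc -divn_eq.
Qed.

Lemma supp_nil k : supp [::] k -> k = (fun=> 0%N).
Proof. by move=> h; apply/funext => i; apply: h. Qed.

(** Induction on the number of free coordinates: separating the points with first coordinate 0 from
    their successors gives a linear recursion, hence a geometric factor in the denominator. *)
Lemma Rsum_true D : uniq D -> (forall i, i \in D -> (i < s)%N) -> Rsum D (fun=> True).
Proof.
move: {2}(size D) (erefl (size D)) => n; elim: n D => [|n IH] D hn hu hs d wt hd hw hfin.
  move/eqP: hn; rewrite size_eq0 => /eqP D0; subst D.
  apply: ratl_ext (ratl_delta (d (fun=> 0%N)) (wt (fun=> 0%N))) => m.
  have k0 : supp [::] (fun=> 0%N) by [].
  rewrite /wsum; case: eqP => [->|hne].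
    rewrite (_ : [set k | _] = [set (fun=> 0%N)]) ?esum_set1 //.
      by rewrite lee_fin ltW // mul1_gt0.
    by apply/seteqP; split=> k /=; [case=> /supp_nil|move=> ->].
  rewrite (_ : [set k | _] = classical_sets.set0) ?esum_set0 //.
  by apply/seteqP; split=> k //= [/supp_nil-> _ e]; case: hne.
case: D hn hu hs hfin => // i D [hn] hu hs hfin.
set DD := i :: D in hfin *.
have hi : i \in DD by rewrite mem_head.
have eD : rem i DD = D by rewrite /DD /= eqxx.
have [p hp] := aff1_succ i hd.
have [w w0 hw1] := mul1_succ i hw.
have hsD j : j \in D -> (j < s)%N by move=> hj; apply: hs; rewrite in_cons hj orbT.
have uD : uniq D by move: hu => /= /andP[].
have wge k : (0 <= (wt k)%:E)%E by rewrite lee_fin ltW // mul1_gt0.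
(* A point with nonzero coordinate [i] is the successor of an arbitrary point; the shift adds [p] to
   the degree and multiplies the weight by [w]. *)
have rec m : wsum DD (fun=> True) d wt m = wsum D (fun=> True) d wt m +
    (if (p <= m)%N then w%:E * wsum DD (fun=> True) d wt (m - p)%N else 0).
  rewrite {1}/wsum (esumID [set k | k i = 0%N]); last by move=> k _; apply: wge.
  congr (_ + _).
    congr (esum _ _); apply/seteqP; split=> k /=.
      case=> -[k1 _ k3] k4; split=> // j hj; have [->//|ji] := eqVneq j i.
      by apply: k1; rewrite in_cons negb_or ji.
    case=> k1 _ k3; split; last by apply: k1; move: hu => /= /andP[].
    by split=> // j; rewrite in_cons negb_or => /andP[_ /k1].
  case: leqP => hpm; last first.
    rewrite (_ : _ `&` _ = classical_sets.set0) ?esum_set0 //; apply/seteqP; split=> k //= -[[k1 _ k3] k4].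
    move: hpm; rewrite -k3 ltnNge => /negP; apply.
    have -> : k = upd (upd k i (k i).-1) i ((upd k i (k i).-1) i).+1.
      apply/funext => j; rewrite /upd eqxx; case: eqP => [->|] //.
      by rewrite prednK // lt0n; apply/eqP.
    by rewrite hp leq_addl.
  have hb : set_bij [set k | [/\ supp DD k, True & d k = (m - p)%N]]
      ([set k | [/\ supp DD k, True & d k = m]] `&` ~` [set k | k i = 0%N]) (fun k => upd k i (k i).+1).
    have [b1 b2 b3] := bij_succ hi hu; split.
    - move=> k /= [k1 _ k3]; have [c1 c2] := b1 k k1; split; last by rewrite /upd eqxx.
      by split=> //; rewrite hp k3 subnK.
    - by move=> k k' /=; rewrite !inE => -[k1 _ _] [k1' _ _]; apply: b2; rewrite inE.
    - move=> k /= [[k1 _ k3] /eqP k4]; have [|k' hk' e] := b3 k; first by rewrite /= k4.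
      by exists k' => //=; split=> //; move: k3; rewrite -e hp => <-; rewrite addnK.
  rewrite /wsum -esumZ // (reindex_esum _ _ _ _ hb).
  by apply: eq_esum => k _; rewrite hw1 EFinM.
have wfin m : wsum DD (fun=> True) d wt m \is a fin_num by apply: wsum_fin.
have fin' m : wsum D (fun=> True) d wt m < +oo.
  apply: le_lt_trans (hfin m); rewrite rec; apply: leeDl; case: ifP => // _.
  by rewrite mule_ge0 ?wsum_ge0 // lee_fin ltW.
have wfin' m : wsum D (fun=> True) d wt m \is a fin_num by apply: wsum_fin.
have rD := IH D hn uD hsD d wt hd hw fin'.
have rec' m : fine (wsum DD (fun=> True) d wt m) = (fine (wsum D (fun=> True) d wt m) +
    (if (p <= m)%N then w * fine (wsum DD (fun=> True) d wt (m - p)%N) else 0))%R.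
  rewrite rec fineD //; last by case: ifP => // _; rewrite fin_numM.
  by congr (_ + _)%R; case: ifP => // _; rewrite fineM.
(* If the degree ignores coordinate [i], the recursion degenerates to [a = b + w * a]. Finiteness of
   [a] together with a positive value of [b] forces [w < 1], and [a] is [b] divided by [1 - w]. *)
have [p0|p0] := posnP p; last exact: ratl_rec p0 rD rec'.
have w1 : (w < 1)%R.
  rewrite ltNge; apply/negP => w1.
  pose m := d (fun=> 0%N).
  have h1 := rec' m; rewrite p0 leq0n subn0 in h1.
  have h2 : (0 < fine (wsum D (fun=> True) d wt m))%R.
    rewrite -lte_fin fineK // /wsum.
    apply: lt_le_trans (_ : 0 < (wt (fun=> 0%N))%:E) _; first by rewrite lte_fin mul1_gt0.
    apply: esum_ge; exists [set (fun=> 0%N)]; last by rewrite fsbig_set1.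
    by split=> // k ->.
  have h3 : (0 <= fine (wsum DD (fun=> True) d wt m))%R by rewrite fine_ge0 // wsum_ge0.
  have := ler_wpM2r h3 w1; rewrite mul1r.
  by move: h1 h2; move: (fine _) (fine _) (_ * _)%R => x y z; lra.
apply: ratl_ext (ratl_scale (1 - w)^-1%R rD) => m.
have := rec' m; rewrite p0 leq0n subn0 => h.
have hw' : (1 - w != 0)%R by rewrite subr_eq0 eq_sym lt_eqF.
apply: (mulfI hw'); rewrite mulrA divff // mul1r mulrBl mul1r {1}h addrK //.
Qed.

End Orthants.

(** * Presburger predicates *)

Section Presburger.
Variable R : realType.
Variable s : nat.
Local Notation env := (nat -> nat).
Local Notation Rsum := (@Rsum R s).
Local Notation affmap := (affmap s).
Local Notation iaff := (iaff s).

Definition index_set D := uniq D /\ forall i, i \in D -> (i < s)%N.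

(* Cutting the orthant into finitely many affine images of orthants makes [a] constant on each of them. *)
Definition res1 D (a : env -> bool) := forall P : env -> bool -> Prop,
  (forall D' phi b, index_set D' -> affmap phi -> Rsum D' (fun k => P (phi k) b)) ->
  Rsum D (fun k => P k (a k)).

Lemma affmap_id : affmap id.
Proof. by move=> j hj; apply: aff_crd. Qed.

Lemma affmap_comp phi psi : affmap phi -> affmap psi -> affmap (fun k => phi (psi k)).
Proof. by move=> h1 h2 j hj; apply: (aff1_comp (h1 j hj) h2). Qed.

Lemma affmap_mod i N c : (i < s)%N -> affmap (fun k => upd k i (N * k i + c)%N).
Proof.
move=> hi; apply: aff_upd => //; apply: aff_add; last exact: aff_cst.
by apply: aff_mulc; apply: aff_crd.
Qed.

Lemma affmap_plus i j c : (i < s)%N -> (j < s)%N -> affmap (fun k => upd k i (k i + k j + c)%N).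
Proof.
move=> hi hj; apply: aff_upd => //; apply: aff_add; last exact: aff_cst.
by apply: aff_add; apply: aff_crd.
Qed.

Lemma res1_ext D a a' : (forall k, supp D k -> a k = a' k) -> res1 D a -> res1 D a'.
Proof.
move=> e h P hP; apply: (Rsum_ext _ (h P hP)) => k hk; by rewrite e.
Qed.

Lemma res1_cst D b a : index_set D -> (forall k, supp D k -> a k = b) -> res1 D a.
Proof.
move=> hD e P hP; apply: (Rsum_ext _ (hP D id b hD affmap_id)) => k hk.
by rewrite e.
Qed.

Lemma res1_pull D a phi : affmap phi -> res1 D (fun k => a (phi k)) ->
  forall P : env -> bool -> Prop,
  (forall D' psi b, index_set D' -> affmap psi -> Rsum D' (fun k => P (psi k) b)) ->
  Rsum D (fun k => P (phi k) (a (phi k))).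
Proof.
move=> hphi h P hP; apply: (h (fun k b => P (phi k) b)) => D' psi b hD' hpsi.
by apply: (hP D' (fun k => phi (psi k))) => //; apply: affmap_comp.
Qed.

Lemma res1_mod D i N a : index_set D -> i \in D -> (0 < N)%N ->
  (forall c, (c < N)%N -> res1 D (fun k => a (upd k i (N * k i + c)%N))) -> res1 D a.
Proof.
move=> [_ hD] hi N0 h P hP; have his := hD _ hi.
apply: (Rsum_mod hi his N0) => c hc.
exact: (res1_pull (phi := fun k => upd k i (N * k i + c)%N) (affmap_mod N c his) (h c hc) hP).
Qed.

Lemma res1_cmp D i j a : index_set D -> i \in D -> j \in D -> i != j ->
  res1 D (fun k => a (upd k i (k i + k j + 0)%N)) ->
  res1 D (fun k => a (upd k j (k j + k i + 1)%N)) -> res1 D a.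
Proof.
move=> [_ hD] hi hj ij h1 h2 P hP.
apply: (Rsum_cmp hi hj ij (hD _ hi) (hD _ hj)).
  have := res1_pull (phi := fun k => upd k i (k i + k j + 0)%N) (affmap_plus 0 (hD _ hi) (hD _ hj)) h1 hP.
  by apply: Rsum_ext => k _; rewrite addn0.
exact: (res1_pull (phi := fun k => upd k j (k j + k i + 1)%N) (affmap_plus 1 (hD _ hj) (hD _ hi)) h2 hP).
Qed.

Lemma res1_succ D i a : index_set D -> i \in D -> res1 (rem i D) a ->
  res1 D (fun k => a (upd k i (1 * k i + 1)%N)) -> res1 D a.
Proof.
move=> [hu hD] hi h1 h2 P hP.
apply: (Rsum_zero_succ hu hi (hD _ hi)); first exact: h1.
have := res1_pull (phi := fun k => upd k i (1 * k i + 1)%N) (affmap_mod 1 1 (hD _ hi)) h2 hP.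
by apply: Rsum_ext => k _; rewrite mul1n addn1.
Qed.

Lemma res1_neg D a : res1 D a -> res1 D (fun k => ~~ a k).
Proof. by move=> h P hP; apply: (h (fun k b => P k (~~ b))) => D' phi b; apply: hP. Qed.

Definition laff c0 (c : nat -> int) (k : env) : int := c0 + \sum_(i < s) c i * (k i)%:Z.

Lemma iaff_lin f : iaff f -> exists c0 c, forall k, f k = laff c0 c k.
Proof.
move=> h; elim: h => {f} [c|j hj|f1 g1 _ [c1 [c e1]] _ [d1 [d e2]]|f1 _ [c1 [c e1]]].
- exists c, (fun=> 0) => k; rewrite /laff big1; first by rewrite addr0.
  by move=> i _; rewrite mul0r.
- exists 0, (fun i => if i == j then 1 else 0) => k.
  rewrite /laff add0r (bigD1 (Ordinal hj)) //= eqxx mul1r big1; first by rewrite addr0.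
  move=> i hi.
  rewrite (_ : (i : nat) == j = false) ?mul0r //; apply/negP => /eqP e.
  by case/eqP: hi; apply: val_inj.
- exists (c1 + d1), (fun i => c i + d i) => k; rewrite e1 e2 /laff addrACA -big_split /=.
  by congr (_ + _); apply: eq_bigr => i _; rewrite mulrDl.
- exists (- c1), (fun i => - c i) => k; rewrite e1 /laff opprD -sumrN.
  by congr (_ + _); apply: eq_bigr => i _; rewrite mulNr.
Qed.

Lemma laffD1 c0 c k i : (i < s)%N ->
  laff c0 c k = c0 + (c i * (k i)%:Z + \sum_(j < s | (j : nat) != i) c j * (k j)%:Z).
Proof.
move=> hi; rewrite /laff (bigD1 (Ordinal hi)) //=.
Qed.

Lemma laff_upd c0 c k i x : (i < s)%N -> laff c0 c (upd k i x) = laff c0 c k + c i * (x%:Z - (k i)%:Z).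
Proof.
move=> hi; rewrite !(laffD1 _ _ _ hi) /upd eqxx.
rewrite (eq_bigr (fun j : 'I_s => c j * (k j)%:Z)); first by ring.
by move=> j /negbTE ->.
Qed.

Definition setc (c : nat -> int) i x : nat -> int := fun j => if j == i then x else c j.

Lemma laff_setc c0 d0 c k i x : (i < s)%N ->
  laff (c0 + d0) (setc c i x) k = laff c0 c k + d0 + (x - c i) * (k i)%:Z.
Proof.
move=> hi; rewrite !(laffD1 _ _ _ hi) /setc eqxx.
rewrite (eq_bigr (fun j : 'I_s => c j * (k j)%:Z)); first by ring.
by move=> j /negbTE ->.
Qed.

Lemma laff_mod c0 c k i N r : (i < s)%N ->
  laff c0 c (upd k i (N * k i + r)%N) = laff (c0 + c i * r%:Z) (setc c i (c i * N%:Z)) k.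
Proof. by move=> hi; rewrite laff_upd // laff_setc // PoszD PoszM; ring. Qed.

Lemma laff_plus c0 c k i j r : (i < s)%N -> (j < s)%N -> i != j ->
  laff c0 c (upd k i (k i + k j + r)%N) = laff (c0 + c i * r%:Z) (setc c j (c j + c i)) k.
Proof. by move=> hi hj ij; rewrite laff_upd // laff_setc // !PoszD; ring. Qed.

Lemma laff_const D c0 c k : supp D k -> (forall i, i \in D -> c i = 0) -> laff c0 c k = c0.
Proof.
move=> hk h; rewrite /laff big1; first by rewrite addr0.
move=> i _; by have [/h->|/hk->] := boolP (nat_of_ord i \in D); rewrite ?mul0r ?mulr0.
Qed.

Lemma count_lt (T : eqType) (p p' : pred T) (D : seq T) i : (forall j, p' j -> p j) ->
  i \in D -> p i -> ~~ p' i -> (count p' D < count p D)%N.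
Proof.
move=> h; elim: D => //= j D IH; rewrite in_cons => /orP[/eqP<-|hi] hp hp'.
  by rewrite hp (negbTE hp') ltnS; apply: sub_count.
have := IH hi hp hp'; case: (boolP (p' j)) => [/h->|_] //=; by lia.
Qed.

(** Splitting a coordinate modulo [N] makes its coefficient a multiple of [N]. Once all of them are,
    the constant term decides. *)
Lemma res1_dvd D N c0 c : index_set D -> (0 < N)%N -> res1 D (fun k => (N%:Z %| laff c0 c k)%Z).
Proof.
move=> hD N0.
have [n hn] := ubnP (count (fun i => ~~ (N%:Z %| c i)%Z) D).
elim: n c0 c hn => // n IH c0 c hn.
have [/hasP[i hi hci]|/hasPn hno] := boolP (has (fun i => ~~ (N%:Z %| c i)%Z) D).
  apply: (res1_mod hD hi N0) => r _.
  have his := hD.2 _ hi.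
  apply: (res1_ext _ (IH (c0 + c i * r%:Z) (setc c i (c i * N%:Z)) _)).
    by move=> k _; rewrite laff_mod.
  move: hn; rewrite ltnS; apply: leq_trans; apply: (count_lt _ hi) => //.
    move=> j; rewrite /setc; case: (j == i) => //; by rewrite dvdz_mull.
  by rewrite /setc eqxx negbK dvdz_mull.
apply: (res1_cst (b := (N%:Z %| c0)%Z)) => // k hk.
rewrite /laff rpredDr //; apply: rpred_sum => i _; have [/hno|/hk->] := boolP (nat_of_ord i \in D); last by rewrite mulr0 dvdz0.
by rewrite negbK => h; apply: dvdz_mulr.
Qed.

(* All relevant coefficients are nonnegative: each successor step either kills a coordinate or raises the constant term. *)
Lemma res1_pos D c0 c : index_set D -> (forall i, i \in D -> 0 <= c i) -> res1 D (fun k => 0 <= laff c0 c k).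
Proof.
have [n hn] := ubnP (size D + absz (Num.min c0 0))%N.
elim: n D c0 hn => // n IH D c0 hn hD hc.
have [c00|c00] := leP 0 c0.
  apply: (res1_cst (b := true)) => // k hk; rewrite /laff addr_ge0 // sumr_ge0 // => i _.
  by have [/hc h|/hk->] := boolP (nat_of_ord i \in D); rewrite ?mulr0 // mulr_ge0.
have [/hasP[i hi hci]|/hasPn hno] := boolP (has (fun i => c i != 0) D); last first.
  apply: (res1_cst (b := false)) => // k hk.
  rewrite (laff_const _ hk) ?leNgt ?c00 // => i /hno; rewrite negbK => /eqP //.
have his := hD.2 _ hi.
have D0 : (0 < size D)%N by case: (D) hi.
apply: (res1_succ hD hi).
- apply: IH.
  + rewrite size_rem //; move: hn D0; clear; lia.
  + split; first by rewrite rem_uniq // hD.1.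
    by move=> j /mem_rem /hD.2.
  + by move=> j /mem_rem /hc.
- have ci : 0 < c i by rewrite lt_def hci hc.
  apply: (res1_ext _ (IH D (c0 + c i) _ hD hc)).
    by move=> k _; rewrite laff_upd // mul1n PoszD /laff; congr (0 <= _); ring.
  by move: hn ci c00; move: (c i) (size D) => x z; clear; lia.
Qed.

Lemma laff_opp c0 c k : (0 <= laff c0 c k) = ~~ (0 <= laff (- c0 - 1) (fun i => - c i) k).
Proof.
have -> : laff (- c0 - 1) (fun i => - c i) k = - laff c0 c k - 1.
  rewrite /laff (eq_bigr (fun i : 'I_s => - (c i * (k i)%:Z))); last by move=> i _; rewrite mulNr.
  by rewrite sumrN; ring.
by move: (laff _ _ _) => x; lia.
Qed.

(** While both [C] and [- C] occur, comparing the two coordinates turns one of the coefficients into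
    0. When only one sign is left, [res1_pos] concludes, possibly after negation. *)
Lemma res1_eqabs D C c0 c : index_set D -> (forall i, i \in D -> [\/ c i = 0, c i = C | c i = - C]) ->
  0 < C -> res1 D (fun k => 0 <= laff c0 c k).
Proof.
move=> hD + C0; have [n hn] := ubnP (count (fun i => c i != 0) D).
elim: n c0 c hn => // n IH c0 c hn hc.
have [/hasP[i hi /eqP hci]|/hasPn hnp] := boolP (has (fun i => c i == C) D); last first.
  apply: (res1_ext (fun k _ => esym (laff_opp c0 c k))); apply: res1_neg; apply: res1_pos => // i hi.
  have := hnp _ hi; case: (hc _ hi) => ->; by move: C0; clear; lia.
have [/hasP[j hj /eqP hcj]|/hasPn hnn] := boolP (has (fun i => c i == - C) D); last first.
  apply: res1_pos => // j hj.
  have := hnn _ hj; case: (hc _ hj) => ->; by move: C0; clear; lia.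
have his := hD.2 _ hi; have hjs := hD.2 _ hj.
have ij : i != j by apply/eqP => e; move: hci hcj C0; rewrite e => ->; clear; lia.
have ji : j != i by rewrite eq_sym.
have red a0 l : l \in D -> c l != 0 -> res1 D (fun k => 0 <= laff a0 (setc c l 0) k).
  move=> hl hcl; apply: IH; last by move=> m hm; rewrite /setc; case: eqP => _; [constructor 1|apply: hc].
  move: hn; rewrite ltnS; apply: leq_trans; apply: (count_lt _ hl) => //; last by rewrite /setc !eqxx.
  by move=> m; rewrite /setc; case: (m == l); rewrite ?eqxx.
apply: (res1_cmp hD hi hj ij).
  apply: (res1_ext _ (red (c0 + c i * 0%:Z) j hj _)); last by rewrite hcj oppr_eq0 gt_eqF.
  by move=> k _; rewrite laff_plus // hci hcj addNr.
apply: (res1_ext _ (red (c0 + c j * 1%:Z) i hi _)); last by rewrite hci gt_eqF.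
by move=> k _; rewrite laff_plus // hci hcj subrr.
Qed.


Lemma setc_eq c i x : setc c i x i = x.
Proof. by rewrite /setc eqxx. Qed.

(** Splitting coordinate [i] modulo [C / |c i|] multiplies its coefficient by that number, so that
    all nonzero coefficients reach the common absolute value [C]. *)
Lemma res1_ge_dvd D (C : nat) c0 c : index_set D -> (0 < C)%N -> (forall i, i \in D -> c i != 0 -> (absz (c i) %| C)%N) ->
  res1 D (fun k => 0 <= laff c0 c k).
Proof.
move=> hD C0; pose p (c : nat -> int) (i : nat) := (c i != 0) && (absz (c i) != C).
have [n hn] := ubnP (count (p c) D).
elim: n c0 c hn => // n IH c0 c hn hc.
have [/hasP[i hi hpi]|/hasPn hno] := boolP (has (p c) D); last first.
  apply: (@res1_eqabs D C%:Z) => // i hi.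
  have := hno _ hi; rewrite /p negb_and !negbK => /orP[/eqP->|/eqP hci]; first by constructor 1.
  have [h|h] := leP 0 (c i); [constructor 2|constructor 3]; by rewrite -hci; move: h; clear; lia.
have his := hD.2 _ hi; have /andP[ci0 ciC] := hpi; have hdv := hc _ hi ci0.
have N0 : (0 < C %/ absz (c i))%N by rewrite divn_gt0 ?absz_gt0 // dvdn_leq.
have eN : absz (c i * (C %/ absz (c i))%N%:Z) = C by rewrite abszM mulnC divnK.
apply: (res1_mod hD hi N0) => r _.
apply: (res1_ext _ (IH (c0 + c i * r%:Z) (setc c i (c i * (C %/ absz (c i))%N%:Z)) _ _)).
- by move=> k _; rewrite laff_mod.
- move: hn; rewrite ltnS; apply: leq_trans; apply: (count_lt _ hi) => //.
    by move=> j; rewrite /p /setc; case: (j == i) => //; rewrite eN eqxx andbF.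
  by rewrite /p setc_eq eN eqxx andbF.
- move=> j hj; rewrite /setc; case: (j == i); last exact: hc.
  by rewrite eN.
Qed.

Lemma res1_ge D c0 c : index_set D -> res1 D (fun k => 0 <= laff c0 c k).
Proof.
move=> hD; pose C := (\prod_(i <- D | c i != 0) absz (c i))%N.
have C0 : (0 < C)%N by apply: prodn_cond_gt0 => i h; rewrite absz_gt0.
apply: (@res1_ge_dvd D C) => // i hi ci.
by rewrite /C (big_rem i hi) /= ci dvdn_mulr.
Qed.

(** Stability under affine substitution is built in because resolving one condition of a conjunction
    leaves the other to be resolved on affine images of orthants. *)
Definition res (a : env -> bool) := forall phi D, affmap phi -> index_set D -> res1 D (fun k => a (phi k)).

Lemma res_ge f : iaff f -> res (fun k => 0 <= f k).
Proof.
move=> hf phi D hphi hD; have [c0 [c e]] := iaff_lin (iaff_comp hf hphi).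
by apply: (@res1_ext D (fun k => 0 <= laff c0 c k)); [move=> k _; rewrite e|apply: res1_ge].
Qed.

Lemma res_dvd N f : (0 < N)%N -> iaff f -> res (fun k => (N%:Z %| f k)%Z).
Proof.
move=> N0 hf phi D hphi hD; have [c0 [c e]] := iaff_lin (iaff_comp hf hphi).
by apply: (@res1_ext D (fun k => (N%:Z %| laff c0 c k)%Z)); [move=> k _; rewrite e|apply: res1_dvd].
Qed.

Lemma res_neg a : res a -> res (fun k => ~~ a k).
Proof. by move=> h phi D hphi hD; apply: res1_neg; apply: h. Qed.

Lemma res_and a b : res a -> res b -> res (fun k => a k && b k).
Proof.
move=> ha hb phi D hphi hD P hP.
apply: (ha phi D hphi hD (fun k x => P k (x && b (phi k)))) => D1 psi x hD1 hpsi.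
apply: (hb (fun k => phi (psi k)) D1 (affmap_comp hphi hpsi) hD1 (fun k y => P (psi k) (x && y))).
move=> D2 psi2 y hD2 hpsi2; apply: (hP D2 (fun k => psi (psi2 k))) => //; exact: affmap_comp.
Qed.

Lemma res_cst b : res (fun=> b).
Proof. by move=> phi D hphi hD; apply: (res1_cst (b := b)). Qed.

Lemma res_Rsum a D : index_set D -> res a -> Rsum D (fun k => a k).
Proof.
move=> hD h; apply: (h id D affmap_id hD (fun _ b => b)) => D' phi [] hD' _.
  by apply: (@Rsum_ext R s D' (fun=> True)); [|apply: Rsum_true hD'.1 hD'.2].
by apply: (@Rsum_ext R s D' (fun=> False)); [|apply: Rsum_false].
Qed.

Section Base.
Variables (K F : fieldType) (v : F -> int) (io : {rmorphism K -> F}) (pi : F).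

Definition trunc (k : env) : nat -> int := fun j => if (j < s)%N then (k j)%:Z else 0.

Lemma iaff_trunc j : iaff (fun k => trunc k j).
Proof. by rewrite /trunc; case: ltnP => h; [apply: iaff_crd|apply: iaff_cst]. Qed.

(** Without field variables all ring atoms are constants, and a Presburger formula in the integer
    variables remains. *)
Lemma dfn0_res P : Dk v io pi (k := 0) P -> exists2 a, res a & forall k, P (trunc k, tt) <-> a k.
Proof.
have hlin t : Definable.lin v (fun y : (nat -> int) * pt F 0 => @evk K F io 0 y.2 : RI K 0 -> F) (@Tk F 0) (fun=> True) t ->
    iaff (fun k => t (trunc k, tt)).
  elim=> {t} [c|t [i ->]|g _|t1 t2 _ h1 _ h2|t _ h1].
  - exact: (iaff_cst s c).
  - exact: (iaff_trunc i).
  - exact: (iaff_cst s (v (io g))).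
  - exact: (iaff_add h1 h2).
  - exact: (iaff_opp h1).
elim=> {P} [g _|M u g _|t ht|N t ht|P Q _ [a ha ea] _ [b hb eb]|P _ [a ha ea]|P Q e _ [a ha ea]].
- by exists (fun=> io g == 0); [apply: res_cst|move=> k; split=> /eqP].
- by exists (fun=> ac v pi M u (io g)); [apply: res_cst|].
- by exists (fun k => 0 <= t (trunc k, tt)); [apply: res_ge; apply: hlin|].
- have hl := hlin _ ht; have [N0|N0] := eqVneq N 0.
    exists (fun k => (0 <= t (trunc k, tt)) && (0 <= - t (trunc k, tt))).
      by apply: res_and; apply: res_ge => //; apply: iaff_opp.
    move=> k; rewrite N0 dvd0z; move: (t _) => x; lia.
  exists (fun k => ((absz N)%:Z %| t (trunc k, tt))%Z); first by apply: res_dvd; rewrite ?absz_gt0.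
  by move=> k; rewrite !dvdzE.
- by exists (fun k => a k && b k); [apply: res_and|move=> k; rewrite ea eb; split=> [[-> ->]|/andP]].
- by exists (fun k => ~~ a k); [apply: res_neg|move=> k; rewrite ea; split=> /negP].
- by exists a => // k; rewrite -ea -e.
Qed.

End Base.
End Presburger.

(** * Rationality *)

Section Codes.
Variables (K F : fieldType) (v : F -> int) (io : {rmorphism K -> F}).
Hypothesis hv : is_padic_val v.
Variable pi : F.
Hypotheses (pi0 : pi != 0) (vpi : v pi = 1).
Local Notation vge := (vge v).
Local Notation evk := (@Tower.evk K F io _).
Local Notation tower_eq := (@Tower.tower_eq K F v io _).
Local Notation nonvanishing := (@Tower.nonvanishing K F io _).
Local Notation delineated := (@Tower.delineated K F v io _).
Local Notation radius := (@Tower.radius K F v io _).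
Local Notation pint := (pall (fun x : F => vge 0 x)).
Local Notation env := (nat -> int).
Local Notation ev k := (fun y : env * pt F k => @Tower.evk K F io k y.2 : RI K k -> F).

Lemma evkC k (z : pt F k.+1) (c : RI K k) : evk z (c%:P : RI K k.+1) = evk z.1 c.
Proof. by rewrite /= /horner_eval /= map_polyC hornerC. Qed.

Lemma evkX k (z : pt F k.+1) : evk z ('X : {poly RI K k}) = z.2.
Proof. by rewrite /= /horner_eval /= map_polyX hornerX. Qed.

Lemma evk_bound k (g : RI K k) : exists C : nat, forall x, pint x -> vge (- C%:Z) (evk x g).
Proof.
elim: k g => [|k IH] g.
  exists (absz (v (io g))) => x _; apply: vge_le (vge_self _ _) => /=.
  by move: (v _) => z; clear; lia.
have evkD (x : pt F k.+1) (p : {poly RI K k}) c :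
    @Tower.evk K F io k.+1 x (p * 'X + c%:P) = @Tower.evk K F io k.+1 x p * x.2 + evk x.1 c.
  by rewrite -[in RHS](evkX x) -(evkC x c) -rmorphM -rmorphD.
have ev0 (x : pt F k.+1) : @Tower.evk K F io k.+1 x (0 : {poly RI K k}) = 0 by exact: (rmorph0 (@Tower.evk K F io k.+1 x)).
elim/(@poly_ind (RI K k)): g => [|p c [Cp hp]].
  by exists 0%N => x _; rewrite ev0 vge0.
have [Cc hc] := IH c; exists (maxn Cp Cc) => x [hx1 hx2].
rewrite evkD; apply: (vgeD hv).
  rewrite mulrC; apply: (vgeM0 hv) => //.
  by apply: vge_le (hp x (conj hx1 hx2)); have := leq_maxl Cp Cc; move: (maxn _ _) => z; clear; lia.
apply: vge_le (hc x.1 hx1).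
by have := leq_maxr Cp Cc; move: (maxn _ _) => z; clear; lia.
Qed.

Lemma evk_bounds (T : eqType) k (G : T -> RI K k) (s : seq T) : exists C : nat, forall g x, g \in s -> pint x ->
  vge (- C%:Z) (evk x (G g)).
Proof.
elim: s => [|g s [C IH]]; first by exists 0%N.
have [C' h] := evk_bound (G g); exists (maxn C C') => g' x; rewrite in_cons => /orP[/eqP->|hg] hx.
  by apply: vge_le (h x hx); have := leq_maxr C C'; move: (maxn _ _) => z; clear; lia.
by apply: vge_le (IH g' x hg hx); have := leq_maxl C C'; move: (maxn _ _) => z; clear; lia.
Qed.

(** All levels lifted to the top ring, each polynomial with its precision; a class is described by
    one flat list of leading terms. *)
Fixpoint fullp k : tower K k -> seq (RI K k * nat) :=
  if k is k'.+1 then fun tau => [seq ((p.1)%:P : RI K k'.+1, p.2) | p <- @fullp k' tau.1] ++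
    [seq (g, tau.2.2) | g <- tau.2.1]
  else fun=> [::].

Lemma teq_fullp k (tau : tower K k) x y : tower_eq tau x y <->
  forall p, p \in fullp tau -> eqrv v p.2 (evk x p.1) (evk y p.1).
Proof.
elim: k tau x y => [|k IH] tau x y; first by split.
split=> [[h1 h2] p|h].
  rewrite mem_cat => /orP[/mapP[p' hp' ->]|/mapP[g hg ->]]; last exact: h2.
  by rewrite !evkC; apply: (proj1 (IH tau.1 x.1 y.1)).
split=> [|g hg].
  apply: (proj2 (IH tau.1 x.1 y.1)) => p hp; rewrite -!evkC.
  by apply: (h (p.1%:P : RI K k.+1, p.2)); rewrite mem_cat; apply/orP; left; apply/mapP; exists p.
by apply: (h (g, tau.2.2)); rewrite mem_cat; apply/orP; right; apply/mapP; exists g.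
Qed.

Lemma ndg_fullp k (tau : tower K k) x : nonvanishing tau x <-> forall p, p \in fullp tau -> evk x p.1 != 0.
Proof.
elim: k tau x => [|k IH] tau x; first by split.
split=> [[h1 h2] p|h].
  rewrite mem_cat => /orP[/mapP[p' hp' ->]|/mapP[g hg ->]]; last exact: h2.
  by rewrite evkC; apply: (proj1 (IH tau.1 x.1)).
split=> [|g hg].
  apply: (proj2 (IH tau.1 x.1)) => p hp; rewrite -evkC.
  by apply: (h (p.1%:P : RI K k.+1, p.2)); rewrite mem_cat; apply/orP; left; apply/mapP; exists p.
by apply: (h (g, tau.2.2)); rewrite mem_cat; apply/orP; right; apply/mapP; exists g.
Qed.

Lemma fullp_good k (tau : tower K k) p : delineated tau -> p \in fullp tau -> p.1 != 0 /\ (0 < p.2)%N.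
Proof.
elim: k tau p => // k IH tau p [h1 [M0 _ hn _ _] _].
rewrite mem_cat => /orP[/mapP[p' hp' ->]|/mapP[g hg ->]] /=.
  by have [a b] := IH _ _ h1 hp'; rewrite polyC_eq0.
by split=> //; apply: hn.
Qed.

Definition tmax k (tau : tower K k) : nat := \max_(p <- fullp tau) p.2.

(** A radius is a difference of two valuations of tower polynomials, so bounds on these valuations
    bound all radii. *)
Lemma tle_fullp k (tau : tower K k) x (C J N : nat) : delineated tau -> pint x ->
  (forall p, p \in fullp tau -> evk x p.1 != 0 /\ - C%:Z <= v (evk x p.1) <= J%:Z) ->
  (J + C + tmax tau <= N)%N -> radii_le v io N tau x.
Proof.
elim: k tau x => // k IH tau x [h1 [M0 hX hn hd hM] _] [p1 p2] h hN.
have hg g : g \in tau.2.1 -> - C%:Z <= v (evk x g) <= J%:Z.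
  by move=> hg; apply: (h (g, tau.2.2) _).2; rewrite mem_cat; apply/orP; right; apply/mapP; exists g.
have hMt : (tau.2.2 <= tmax tau)%N.
  apply: (@leq_bigmax_seq _ (fullp tau) xpredT (fun p => p.2) ('X : {poly RI K k}, tau.2.2)) => //.
  by rewrite mem_cat; apply/orP; right; apply/mapP; exists ('X : {poly RI K k}).
split.
  apply: IH => // [p hp|].
    by rewrite -evkC; apply: (h (p.1%:P : RI K k.+1, p.2)); rewrite mem_cat; apply/orP; left; apply/mapP; exists p.
  apply: leq_trans hN; rewrite leq_add2l /tmax /= big_cat big_map; exact: leq_maxl.
have : radius tau.2.1 x <= (J + C)%N%:Z.
  rewrite /Tower.radius big_seq_cond; elim/big_ind: _ => [|a b ha hb|g /andP[hgg g0]].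
  - by have := hg _ hX; move: (v _) => z; clear; lia.
  - by rewrite /Num.max; case: ifP.
  - have := hg _ hgg; have := hg _ (hd _ hgg g0); move: (v _) (v _) => a b; clear; lia.
by move: hMt hN; move: (radius _ _) (tmax tau) => a b; clear; lia.
Qed.

Lemma tle_mono N N' k (tau : tower K k) x : (N <= N')%N -> radii_le v io N tau x -> radii_le v io N' tau x.
Proof.
move=> hN; elim: k tau x => // k IH tau x [h1 h2]; split; first exact: IH.
by apply: le_trans h2 _; rewrite lez_nat.
Qed.

Lemma tle_ex k (tau : tower K k) x : exists N, radii_le v io N tau x.
Proof.
elim: k tau x => [|k IH] tau x; first by exists 0%N.
have [N h] := IH tau.1 x.1.
exists (N + absz (tau.2.2%:Z + radius tau.2.1 x)%R)%N; split; first by apply: tle_mono h; apply: leq_addr.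
by move: (_ + radius _ _) => z; clear; lia.
Qed.

Definition dlin k := lin v (ev k) (@Tk F k) (fun=> True).
Definition dpwl k := pwl v pi (ev k) (@Tk F k) (fun=> True) (fun=> True).

Lemma up_lin k t : dlin t -> dlin (fun y : env * pt F k.+1 => t (y.1, y.2.1)).
Proof.
elim=> {t} [c|t [i ->]|g _|t1 t2 _ h1 _ h2|t _ h1].
- exact: lin_cst.
- by apply: lin_var; exists i.
- apply: (lin_ext _ (lin_val v (ev k.+1) (@Tk F k.+1) (A := fun=> True) (g := g%:P) I)) => y.
  by rewrite evkC.
- exact: lin_add.
- exact: lin_opp.
Qed.

Lemma up_dfn k P : Dk v io pi P -> Dk v io pi (fun y : env * pt F k.+1 => P (y.1, y.2.1)).
Proof.
elim=> {P} [g _|M u g _|t ht|N t ht|P Q _ h1 _ h2|P _ h1|P Q e _ h1].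
- apply: (d_ext _ (d_zero v pi (ev k.+1) (@Tk F k.+1) (A := fun=> True) (g := g%:P) I)) => y.
  by rewrite evkC.
- apply: (d_ext _ (d_ac v pi (ev k.+1) (@Tk F k.+1) M u (A := fun=> True) (g := g%:P) I)) => y.
  by rewrite evkC.
- by apply: d_ge; apply: up_lin.
- by apply: d_dvd; apply: up_lin.
- exact: d_and.
- exact: d_not.
- by apply: d_ext h1 => y; apply: e.
Qed.

Lemma up_pwl k G t : pwl v pi (ev k) (@Tk F k) (fun=> True) G t ->
  pwl v pi (ev k.+1) (@Tk F k.+1) (fun=> True) (fun y => G (y.1, y.2.1)) (fun y => t (y.1, y.2.1)).
Proof.
elim=> {G t} [G l t ht e|G l D hD _ h1 _ h2].
  by apply: (pwl_lin pi (up_lin ht)) => y; apply: e.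
exact: (pwl_split (up_dfn hD) h1 h2).
Qed.

Lemma rad_pwl k (G : seq (RI K k.+1)) : dpwl (fun y : env * pt F k.+1 => radius G y.2).
Proof.
pose s : seq (option {poly RI K k}) := None :: [seq Some g | g <- (G : seq {poly RI K k}) & g^`() != 0].
pose ta (i : option {poly RI K k}) (y : env * pt F k.+1) := if i is Some g then
   v (@Tower.evk _ _ io k.+1 y.2 g) - v (@Tower.evk _ _ io k.+1 y.2 g^`())
   else v (@Tower.evk _ _ io k.+1 y.2 ('X : {poly RI K k})).
have hl i : dlin (ta i).
  case: i => [g|]; last exact: (lin_val v (ev k.+1) (@Tk F k.+1) (A := fun=> True) I).
  by apply: lin_sub; apply: (lin_val v (ev k.+1) (@Tk F k.+1) (A := fun=> True) I).
have hub i y : i \in s -> ta i y <= radius G y.2.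
  rewrite in_cons => /orP[/eqP->|/mapP[g]]; first exact: Order.TotalTheory.bigmax_ge_id.
  by rewrite mem_filter => /andP[g0 hg] ->; apply: rad_ge.
have hatt y : exists2 i, i \in s & radius G y.2 = ta i y.
  rewrite /Tower.radius big_seq_cond; elim/big_ind: _ => [|a b ha hb|g /andP[hg g0]].
  - by exists None; rewrite ?mem_head.
  - by rewrite /Num.max; case: ifP.
  - by exists (Some g) => //; rewrite in_cons; apply/orP; right; apply/mapP; exists g; rewrite ?mem_filter ?g0.
apply: (pwl_cover (s := s) (D := fun i y => forall j, j \in s -> ta j y <= ta i y) (tau := ta)).
- by move=> i _; apply: dfn_all => j _; apply: dfn_le; apply: hl.
- by move=> i _; apply: hl.
- move=> y _; have [i hi e] := hatt y; exists i => // j hj; rewrite -e; exact: hub.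
- move=> y i hi _ h; have [j hj e] := hatt y; apply/eqP; rewrite eq_le hub // andbT e; exact: h.
Qed.

Lemma tr_pwl k (tau : tower K k) : dpwl (fun y : env * pt F k => total_radius v io tau y.2).
Proof.
elim: k tau => [|k IH] tau; first by apply: (pwl_lin pi (lin_cst _ _ _ _ 0)).
have h1 := up_pwl (IH tau.1).
have h2 := rad_pwl tau.2.1.
have h3 : dpwl (fun y : env * pt F k.+1 => tau.2.2%:Z + radius tau.2.1 y.2).
  by apply: pwl_add => //; apply: (pwl_lin pi (lin_cst _ _ _ _ tau.2.2%:Z)).
exact: pwl_add h1 h3.
Qed.

Definition dgraph k (f : pt F k -> int) := forall i, Dk v io pi (fun y : env * pt F k => y.1 i = f y.2).

Lemma tr_graph k (tau : tower K k) : dgraph (total_radius v io tau).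
Proof.
move=> i; have h := pwl_dfn (Q := fun y z => y.1 i = z) _ _ (tr_pwl tau).
have h' : Dk v io pi (fun y : env * pt F k => True /\ y.1 i = total_radius v io tau y.2).
  apply: h; last exact: dfn_const.
  by move=> t ht; apply: dfn_eqz => //; apply: lin_var; exists i.
by apply: d_ext h' => y; split=> [[]|].
Qed.

Lemma v_graph k (g : RI K k) (C : int) : dgraph (fun x => v (evk x g) + C).
Proof.
move=> i; apply: dfn_eqz; first by apply: lin_var; exists i.
by apply: lin_add; [apply: (lin_val v (ev k) (@Tk F k) (A := fun=> True) I)|apply: lin_cst].
Qed.

Lemma idx_graph k (g : RI K k) M : dgraph (fun x => (idx v pi M (evk x g))%:Z).
Proof.
move=> i.
have h : Dk v io pi (fun y : env * pt F k => exists2 j, j \in seq.iota 0 (size (ulist v pi M)).+1 &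
    idx v pi M (evk y.2 g) = j /\ y.1 i = j%:Z).
  apply: dfn_ex => j _; apply: d_and; first exact: (dfn_idx v pi (ev k)).
  by apply: dfn_eqz; [apply: lin_var; exists i|apply: lin_cst].
apply: d_ext h => y; split=> [[j _ [-> ->]] //|e].
by exists (idx v pi M (evk y.2 g)) => //; rewrite mem_iota /= add0n ltnS /idx find_size.
Qed.

Lemma Dk_exall k (P : env * pt F k -> Prop) : Dk v io pi P ->
  Dk v io pi (k := 0) (fun y => exists x, P (y.1, x)).
Proof.
elim: k P => [|k IH] P hP.
  by apply: d_ext hP => -[E []]; split=> [h|[[]]] //; exists tt.
apply: d_ext (IH _ (Dk_ex hv pi0 vpi hP)) => y; split=> [[x [t h]]|[[x t] h]].
  by exists (x, t).
by exists x, t.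
Qed.

End Codes.

Section Rationality.
Variables (K F : fieldType) (v : F -> int) (io : {rmorphism K -> F}).
Hypothesis hv : is_padic_val v.
Variable pi : F.
Hypotheses (pi0 : pi != 0) (vpi : v pi = 1).
Local Notation vge := (vge v).
Local Notation evk := (@Tower.evk K F io _).
Local Notation tower_eq := (@Tower.tower_eq K F v io _).
Local Notation nonvanishing := (@Tower.nonvanishing K F io _).
Local Notation delineated := (@Tower.delineated K F v io _).
Local Notation total_radius := (@ClassVolume.total_radius K F v io _).
Local Notation pint := (pall (fun x : F => vge 0 x)).
Local Notation pcong n := (pall2 (fun x y : F => vge n%:Z (x - y))).
Local Notation env := (nat -> int).
Local Notation idx := (Tower.idx v pi).

Section Tower.
Variables (m : nat) (tau : tower K m) (C : nat).
Hypothesis htau : delineated tau.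
Hypothesis hC : forall p x, p \in fullp tau -> pint x -> vge (- C%:Z) (evk x p.1).

(* The shift by [C] makes the valuations nonnegative on integral points. *)
Definition feats : seq (pt F m -> int) :=
  total_radius tau :: [seq (fun x => v (evk x p.1) + C%:Z) | p <- fullp tau] ++
            [seq (fun x => (idx p.2 (evk x p.1))%:Z) | p <- fullp tau].

Lemma size_feats : size feats = (size (fullp tau) + size (fullp tau)).+1.
Proof. by rewrite /= size_cat !size_map. Qed.

Local Notation f0 := (fun=> 0).
Local Notation p0 := ((0, 0%N) : RI K m * nat).

Lemma feat_v i : (i < size (fullp tau))%N ->
  nth f0 feats i.+1 = (fun x => v (evk x (nth p0 (fullp tau) i).1) + C%:Z).
Proof. by move=> hi; rewrite /= nth_cat size_map hi (nth_map p0). Qed.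

Lemma feat_idx i : (i < size (fullp tau))%N -> nth f0 feats (size (fullp tau) + i).+1 =
  (fun x => (idx (nth p0 (fullp tau) i).2 (evk x (nth p0 (fullp tau) i).1))%:Z).
Proof.
by move=> hi; rewrite /= nth_cat size_map ltnNge leq_addr /= addKn (nth_map p0).
Qed.

Lemma featP (Q : (pt F m -> int) -> Prop) : Q (total_radius tau) ->
  (forall p, p \in fullp tau -> Q (fun x => v (evk x p.1) + C%:Z)) ->
  (forall p, p \in fullp tau -> Q (fun x => (idx p.2 (evk x p.1))%:Z)) ->
  forall i, (i < size feats)%N -> Q (nth f0 feats i).
Proof.
move=> q1 q2 q3 [|i] //; rewrite size_feats ltnS => hi.
have [hi'|hi'] := ltnP i (size (fullp tau)).
  by rewrite feat_v //; apply: q2; apply: mem_nth.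
have hj : (i - size (fullp tau) < size (fullp tau))%N by rewrite ltn_subLR.
by rewrite -(subnKC hi') feat_idx //; apply: q3; apply: mem_nth.
Qed.

(** Entry 0 holds the parameter [n] and entry 1 the total radius, so that the volume of the class is
    the monomial weight [w ^+ k 1]; the other entries determine the class. *)
Definition code (n : nat) (x : pt F m) : nat -> nat :=
  fun i => if i is i'.+1 then absz (nth f0 feats i' x) else n.

Lemma feat_ge0 i x : pint x -> nonvanishing tau x -> 0 <= nth f0 feats i x.
Proof.
move=> px nx; have [hi|hi] := ltnP i (size feats); last by rewrite nth_default.
apply: (featP (Q := fun f => 0 <= f x)) hi => //; first exact: (tr_ge0 htau).
move=> p hp; have := hC hp px; have h0 := proj1 (ndg_fullp io tau x) nx p hp.
by rewrite vgeE //; move: (v _) => z; clear; lia.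
Qed.

Lemma teq_code n x y : tower_eq tau x y -> code n x = code n y.
Proof.
move=> h; apply/funext => -[|i] //=; congr absz.
have [hi|hi] := ltnP i (size feats); last by rewrite nth_default.
have hf p : p \in fullp tau -> v (evk x p.1) = v (evk y p.1) /\ idx p.2 (evk x p.1) = idx p.2 (evk y p.1).
  move=> hp; have [_ p20] := fullp_good htau hp.
  by apply/(eqrv_idx hv pi0 vpi) => //; apply: (proj1 (teq_fullp v io tau x y) h).
apply: (featP (Q := fun f => f x = f y)) hi.
- exact: (teq_tr hv htau).
- by move=> p /hf [-> _].
- by move=> p /hf [_ ->].
Qed.

Lemma code_teq n n' x y : pint x -> nonvanishing tau x -> pint y -> nonvanishing tau y ->
  code n x = code n' y -> tower_eq tau x y.
Proof.
move=> px nx py ny e.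
have ef i : nth f0 feats i x = nth f0 feats i y.
  have := congr1 (fun f : nat -> nat => f i.+1) e => /= e'.
  have := feat_ge0 i px nx; have := feat_ge0 i py ny; move: e'.
  by move: (nth _ _ _ x) (nth _ _ _ y) => a b; clear; lia.
apply: (proj2 (teq_fullp v io tau x y)) => p hp.
have [_ p20] := fullp_good htau hp; have hi : (index p (fullp tau) < size (fullp tau))%N by rewrite index_mem.
apply/(eqrv_idx hv pi0 vpi) => //; split.
  by have := ef (index p (fullp tau)).+1; rewrite feat_v // nth_index // => /addIr.
have := ef (size (fullp tau) + index p (fullp tau)).+1; rewrite feat_idx // nth_index //.
by case.
Qed.

Lemma feat_graph i : (i < size feats)%N -> dgraph v io pi (nth f0 feats i).
Proof.
move=> hi; refine (featP (Q := fun f => dgraph v io pi f) _ _ _ hi).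
- exact: tr_graph.
- by move=> p _; apply: v_graph.
- by move=> p _; apply: idx_graph.
Qed.

Lemma ndg_dfn : Dk v io pi (fun y : env * pt F m => nonvanishing tau y.2).
Proof.
have h : Dk v io pi (fun y : env * pt F m => forall p, p \in fullp tau -> ~ evk y.2 p.1 = 0).
  apply: dfn_all => p _; apply: d_not.
  exact: (d_zero v pi (fun y : env * pt F m => @Tower.evk K F io m y.2 : RI K m -> F)).
apply: d_ext h => y; split=> h.
  by apply: (proj2 (ndg_fullp io tau y.2)) => p hp; apply/eqP; apply: h.
by move=> p hp; apply/eqP; apply: (proj1 (ndg_fullp io tau y.2)).
Qed.

End Tower.

Lemma pint_dfn k : Dk v io pi (fun y : env * pt F k => pint y.2).
Proof.
elim: k => [|k IH]; first exact: dfn_const.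
apply: d_and; first exact: (up_dfn IH).
have h : Dk v io pi (fun y : env * pt F k.+1 => evk y.2 ('X : {poly RI K k}) = 0 \/
    0 <= v (evk y.2 ('X : {poly RI K k}))).
  apply: dfn_or; first exact: (d_zero v pi (fun y : env * pt F k.+1 => @Tower.evk K F io k.+1 y.2 : RI K k.+1 -> F)).
  by apply: d_ge; apply: (lin_val v (fun y : env * pt F k.+1 => @Tower.evk K F io k.+1 y.2 : RI K k.+1 -> F)).
apply: d_ext h => y; rewrite evkX; split=> [h|/vgeP //]; by apply/vgeP.
Qed.

Variable ds : seq F.
Hypothesis hds : is_digits v ds.
Let q := size ds.
Local Notation cnt := (@Counting.cnt F pi ds _).

Lemma small_list (m : nat) (T : eqType) (g : T -> RI K m) (s : seq T) : (forall p, p \in s -> g p != 0) ->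
  exists c D : nat, forall j N, (D * j.+1 <= N)%N ->
  (cnt N (fun x => exists2 p, p \in s & vge (D * j.+1)%N%:Z (evk x (g p))) * q ^ j <= c * q ^ (N * m))%N.
Proof.
elim: s => [|p s IH] h.
  exists 0%N, 0%N => j N _; rewrite /Counting.cnt big1 // => x _.
  by rewrite asboolF // => -[].
have [c1 [D1 h1]] : exists c D : nat, forall j N, (D * j.+1 <= N)%N ->
  (cnt N (fun x => exists2 p, p \in s & vge (D * j.+1)%N%:Z (evk x (g p))) * q ^ j <= c * q ^ (N * m))%N.
  by apply: IH => p' hp'; apply: h; rewrite in_cons hp' orbT.
have [c2 [D2 [D20 h2]]] := small_set_count hv pi0 vpi hds io (h p (mem_head _ _)).
have hD1 j : (D1 * j.+1 <= maxn D1 D2 * j.+1)%N by rewrite leq_mul2r leq_maxl orbT.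
have hD2 j : (D2 * j.+1 <= maxn D1 D2 * j.+1)%N by rewrite leq_mul2r leq_maxr orbT.
exists (c1 + c2)%N, (maxn D1 D2) => j N hN.
have a1 := h1 j N (leq_trans (hD1 j) hN); have a2 := h2 j N (leq_trans (hD2 j) hN).
rewrite mulnDl; apply: leq_trans (leq_add a1 a2); rewrite -mulnDl leq_mul2r; apply/orP; right.
apply: leq_trans (cnt_or hv pi0 vpi hds _ _ _); apply: (cnt_mono hv pi0 vpi hds) => x _ [p'].
have hle D : (D * j.+1 <= maxn D1 D2 * j.+1)%N -> ((D * j.+1)%N%:Z <= (maxn D1 D2 * j.+1)%N%:Z) by [].
rewrite in_cons => /orP[/eqP->|hp'] hx; [right|left]; first exact: vge_le (hle _ (hD2 j)) hx.
by exists p' => //; apply: vge_le (hle _ (hD1 j)) hx.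
Qed.


Lemma digits_gt1 : (1 < q)%N.
Proof.
have [_ _ _ hc] := hds.
have [a ha h0] := hc 0 (vge0 _ _); have [b hb h1] := hc 1 (vge1 hv).
have ab : a != b.
  apply/eqP => e; have := vgeB hv h1 h0.
  by rewrite e sub0r opprK subrK vgeE ?oner_neq0 // (v1 hv).
have := @uniq_leq_size _ [:: a; b] ds; rewrite /= inE ab; apply=> // x.
by rewrite !inE => /orP[/eqP->|/eqP->].
Qed.

Lemma sum_classes (T U : eqType) (c : T -> U) (Y : T -> Prop) (L : seq T) : exists r : seq U,
  [/\ uniq r, forall k, k \in r -> exists2 x, Y x & c x = k &
   (\sum_(x <- L) (`[< Y x >] : nat) <= \sum_(k <- r) \sum_(x <- L) (`[< Y x /\ c x = k >] : nat))%N].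
Proof.
exists (undup [seq c x | x <- L & `[< Y x >]]); split; first exact: undup_uniq.
  by move=> k; rewrite mem_undup => /mapP[x]; rewrite mem_filter => /andP[/asboolP hx _] ->; exists x.
rewrite exchange_big big_seq [X in (_ <= X)%N]big_seq; apply: leq_sum => x hx.
case: asboolP => // hY; rewrite (bigD1_seq (c x)) ?undup_uniq //=; last first.
  by rewrite mem_undup; apply/mapP; exists x => //; rewrite mem_filter hx andbT; apply/asboolP.
by rewrite asboolT.
Qed.

Variable R : realType.
Local Notation w := ((q%:R : R)^-1).

Lemma q_gt0 : (0 < (q%:R : R)).
Proof. by rewrite ltr0n ltnW // digits_gt1. Qed.

Lemma class_vol m (tau : tower K m) x N : delineated tau -> nonvanishing tau x -> pint x -> radii_le v io N tau x ->
  (cnt N (tower_eq tau x))%:R = q%:R ^+ (N * m) * w ^+ absz (total_radius tau x) :> R.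
Proof.
move=> h1 h2 h3 h4; have := class_cnt hv pi0 vpi hds h1 h2 h3 h4.
move=> /(congr1 (fun n => n%:R : R)); rewrite natrM !natrX => <-.
by rewrite -mulrA -exprMn divff ?gt_eqF ?q_gt0 // expr1n mulr1.
Qed.

Lemma code_notin (D : seq nat) n m (tau : tower K m) C x i : (forall i, (i < (size (feats tau C)).+1)%N -> i \in D) ->
  i \notin D -> code tau C n x i = 0%N.
Proof.
move=> hD; case: i => [|i] hi; first by rewrite hD in hi.
rewrite /= nth_default // leqNgt; apply: contra hi => hi; exact: hD.
Qed.

Fixpoint pt0 k : pt F k := if k is k'.+1 then (pt0 k', 0) else tt.

Section Volume.
Variables (m : nat) (P : env * pt F m -> Prop).
Local Notation Xn n := (fun x => P (fun=> n%:Z, x)).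
Hypothesis hinv : forall n x y, pint x -> pint y -> pcong n x y -> Xn n x -> Xn n y.
Variables (tau : tower K m) (C : nat).
Hypothesis htau : delineated tau.
Hypothesis hC : forall p x, p \in fullp tau -> pint x -> vge (- C%:Z) (evk x p.1).
Hypothesis hdep : forall E x y, tower_eq tau x y -> P (E, x) -> P (E, y).

Definition realized n (k : nat -> nat) := exists x, [/\ pint x, nonvanishing tau x, Xn n x & k = code tau C n x].

(** Distinct codes belong to disjoint classes, each lying in [X_n] as a whole on integral points;
    finitely many of them are measured at one common precision. *)
Lemma vol_ge n (r : seq (nat -> nat)) : uniq r -> (forall k, k \in r -> realized n k) ->
  \sum_(k <- r) w ^+ k 1%N <= (cnt n (Xn n))%:R / q%:R ^+ (n * m).
Proof.
move=> hu hr.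
have /choice [xk hxk] : forall k, exists x, k \in r -> [/\ pint x, nonvanishing tau x, Xn n x & k = code tau C n x].
  move=> k; have [/hr [x hx]|hk] := boolP (k \in r); [by exists x|by exists (pt0 m)].
have [N [hN hle]] : exists N, (n <= N)%N /\ forall k, k \in r -> radii_le v io N tau (xk k).
  elim: (r) => [|k r' [N [hN IH]]]; first by exists n.
  have [N' hN'] := tle_ex v io tau (xk k).
  exists (maxn N N'); split; first by rewrite leq_max hN.
  move=> k'; rewrite in_cons => /orP[/eqP->|/IH h]; first by apply: tle_mono hN'; apply: leq_maxr.
  by apply: tle_mono h; apply: leq_maxl.
have h1 : (\sum_(k <- r) cnt N (tower_eq tau (xk k)) <= cnt N (Xn n))%N.
  apply: (cnt_disj hv pi0 vpi hds) => // [k k' y hk hk' e e'|k y hk _ e].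
    have [_ _ _ ->] := hxk _ hk; have [_ _ _ ->] := hxk _ hk'.
    by rewrite (teq_code C htau n e) (teq_code C htau n e').
  by have [_ _ h _] := hxk _ hk; apply: hdep e h.
have h2 := cnt_inv hv pi0 vpi hds (N - n) (hinv (n := n)).
rewrite subnKC // in h2; rewrite h2 in h1.
have h3 : (\sum_(k <- r) q%:R ^+ (N * m) * w ^+ k 1%N <= q%:R ^+ ((N - n) * m) * (cnt n (Xn n))%:R :> R)%R.
  move: h1; rewrite -(ler_nat R) natr_sum natrM natrX; congr (_ <= _).
  rewrite big_seq [RHS]big_seq; apply: eq_bigr => k hk.
  have [a1 a2 a3 a4] := hxk _ hk; rewrite (class_vol htau a2 a1 (hle _ hk)).
  by rewrite {2}a4.
have q0 := q_gt0; rewrite ler_pdivlMr ?exprn_gt0 //.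
have qq : 0 < q%:R ^+ ((N - n) * m) :> R by rewrite exprn_gt0.
rewrite -(ler_pM2l qq); apply: le_trans h3; rewrite -mulr_sumr mulrA mulrAC -exprD -mulnDl subnK //.
Qed.

(** Outside the negligible set all tower polynomials have valuation at most [D * (j + 1)]. The radii
    are then bounded, and the remaining points are grouped by their codes. *)
Lemma vol_le n j (c D : nat) : (forall j N, (D * j.+1 <= N)%N ->
    (cnt N (fun x => exists2 p, p \in fullp tau & vge (D * j.+1)%N%:Z (evk x p.1)) * q ^ j <= c * q ^ (N * m))%N) ->
  exists r : seq (nat -> nat), [/\ uniq r, forall k, k \in r -> realized n k &
  (cnt n (Xn n))%:R / q%:R ^+ (n * m) <= c%:R / q%:R ^+ j + \sum_(k <- r) w ^+ k 1%N].
Proof.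
move=> hsm; pose N := (D * j.+1 + C + tmax tau + n)%N.
pose Sm x := exists2 p, p \in fullp tau & vge (D * j.+1)%N%:Z (evk x p.1).
pose Y x := [/\ pint x, nonvanishing tau x, Xn n x & radii_le v io N tau x].
have hXY : (cnt N (Xn n) <= cnt N Sm + cnt N Y)%N.
  apply: leq_trans (cnt_or hv pi0 vpi hds _ _ _); apply: (cnt_mono hv pi0 vpi hds) => x px hx.
  have [s|ns] := pselect (Sm x); [by left|right].
  have hp p : p \in fullp tau -> evk x p.1 != 0 /\ v (evk x p.1) <= (D * j.+1)%N%:Z.
    move=> hp; have h : ~~ vge (D * j.+1)%N%:Z (evk x p.1) by apply/negP => h; apply: ns; exists p.
    split; first by apply: contraNneq h => ->; rewrite vge0.
    by move: h; rewrite /Valuation.vge negb_or -ltNge => /andP[_ /ltW].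
  split=> //; first by apply: (proj2 (ndg_fullp io tau x)) => p /hp [].
  apply: (@tle_fullp _ _ v io _ tau x C (D * j.+1)%N) => //; last by rewrite /N leq_addr.
  move=> p hpp; have [h1 h2] := hp p hpp; split=> //; rewrite h2 andbT.
  by have := hC hpp px; rewrite vgeE.
have [r [hu hr hs]] := @sum_classes {classic pt F m} _ (code tau C n) Y (@pts F pi ds m N).
exists r; split=> //.
  by move=> k /hr [x [h1 h2 h3 _] e]; exists x.
have hN : (n <= N)%N by rewrite /N leq_addl.
have h2 := cnt_inv hv pi0 vpi hds (N - n) (hinv (n := n)).
rewrite subnKC // in h2.
have hDN : (D * j.+1 <= N)%N by rewrite /N -!addnA leq_addr.
have h3 := hsm j N hDN.
have hcl k : k \in r -> (\sum_(x <- @pts F pi ds m N) (`[< Y x /\ code tau C n x = k >] : nat))%:R <= q%:R ^+ (N * m) * w ^+ k 1%N :> R.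
  move=> /hr [x [a1 a2 a3 a4] e].
  have <- : (cnt N (tower_eq tau x))%:R = q%:R ^+ (N * m) * w ^+ k 1%N :> R by rewrite -e (class_vol htau a2 a1 a4).
  rewrite ler_nat; apply: (cnt_mono hv pi0 vpi hds) => y _ [[b1 b2 b3 b4] e'].
  by apply: (code_teq htau hC (n := n) (n' := n)) => //; rewrite e e'.
have q0 := q_gt0.
have h4 : (cnt N Y)%:R <= q%:R ^+ (N * m) * \sum_(k <- r) w ^+ k 1%N :> R.
  apply: (@le_trans _ _ ((\sum_(k <- r) \sum_(x <- @pts F pi ds m N) (`[< Y x /\ code tau C n x = k >] : nat))%N%:R)).
    by rewrite ler_nat; apply: hs.
  by rewrite natr_sum mulr_sumr big_seq [X in _ <= X]big_seq; apply: ler_sum => k /hcl.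
have h5 : (cnt N Sm)%:R <= q%:R ^+ (N * m) * (c%:R / q%:R ^+ j) :> R.
  rewrite mulrCA mulrA ler_pdivlMr ?exprn_gt0 // -!natrX -!natrM ler_nat; exact: h3.
have h6 : (q%:R ^+ ((N - n) * m) * (cnt n (Xn n))%:R <= q%:R ^+ (N * m) * (c%:R / q%:R ^+ j + \sum_(k <- r) w ^+ k 1%N) :> R).
  rewrite mulrDr; apply: le_trans (lerD h5 h4); rewrite -natrX -natrM -natrD ler_nat -h2; exact: hXY.
have qq : 0 < q%:R ^+ ((N - n) * m) :> R by rewrite exprn_gt0.
rewrite ler_pdivrMr ?exprn_gt0 // -(ler_pM2l qq); apply: le_trans h6 _.
by rewrite [_ * q%:R ^+ (n * m)]mulrC mulrA -exprD -mulnDl subnK.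
Qed.

End Volume.

Lemma tower_for m (P : env * pt F m -> Prop) : Dk v io pi P -> exists (tau : tower K m) (C : nat),
  [/\ delineated tau, forall p x, p \in fullp tau -> pint x -> vge (- C%:Z) (evk x p.1) &
    forall E x y, tower_eq tau x y -> P (E, x) -> P (E, y)].
Proof.
move=> hP; have [H [_ hH]] := dfn_fin hP.
have [M' [M'0 hdep]] := dfn_dep hv pi0 vpi hH.
have [tau [hg he]] := tower_ex io hv pi0 vpi H M'.
have [C hC] := @evk_bounds K F v io hv _ m fst (fullp tau).
exists tau, C; split=> // E x y hxy.
by apply: (proj1 (hdep (E, x) (E, y) _ _)); [move=> t [i ->]|move=> g hg'; apply: he].
Qed.

Lemma near_inf (c x : R) : 0 <= c -> (forall j, x <= c / q%:R ^+ j) -> x <= 0.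
Proof.
move=> c0 h; rewrite leNgt; apply/negP => x0.
pose j := Num.bound (c / x).
have hj : c / x < j%:R by have := archi_boundP (divr_ge0 c0 (ltW x0)).
have := h j; apply/negP; rewrite -ltNge ltr_pdivrMr ?exprn_gt0 ?q_gt0 //.
have : (j%:R : R) < q%:R ^+ j by rewrite -natrX ltr_nat; apply: ltn_expl; apply: digits_gt1.
move: hj; rewrite ltr_pdivrMr // => hj hq; apply: lt_trans hj _.
by rewrite mulrC ltr_pM2l.
Qed.

(** The volume of [X_n] is the sum of [w ^+ k 1] over the realized codes [k]: finite partial sums
    are bounded by [vol_ge], and [vol_le] leaves an error [c / q^j] that tends to 0. The codes form
    a Presburger set, so the sum is rational. *)
Theorem vol_ratl m (P : env * pt F m -> Prop) : Dk v io pi P ->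
  (forall n x y, pint x -> pint y -> pcong n x y -> P (fun=> n%:Z, x) -> P (fun=> n%:Z, y)) ->
  ratl (fun n => (cnt n (fun x => P (fun=> n%:Z, x)))%:R / q%:R ^+ (n * m) : R).
Proof.
move=> hP hinv; have [tau [C [htau hC hdep]]] := tower_for hP.
set f0 := (fun _ : pt F m => 0 : int).
(* Being a realized code is a condition on integers alone once all field variables of the witness
   [x] are eliminated. *)
pose Real (y : env * pt F 0) := exists x, (pint x /\ nonvanishing tau x) /\ (P (fun=> y.1 0%N, x) /\
  forall i, i \in seq.iota 0 (size (feats tau C)) -> y.1 i.+1 = nth f0 (feats tau C) i x).
have hR : Dk v io pi Real.
  apply: (Dk_exall (io := io) hv pi0 vpi (P := fun y => (pint y.2 /\ nonvanishing tau y.2) /\ (P (fun=> y.1 0%N, y.2) /\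
     forall i, i \in seq.iota 0 (size (feats tau C)) -> y.1 i.+1 = nth f0 (feats tau C) i y.2))).
  apply: d_and; first by apply: d_and; [apply: pint_dfn|apply: ndg_dfn].
  apply: d_and.
    apply: (dfn_pull (s := fun y : env * pt F m => (fun=> y.1 0%N, y.2)) _ _ hP) => // t [i ->].
    by apply: lin_var; exists 0%N.
  by apply: dfn_all => i; rewrite mem_iota /= add0n => hi; apply: feat_graph.
pose s := (size (feats tau C)).+1; pose D := seq.iota 0 s.
have hD : index_set s D by split; [apply: iota_uniq|move=> i; rewrite mem_iota].
have [a ha ea] := dfn0_res R s hR.
have hsum := res_Rsum hD ha.
have hS n k : [/\ supp D k, a k & k 0%N = n] <-> realized P tau C n k.
  split=> [[hk hak k0]|[x [px nx hx ->]]].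
    have [x [[px nx] [hx hf]]] := proj2 (ea k) hak; exists x; split=> //.
      by move: hx; rewrite /= /trunc /= k0.
    apply/funext => i; have [hi|hi] := boolP (i \in D); last first.
      by rewrite hk // (code_notin _ _ _ hi) // => j hj; rewrite mem_iota.
    case: i hi => [//|i]; rewrite mem_iota /= add0n ltnS => hi.
    by rewrite -[nth _ _ _ x]hf ?mem_iota //= /trunc ltnS hi.
  split=> //; first by move=> i; apply: code_notin => j hj; rewrite mem_iota.
  apply/ea; exists x; split=> //; split; first by rewrite /= /trunc.
  move=> i; rewrite mem_iota /= add0n => hi; rewrite /trunc ltnS hi /= gez0_abs //.
  exact: feat_ge0.
pose wt (k : nat -> nat) : R := w ^+ k 1%N.
pose d (k : nat -> nat) := k 0%N.
have wt1 : mul1 s wt by apply: mul_pow; rewrite ?invr_gt0 ?q_gt0.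
have d1 : aff1 s d by apply: aff_crd.
have [c [E hsm]] : exists c D : nat, forall j N, (D * j.+1 <= N)%N ->
    (cnt N (fun x => exists2 p, p \in fullp tau & vge (D * j.+1)%N%:Z (evk x p.1)) * q ^ j <= c * q ^ (N * m))%N.
  by apply: small_list => p hp; have [] := fullp_good htau hp.
have hw0 k : (0 <= (wt k)%:E)%E by rewrite lee_fin exprn_ge0 // invr_ge0 ltW // q_gt0.
have hle n : (wsum D (fun k => a k) d wt n <= ((cnt n (fun x => P (fun=> n%:Z, x)))%:R / q%:R ^+ (n * m))%:E)%E.
  rewrite ge_ereal_sup => //= _ [Z [finZ ZS]] <-.
  rewrite fsbig_finite //= sumEFin lee_fin; apply: (vol_ge hinv htau hdep); first exact: finmap.fset_uniq.
  move=> k.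
  by rewrite in_fset_set // => /set_mem hk; apply/hS; exact: ZS.
have hfin n : (wsum D (fun k => a k) d wt n < +oo)%E by apply: le_lt_trans (hle n) _; rewrite ltry.
have hge n : (cnt n (fun x => P (fun=> n%:Z, x)))%:R / q%:R ^+ (n * m) <= fine (wsum D (fun k => a k) d wt n).
  rewrite -subr_le0; apply: (near_inf (c := c%:R)) => // j.
  have [r [ur hr h]] := vol_le hinv htau hC n j hsm.
  rewrite lerBlDr; apply: le_trans h _; rewrite lerD2l -lee_fin fineK; last by apply: wsum_fin wt1 (hfin n).
  rewrite -sumEFin; apply: esum_ge; exists [set` r]%classic.
    by split=> [|k /= hk]; [apply: finite_seq|apply/hS; apply: hr].
  by rewrite fsbig_seq.
apply: ratl_ext (hsum d wt d1 wt1 hfin) => n; apply/eqP; rewrite eq_le hge andbT.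
by rewrite -lee_fin fineK ?hle //; apply: wsum_fin wt1 (hfin n).
Qed.

End Rationality.

(** * Comparison of volumes under a field extension *)

Lemma size_codes (s B : nat) (r : seq (nat -> nat)) : uniq r ->
  (forall k i, k \in r -> (i < s)%N -> (k i <= B)%N) ->
  (forall k i, k \in r -> (s <= i)%N -> k i = 0%N) -> (size r <= B.+1 ^ s)%N.
Proof.
move=> hu hB h0; pose F (k : nat -> nat) : {ffun 'I_s -> 'I_B.+1} := [ffun i : 'I_s => inord (k i)].
have hF : uniq [seq F k | k <- r].
  rewrite map_inj_in_uniq // => k k' hk hk' e; apply/funext => i.
  have [hi|hi] := ltnP i s; last by rewrite (h0 k) // (h0 k').
  have := congr1 (fun f : {ffun 'I_s -> 'I_B.+1} => nat_of_ord (f (Ordinal hi))) e.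
  by rewrite !ffunE /= !inordK // ltnS hB.
rewrite -(size_map F); have hc : (#|{: {ffun 'I_s -> 'I_B.+1}}| = B.+1 ^ s)%N by rewrite card_ffun !card_ord.
by rewrite -hc cardT; apply: uniq_leq_size => // x _; rewrite mem_enum.
Qed.

Section Comparison.
Variables (K F : fieldType) (v : F -> int) (vK : K -> int) (io : {rmorphism K -> F}).
Hypotheses (hv : is_padic_val v) (hvK : is_padic_val vK).
Variables (pi : F) (piK : K).
Hypotheses (pi0 : pi != 0) (vpi : v pi = 1) (piK0 : piK != 0) (vpiK : vK piK = 1).
Variable e : nat.
Hypothesis e0 : (0 < e)%N.
Hypothesis hve : forall a, a != 0 -> v (io a) = e%:Z * vK a.
Variables (ds : seq F) (dsK : seq K).
Hypotheses (hds : is_digits v ds) (hdsK : is_digits vK dsK).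
Let q := size ds.
Let qK := size dsK.
Local Notation pint := (pall (fun x : F => vge v 0 x)).
Local Notation pintK := (pall (fun x : K => vge vK 0 x)).
Local Notation cntK := (Counting.cnt piK dsK).
Local Notation evk := (@Tower.evk K F io _).
Local Notation evkK := (@Tower.evk K K idfun _).
Local Notation tower_eq := (@Tower.tower_eq K F v io _).
Local Notation nonvanishing := (@Tower.nonvanishing K F io _).
Local Notation delineated := (@Tower.delineated K F v io _).
Local Notation total_radius := (@ClassVolume.total_radius K F v io _).
Local Notation emb := (@ClassVolume.emb K F io _).
Local Notation env := (nat -> int).

Lemma emb_pint k (x : pt K k) : pintK x -> pint (emb x).
Proof.
elim: k x => //= k IH x [h1 h2]; split; first exact: IH.
have [->|x0] := eqVneq x.2 0; first by rewrite rmorph0 vge0.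
move: h2; rewrite !vgeE ?fmorph_eq0 // hve // => h.
by apply: mulr_ge0.
Qed.

Lemma tle_tr N k (tau : tower K k) x : delineated tau -> nonvanishing tau x -> pint x -> radii_le v io N tau x ->
  (absz (total_radius tau x) <= k * N)%N.
Proof.
elim: k tau x => //= k IH tau x [h1 ho hd] [n1 n2] [p1 p2] [l1 l2].
have := IH _ _ h1 n1 p1 l1; have := tr_ge0 h1 n1 p1; have := level_ge0 ho n2 p2.
move: l2; rewrite mulSn; move: (k * N)%N (total_radius _ _) (@Tower.radius K F v io k tau.2.1 x) => a b c; clear; lia.
Qed.

Variable R : realType.
Variables (m : nat) (P : env * pt F m -> Prop) (PK : nat -> pt K m -> Prop).
Hypothesis hP : Dk v io pi P.
Hypothesis hinv : forall n x y, pint x -> pint y -> pall2 (fun x y : F => vge v n%:Z (x - y)) x y ->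
  P (fun=> n%:Z, x) -> P (fun=> n%:Z, y).
Hypothesis hinvK : forall n x y, pintK x -> pintK y -> pall2 (fun x y : K => vge vK n%:Z (x - y)) x y ->
  PK n x -> PK n y.
Hypothesis hemb : forall n x, pintK x -> PK n x -> P (fun=> (e * n)%N%:Z, emb x).

(** Pigeonhole principle: polynomially many classes carry at least half of [X_n(K)], so one of them
    carries a polynomial share. Its total radius is [t]; over [F] it contributes volume [q^-t], and
    over [K] it obeys [class_cnt_sub]. *)
Lemma vol_compare : exists (A : R) (a : nat), 0 < A /\ forall n, (0 < cntK n (PK n))%N ->
  exists t : nat,
   (q%:R : R) ^- t <= (Counting.cnt pi ds (e * n) (fun x => P (fun=> (e * n)%N%:Z, x)))%:R / q%:R ^+ (e * n * m) /\
   ((cntK n (PK n))%:R / qK%:R ^+ (n * m)) ^+ e <= A * n.+1%:R ^+ a / (qK%:R : R) ^+ t.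
Proof.
have [tau [C [htau hC hdep]]] := tower_for hv pi0 vpi hP.
have [c [D hsm]] : exists c D : nat, forall j N, (D * j.+1 <= N)%N ->
    (cntK N (fun x => exists2 p, p \in fullp tau & vge vK (D * j.+1)%N%:Z (evkK x p.1)) * qK ^ j <= c * qK ^ (N * m))%N.
  by apply: (@small_list K K vK idfun hvK piK piK0 vpiK dsK hdsK m _ fst (fullp tau)) => p hp; have [] := fullp_good htau hp.
pose U := (\max_(p <- fullp tau) size (ulist v pi p.2))%N.
have hU p y : p \in fullp tau -> (idx v pi p.2 (evk y p.1) <= U)%N.
  move=> hp; apply: leq_trans (find_size _ _) _.
  exact: (@leq_bigmax_seq _ (fullp tau) xpredT (fun p => size (ulist v pi p.2)) p).
(* With [j = j1 * (n + 1) - 1], the points where some polynomial is too small fill at most half of [X_n]. *)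
pose j1 := (m + c + 2)%N.
(* The precision [N1 * (n + 1)] resolves all radii outside the small set. [B1 * (n + 1)] exceeds
   every code entry: the total radius is at most [m * N], shifted valuations at most [e * J + C],
   indices at most [U]. *)
pose N1 := (e * D * j1 + C + tmax tau + 1 + D * j1)%N.
pose B1 := (m * N1 + e * D * j1 + C + U + 1)%N.
pose s := (size (feats v io pi tau C)).+1.
(* At most [(B1 * (n + 1))^s] codes occur; the factor 2 pays for the small set, and everything is
   raised to the power [e]. *)
exists ((2 * B1 ^ s) ^ e)%N%:R, (s * e)%N; split.
  by rewrite ltr0n expn_gt0 muln_gt0 /= expn_gt0 /B1 addn1.
move=> n hn0.
pose j := (j1 * n.+1).-1.
have ej : j.+1 = (j1 * n.+1)%N by rewrite /j prednK // muln_gt0 /j1 addn2.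
pose J := (D * j.+1)%N.
pose N := (N1 * n.+1)%N.
have hnN : (n <= N)%N.
  by apply: leq_trans (leqnSn n) _; rewrite /N leq_pmull // /N1 addnAC addn1.
have hJN : (J <= N)%N by rewrite /J /N ej mulnA leq_mul2r /N1 leq_addl orbT.
have hN : (e * J + C + tmax tau <= N)%N.
  apply: (@leq_trans ((e * D * j1 + C + tmax tau) * n.+1)%N).
    have -> : (e * J = e * D * j1 * n.+1)%N by rewrite /J ej !mulnA.
    by move: (e * D * j1)%N (tmax tau) => x z; clear; nia.
  by rewrite /N /N1 leq_mul2r -!addnA !leq_add2l leq_addr orbT.
pose B := (m * N + e * J + C + U)%N.
have hB : (B.+1 <= B1 * n.+1)%N.
  have -> : (B.+1 = m * N1 * n.+1 + e * D * j1 * n.+1 + C + U + 1)%N by rewrite /B /J ej /N !mulnA addn1.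
  by rewrite /B1; move: (e * D * j1)%N (m * N1)%N => x y; clearbody U; clear; nia.
pose Sm x := exists2 p, p \in fullp tau & vge vK J%:Z (evkK x p.1).
pose Y x := [/\ pintK x, nonvanishing tau (emb x), PK n x, radii_le v io N tau (emb x) &
   forall i, (i < s)%N -> (code v io pi tau C 0 (emb x) i <= B)%N].
have hXY : (cntK N (PK n) <= cntK N Sm + cntK N Y)%N.
  apply: leq_trans (cnt_or hvK piK0 vpiK hdsK _ _ _); apply: (cnt_mono hvK piK0 vpiK hdsK) => x px hx.
  have [sm|ns] := pselect (Sm x); [by left|right].
  have pe := emb_pint px.
  have hp p : p \in fullp tau -> evk (emb x) p.1 != 0 /\ v (evk (emb x) p.1) <= (e * J)%N%:Z.
    move=> hp; have h : ~~ vge vK J%:Z (evkK x p.1) by apply/negP => h; apply: ns; exists p.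
    have h0 : evkK x p.1 != 0 by apply: contraNneq h => ->; rewrite vge0.
    rewrite evk_emb fmorph_eq0 h0 hve // PoszM ler_pM2l ?ltz_nat //; split=> //.
    by move: h; rewrite /vge negb_or -ltNge => /andP[_ /ltW].
  have nx : nonvanishing tau (emb x) by apply: (proj2 (ndg_fullp io tau (emb x))) => p /hp [].
  have hl p : p \in fullp tau -> evk (emb x) p.1 != 0 /\ - C%:Z <= v (evk (emb x) p.1) <= (e * J)%N%:Z.
    move=> hpp; have [h1 h2] := hp p hpp; split=> //; rewrite h2 andbT.
    by have := hC _ _ hpp pe; rewrite vgeE.
  have ht : radii_le v io N tau (emb x) by apply: (tle_fullp htau pe hl hN).
  split=> // -[|i] // hi; rewrite /= in hi *.
  move: hi; rewrite ltnS => hi.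
  refine (featP (Q := fun f => (absz (f (emb x)) <= B)%N) _ _ _ hi).
  - by apply: leq_trans (tle_tr htau nx pe ht) _; rewrite /B -!addnA leq_addr.
  - move=> p hpp; have [_ /andP[]] := hl p hpp; rewrite /B.
    by move: (v _) (e * J)%N (m * N)%N => z x1 x2; clear; lia.
  - by move=> p hpp; apply: leq_trans (hU p (emb x) hpp) _; rewrite /B leq_addl.
have [r [hu hr hs]] := @sum_classes {classic pt K m} _ (fun x => code v io pi tau C 0 (emb x)) Y (@pts K piK dsK m N).
have hsz : (size r <= (B1 * n.+1) ^ s)%N.
  apply: (@leq_trans (B.+1 ^ s)%N); last by rewrite leq_exp2r.
  apply: size_codes => // k i /hr [x [_ _ _ _ h] <-] hi; first exact: h.
  by case: i hi => // i; rewrite ltnS => hi; rewrite /= nth_default.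
have r0 : (0 < size r)%N \/ r = [::] by case: (r); [right|left].
have qK1 := digits_gt1 hvK hdsK; have q1 := digits_gt1 hv hds.
have qK0 : 0 < qK%:R :> R by rewrite ltr0n ltnW.
have q0 : 0 < q%:R :> R by rewrite ltr0n ltnW.
pose cl k := (\sum_(x <- @pts K piK dsK m N) (`[< Y x /\ code v io pi tau C 0 (emb x) = k >] : nat))%N.
have hinvN : cntK N (PK n) = (qK ^ ((N - n) * m) * cntK n (PK n))%N.
  by have := cnt_inv hvK piK0 vpiK hdsK (N - n) (@hinvK n); rewrite subnKC.
(* Being nonempty, [X_n(K)] contains a full class modulo [piK^n], of volume [qK^(- n * m)]. The
   choice of [j1] makes [2 * c * qK^-j] smaller than that. *)
have hhalf : (2 * cntK N Sm <= cntK N (PK n))%N.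
  have h1 := hsm j N hJN.
  have h2 : (c * qK ^ (N * m) * 2 <= cntK N (PK n) * qK ^ j)%N.
    apply: (@leq_trans (qK ^ ((N - n) * m) * qK ^ j)%N); last first.
      by rewrite leq_mul2r hinvN leq_pmulr ?orbT.
    rewrite -expnD.
    have hj : (N * m + c.+1 <= (N - n) * m + j)%N.
      rewrite mulnBl; have : (n * m <= N * m)%N by rewrite leq_mul2r hnN orbT.
      have : (j.+1 = n * m + n * c + n * 2 + m + c + 2)%N by rewrite ej /j1; ring.
      by move: (n * m)%N (N * m)%N (n * c)%N => x1 x2 x3; clear; lia.
    apply: leq_trans (_ : qK ^ (N * m + c.+1) <= _)%N; last by rewrite leq_pexp2l // ltnW.
    rewrite expnD mulnAC mulnC leq_mul2l; apply/orP; right.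
    have hc : (c * 2 <= 2 ^ c.+1)%N by rewrite expnSr leq_mul2r ltnW ?orbT // ltn_expl.
    by apply: leq_trans hc _; rewrite leq_exp2r.
  rewrite -(leq_pmul2r (_ : 0 < qK ^ j)%N) ?expn_gt0 ?(ltnW qK1) //.
  apply: leq_trans h2; rewrite -mulnA mulnC leq_mul2r; apply/orP; right; exact: h1.
have hmain : (cntK N (PK n) <= 2 * \sum_(k <- r) cl k)%N.
  have : (cntK N Y <= \sum_(k <- r) cl k)%N by apply: hs.
  by move: hhalf hXY; move: (cntK _ _) (cntK _ _) (cntK _ _) (\sum_(k <- r) _)%N => x1 x2 x3 x4; clear; lia.
(* If every class had less than the average share, the total would fall short of [hmain]. *)
have [k hk hbig] : exists2 k, k \in r & (cntK N (PK n) <= 2 * size r * cl k)%N.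
  apply: contrapT => hno.
  have hno' k : k \in r -> (2 * size r * cl k < cntK N (PK n))%N.
    by move=> hk; rewrite ltnNge; apply/negP => h; apply: hno; exists k.
  have hN0 : (0 < cntK N (PK n))%N by rewrite hinvN muln_gt0 hn0 expn_gt0 (ltnW qK1).
  case: r0 => [r0|r0]; last by move: hmain; rewrite r0 big_nil muln0 leqNgt hN0.
  have : (size r * (2 * \sum_(k <- r) cl k) <= \sum_(k <- r) (cntK N (PK n)).-1)%N.
    rewrite mulnA (mulnC (size r)) big_distrr /= big_seq [leqRHS]big_seq; apply: leq_sum => k hk.
    by have := hno' k hk; move: hN0; case: (cntK _ _).
  rewrite big_const_seq count_predT iter_addn_0 mulnC leq_mul2r => /orP[/eqP er|].
    by rewrite er in r0.
  by move: hmain hN0; move: (\sum_(k <- r) _)%N (cntK _ _) => x1 x2; clear; lia.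
have [x [a1 a2 a3 a4 _] ek] := hr k hk.
have pe := emb_pint a1.
exists (absz (total_radius tau (emb x))); split.
  have := @vol_ge K F v io hv pi pi0 vpi ds hds R m P hinv tau C htau hdep (e * n) [:: code v io pi tau C (e * n) (emb x)] isT.
  rewrite big_seq1 /= exprVn; apply => k'; rewrite inE => /eqP->.
  by exists (emb x); split=> //; apply: hemb.
have hcl : (cl k <= cntK N (fun y => tower_eq tau (emb x) (emb y)))%N.
  rewrite /cl; apply: (cnt_mono hvK piK0 vpiK hdsK) => y _ [[b1 b2 b3 b4 _] e'].
  apply: (code_teq hv pi0 vpi htau hC (n := 0) (n' := 0)) => //; last by rewrite ek e'.
  exact: emb_pint.
have hsub := class_cnt_sub hv pi0 vpi hvK piK0 vpiK e0 hve hdsK htau a2 pe a4.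
rewrite -/qK in hsub.
have hfin : ((cntK n (PK n)) ^ e * qK ^ absz (total_radius tau (emb x)) <= ((2 * B1 ^ s) ^ e * n.+1 ^ (s * e)) * qK ^ (n * m * e))%N.
  have qe : (0 < qK ^ ((N - n) * m * e))%N by rewrite expn_gt0 (ltnW qK1).
  rewrite -(leq_pmul2l qe) mulnA expnM -expnMn -hinvN.
  apply: (@leq_trans ((2 * size r * cl k) ^ e * qK ^ absz (total_radius tau (emb x)))%N).
    by rewrite leq_mul2r leq_exp2r // hbig orbT.
  rewrite expnMn -mulnA; apply: (@leq_trans ((2 * size r) ^ e * qK ^ (N * m * e))%N).
    rewrite leq_mul2l; apply/orP; right; apply: leq_trans hsub.
    by rewrite leq_mul2r leq_exp2r // hcl orbT.
  rewrite -expnM mulnCA -expnD -!mulnDl subnK // leq_mul2r; apply/orP; right.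
  by rewrite expnM -expnMn leq_exp2r // -mulnA -expnMn leq_mul2l hsz.
have h1 : 0 < qK%:R ^+ absz (total_radius tau (emb x)) :> R by rewrite exprn_gt0.
have h2 : 0 < (qK%:R ^+ (n * m)) ^+ e :> R by rewrite !exprn_gt0.
rewrite expr_div_n ler_pdivlMr // mulrAC ler_pdivrMr // -exprM -!natrX -!natrM ler_nat.
exact: hfin.
Qed.

End Comparison.

(** * Poles and growth of coefficients *)

Lemma conv_map (R S : fieldType) (f : {rmorphism R -> S}) (B : {poly R}) a n :
  conv (map_poly f B) (fun k => f (a k)) n = f (conv B a n).
Proof. by rewrite /conv rmorph_sum; apply: eq_bigr => k _; rewrite coef_map rmorphM. Qed.

Section Poles.
Local Notation nc := (@ComplexField.Normc.normc RR).
Implicit Types (u : nat -> CC) (A B : {poly CC}).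

Lemma ncE (z : CC) : (nc z)%:C%C = `|z|.
Proof. by []. Qed.

Lemma nc_ge0 z : 0 <= nc z.
Proof. by rewrite -(@ler0c RR) ncE. Qed.

Lemma ncD x y : nc (x + y) <= nc x + nc y.
Proof. by rewrite -(@lecR RR) rmorphD !ncE ler_normD. Qed.

Lemma ncN x : nc (- x) = nc x.
Proof. by apply: (@complexI RR); rewrite !ncE normrN. Qed.

Lemma ncM x y : nc (x * y) = nc x * nc y.
Proof. exact: ComplexField.Normc.normcM. Qed.

Lemma nc_gt0 z : z != 0 -> 0 < nc z.
Proof. by move=> z0; rewrite lt_def nc_ge0 andbT; apply: contraNneq z0 => /ComplexField.Normc.eq0_normc ->. Qed.

Lemma nc_real (x : RR) : nc (complex.Complex x 0) = `|x|.
Proof. by rewrite /= expr0n addr0 sqrtr_sqr. Qed.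

Lemma conv_inj B u w : B.[0] != 0 -> (forall n, conv B u n = conv B w n) -> u =1 w.
Proof.
move=> B0 h n; have [k hk] := ubnP n; elim: k n hk => // k IH n hn.
have := h n; rewrite /conv !big_ord_recl !subn0 /=.
rewrite (eq_bigr (fun i : 'I_n => B`_(bump 0 i) * w (n - bump 0 i)%N)); last first.
  move=> i _; rewrite IH //; have := ltn_ord i; rewrite /bump /=; move: hn; clear; lia.
by move=> /addIr /mulfI; apply; rewrite -horner_coef0.
Qed.

Lemma conv_XsubC beta u n : conv ('X - beta%:P) u n = (if n is n'.+1 then u n' else 0) - beta * u n.
Proof.
rewrite /conv; case: n => [|n].
  by rewrite big_ord_recl big_ord0 addr0 coefB coefX coefC subn0 sub0r /= mulNr sub0r.
rewrite 2!big_ord_recl big1 => [|i _]; last first.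
  by rewrite coefB coefX coefC /= subr0 mul0r.
rewrite !coefB !coefX !coefC /= !subn0 addr0 sub0r subr0 mul1r mulNr addrC.
by rewrite /bump /= subSS subn0.
Qed.

(** The roots of [B] are split off one at a time over the algebraically closed field; each division
    by [X - beta] with [|beta| > rho] is a stable first-order recursion. *)
Lemma coef_growth B A u (rho : RR) : 0 < rho -> B.[0] != 0 -> (forall beta, root B beta -> rho < nc beta) ->
  (forall n, conv B u n = A`_n) -> exists C, forall n, nc (u n) * rho ^+ n <= C.
Proof.
move=> rho0; have [k hk] := ubnP (size B); elim: k B A u hk => // k IH B A u hk B0 hroot hu.
have Bn0 : B != 0 by apply: contraNneq B0 => ->; rewrite horner0.
have [hB|hB] := leqP (size B) 1.
  have eB := size1_polyC hB.
  have b0 : B`_0 != 0 by rewrite -horner_coef0.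
  have hu' n : u n = A`_n / B`_0.
    rewrite -hu /conv big_ord_recl big1 ?addr0 ?subn0; last first.
      by move=> i _; rewrite eB coefC /= mul0r.
    by rewrite mulrC mulKf.
  exists (\sum_(i < size A) nc (u i) * rho ^+ i) => n.
  have [hn|hn] := ltnP n (size A); last first.
    rewrite hu' nth_default // mul0r ComplexField.Normc.normc0 mul0r sumr_ge0 // => i _.
    by rewrite mulr_ge0 ?nc_ge0 // exprn_ge0 // ltW.
  rewrite (bigD1 (Ordinal hn)) //= lerDl sumr_ge0 // => i _.
  by rewrite mulr_ge0 ?nc_ge0 // exprn_ge0 // ltW.
have [beta hbeta] : exists beta, root B beta.
  by apply/closed_rootP; rewrite neq_ltn hB orbT.
have [B1 eB] := factor_theorem B beta hbeta.
have hb := hroot _ hbeta.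
have hb0 : 0 < nc beta by apply: lt_trans hb.
have b0 : beta != 0.
  by apply: contraTneq hb0 => ->; rewrite ComplexField.Normc.normc0 ltxx.
have B10 : B1.[0] != 0 by apply: contraNneq B0 => e; rewrite eB hornerM e mul0r.
pose w n := conv ('X - beta%:P) u n.
have [C hC] : exists C, forall n, nc (w n) * rho ^+ n <= C.
  apply: (IH B1 A w) => //.
  - move: hk; rewrite eB size_Mmonic ?monicXsubC ?size_XsubC ?addn2 //.
    by apply: contraNneq B10 => ->; rewrite horner0.
  - by move=> g hg; apply: hroot; rewrite eB rootM hg.
  - by move=> n; rewrite conv_mul -eB.
have C0 : 0 <= C by apply: le_trans (hC 0%N); rewrite mulr_ge0 ?nc_ge0.
(* Chosen so that [rho * M + C <= |beta| * M], which closes the induction, and so that [M] bounds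
   the initial value. *)
pose M := nc (u 0%N) + C / (nc beta - rho).
have hbr : 0 < nc beta - rho by rewrite subr_gt0.
exists M; elim=> [|n IHn].
  by rewrite expr0 mulr1 /M lerDl divr_ge0 // ltW.
have hs : beta * u n.+1 = u n - w n.+1 by rewrite /w conv_XsubC opprB addrC subrK.
have h1 : nc beta * nc (u n.+1) <= nc (u n) + nc (w n.+1).
  by rewrite -ncM hs; apply: le_trans (ncD _ _) _; rewrite ncN.
have h2 : nc beta * (nc (u n.+1) * rho ^+ n.+1) <= rho * M + C.
  have r1 : 0 <= rho ^+ n.+1 by rewrite exprn_ge0 // ltW.
  rewrite mulrA; apply: le_trans (ler_wpM2r r1 h1) _; rewrite mulrDl; apply: lerD; last exact: hC.
  by rewrite exprS mulrCA ler_wpM2l // ltW.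
rewrite -(ler_pM2l hb0); apply: le_trans h2 _.
have : C <= M * (nc beta - rho).
  by rewrite -ler_pdivrMr // /M lerDr nc_ge0.
by move: (nc beta) => z; clear; lra.
Qed.

(* After division of [B] by [T - alpha] the remaining series is eventually geometric of ratio [1 / alpha]. *)
Lemma no_pole A B u (alpha : CC) (x C : RR) : coprimep A B -> B.[0] != 0 -> root B alpha ->
  (forall n, conv B u n = A`_n) -> 1 < x -> (forall n, nc (u n) * (nc alpha * x) ^+ n <= C) -> False.
Proof.
move=> cop B0 hr hu x1 hC.
have a0 : alpha != 0 by apply: contraTneq hr => ->; rewrite /root.
have na : 0 < nc alpha := nc_gt0 a0.
have [B1 eB] := factor_theorem B alpha hr.
pose c := conv B1 u.
have hc n : (if n is n'.+1 then c n' else 0) - alpha * c n = A`_n.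
  by rewrite -conv_XsubC /c conv_mul mulrC -eB.
have x0 : 0 < x by apply: lt_trans x1.
have C0 : 0 <= C by apply: le_trans (hC 0%N); rewrite mulr_ge0 ?nc_ge0.
(* If [c] vanished from [size A] on, it would be a polynomial and [X - alpha] would divide [A],
   against coprimality. *)
have [M [hM hcM]] : exists M, (size A <= M)%N /\ c M != 0.
  apply: contrapT => hno.
  have c0 n : (size A <= n)%N -> c n = 0.
    by move=> hn; apply/eqP; apply: contrapT => /negP h; apply: hno; exists n.
  pose p := \poly_(i < size A) c i.
  have ep n : p`_n = c n by rewrite coef_poly; case: ltnP => // /c0.
  have eA : A = p * ('X - alpha%:P).
    apply/polyP => n; rewrite -hc mulrBr coefB coefMX coefMC !ep mulrC.
    by case: n.
  have : root A alpha by rewrite eA rootM root_XsubC eqxx orbT.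
  by move=> /(coprimep_root cop); rewrite (eqP hr) eqxx.
have hcn n : nc (c (M + n)%N) * nc alpha ^+ n = nc (c M).
  elim: n => [|n IHn]; first by rewrite addn0 mulr1.
  have hz : A`_(M + n).+1 = 0.
    by apply: nth_default; apply: leq_trans hM _; apply: leqW; apply: leq_addr.
  have := hc (M + n).+1; rewrite hz => /eqP.
  rewrite subr_eq0 => /eqP e; rewrite addnS exprS mulrA [nc _ * nc alpha]mulrC -ncM -e; exact: IHn.
pose S := \sum_(k < size B1) nc B1`_k * (nc alpha * x) ^+ k * C.
have hcb n : (size B1 <= n)%N -> nc (c n) * (nc alpha * x) ^+ n <= S.
  move=> hn; have -> : c n = \sum_(k < size B1) B1`_k * u (n - k)%N.
    rewrite (big_ord_widen n.+1 (fun k => B1`_k * u (n - k)%N)) ?(leq_trans hn) //.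
    rewrite [RHS]big_mkcond /=; apply: eq_bigr => k _; case: ltnP => // hk.
    by rewrite nth_default // mul0r.
  have ax k : 0 <= (nc alpha * x) ^+ k by rewrite exprn_ge0 // mulr_ge0 // ltW.
  have hs : nc (\sum_(k < size B1) B1`_k * u (n - k)%N) <= \sum_(k < size B1) nc B1`_k * nc (u (n - k)%N).
    apply: (big_ind2 (fun (z : CC) (y : RR) => nc z <= y)) => [||k _].
    - by rewrite ComplexField.Normc.normc0.
    - by move=> z1 y1 z2 y2 h1 h2; apply: le_trans (ncD _ _) _; apply: lerD.
    - by rewrite ncM.
  apply: le_trans (ler_wpM2r (ax n) hs) _; rewrite mulr_suml; apply: ler_sum => k _.
  have hk : (k <= n)%N by apply: leq_trans hn; apply: ltnW.
  rewrite -{2}(subnK hk) exprD -!mulrA ler_wpM2l ?nc_ge0 //.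
  by rewrite mulrA mulrC [_ * C]mulrC mulrC ler_wpM2r // mulrC.
have S0 : 0 <= S by apply: le_trans (hcb (size B1) (leqnn _)); rewrite mulr_ge0 ?nc_ge0 // exprn_ge0 // mulr_ge0 // ltW.
have hbad n : (size B1 <= n)%N -> x ^+ n <= S / (nc (c M) * nc alpha ^+ M).
  move=> hn; have cM : 0 < nc (c M) := nc_gt0 hcM.
  rewrite ler_pdivlMr ?mulr_gt0 ?exprn_gt0 //.
  apply: le_trans (_ : nc (c (M + n)%N) * (nc alpha * x) ^+ (M + n) <= _); last first.
    by apply: hcb; apply: leq_trans hn (leq_addl _ _).
  rewrite exprMn exprD [x ^+ (M + n)]exprD -(hcn n).
  set y := nc (c _); have y0 : 0 <= y := nc_ge0 _.
  have : 1 <= x ^+ M by rewrite exprn_ege1 // ltW.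
  have : 0 <= y * (nc alpha ^+ M * nc alpha ^+ n) * x ^+ n.
    by rewrite !mulr_ge0 // exprn_ge0 // ltW.
  move: (x ^+ n) (nc alpha ^+ n) (nc alpha ^+ M) (x ^+ M) => z1 z2 z3 z4 h1 h2.
  have -> : y * (z3 * z2 * (z4 * z1)) = (y * (z3 * z2) * z1) * z4 by ring.
  have -> : z1 * (y * z2 * z3) = y * (z3 * z2) * z1 by ring.
  by rewrite ler_peMr.
move: hbad; move: (S / _) => Q hbad.
have [n hn] : exists n, (size B1 <= n)%N /\ Q < x ^+ n.
  pose d := x - 1; have d0 : 0 < d by rewrite subr_gt0.
  have hx n : n%:R * d <= x ^+ n.
    have -> : x = 1 + d by rewrite /d addrC subrK.
    elim: n => [|n IHn]; first by rewrite mul0r expr0.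
    rewrite exprS mulrDl mul1r -natr1 mulrDl mul1r; apply: lerD => //.
    by rewrite ler_peMr ?(ltW d0) // exprn_ege1 // lerDl ltW.
  pose n := maxn (size B1) (Num.bound `|Q / d|).
  exists n; split; first by rewrite leq_maxl.
  apply: lt_le_trans (hx n); rewrite -ltr_pdivrMr //.
  apply: le_lt_trans (ler_norm _) _; apply: lt_le_trans (archi_boundP (normr_ge0 _)) _.
  by rewrite ler_nat /n leq_maxr.
by case: hn => h1; rewrite ltNge hbad.
Qed.


(** Poles are read off from a reduced fraction, so the greatest common divisor has to be removed; it
    is nonzero at 0 because it divides the denominator. *)
Lemma rat_rep_ex (b : nat -> RR) : ratl b -> exists A B, rat_rep b A B.
Proof.
move=> [B0 [A0 [h0 hb]]].
pose f : {rmorphism RR -> CC} := real_complex RR.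
pose B := map_poly f B0; pose A := map_poly f A0.
pose u n : CC := complex.Complex (b n) 0.
have hB0 : B.[0] != 0 by rewrite -(rmorph0 f) horner_map fmorph_eq0.
have hu n : conv B u n = A`_n.
  by have h := conv_map f B0 b n; rewrite hb in h; rewrite /A coef_map; exact: h.
have Bn0 : B != 0 by apply: contraNneq hB0 => ->; rewrite horner0.
pose g := gcdp A B.
have eB : B = g * (B %/ g) by rewrite mulrC divpK ?dvdp_gcdr.
have eA : A = g * (A %/ g) by rewrite mulrC divpK ?dvdp_gcdl.
have /norP[g0 B'0] : ~~ ((g.[0] == 0) || ((B %/ g).[0] == 0)).
  by rewrite -mulf_eq0 -hornerM -eB.
exists (A %/ g), (B %/ g); split; first by rewrite coprimep_div_gcd // Bn0 orbT.
split=> // n; apply: (@conv_inj g (conv (B %/ g) u) (fun k => (A %/ g)`_k)) => // k.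
by rewrite conv_mul -eB conv_coef -eA hu.
Qed.

(* The slack [y > 1] between the two exponential rates absorbs the polynomial factor. *)
Lemma pow_small (y : RR) (a e : nat) : 1 < y -> exists d, [/\ 0 < d, d <= 1 & (1 + d) ^+ (a + e) <= y].
Proof.
move=> y1; move: (a + e)%N => {a e} a.
have h (d : RR) : 0 <= d -> d <= 1 -> (1 + d) ^+ a <= 1 + (2 ^+ a - 1) * d.
  move=> d0 d1; elim: a => [|a IH]; first by rewrite !expr0 subrr mul0r addr0.
  rewrite exprS; apply: le_trans (ler_wpM2l _ IH) _; first by rewrite addr_ge0.
  have : 1 <= (2 : RR) ^+ a by rewrite exprn_ege1 // ler1n.
  rewrite exprS; move: (2 ^+ a) => z hz; have : 0 <= (z - 1) * (d * (1 - d)).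
    by rewrite !mulr_ge0 // subr_ge0.
  by move: hz; clear; nra.
have z1 : 1 <= (2 : RR) ^+ a by rewrite exprn_ege1 // ler1n.
pose z : RR := 2 ^+ a; have z0 : 0 < z by rewrite exprn_gt0 ?ltr0n.
pose d := Num.min 1 ((y - 1) / z).
have d0 : 0 < d by rewrite lt_min ltr01 divr_gt0 // subr_gt0.
have d1 : d <= 1 by rewrite ge_min lexx.
exists d; split=> //; apply: le_trans (h d (ltW d0) d1) _.
have : d * z <= y - 1 by rewrite -ler_pdivlMr // ge_min lexx orbT.
by rewrite -/z; move: z d d0 {d1 z1 z0} => z d; clear -y1; nra.
Qed.

Lemma pow_lin (d : RR) n a : 0 < d -> d <= 1 -> (n.+1%:R : RR) ^+ a <= (1 + d) ^+ (n * a) / d ^+ a.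
Proof.
move=> d0 d1; rewrite exprM -expr_div_n; apply: lerXn2r; rewrite ?nnegrE ?ler0n ?divr_ge0 ?exprn_ge0 ?addr_ge0 ?(ltW d0) //.
rewrite ler_pdivlMr //; elim: n => [|n IH]; first by rewrite mul1r expr0.
rewrite -[n.+2%:R]natr1 exprS; have : 1 <= (1 + d) ^+ n by rewrite exprn_ege1 // lerDl ltW.
move: IH; move: ((1 + d) ^+ n) n.+1%:R => z w h1 h2.
have : 0 <= d * (z - 1) by rewrite mulr_ge0 ?subr_ge0 // ltW.
by move: h1; clear; nra.
Qed.

(** Let [th] be the value at a pole over [K], and suppose that [lambda] over [L] exceeds [th + eps].
    Then [b] decays like [q_L^(-(th + eps) n)], which bounds [t] below linearly in [n]. Hence [a]
    decays faster than the pole allows, contradicting [no_pole]. *)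
Lemma lambda_le (qK qL e : nat) (a b : nat -> RR) : (1 < qK)%N -> (1 < qL)%N -> (0 < e)%N ->
  (forall n, 0 <= a n) -> ratl b ->
  (exists (A : RR) (a0 : nat), 0 < A /\ forall n, a n != 0 -> exists t : nat,
     (qL%:R : RR) ^- t <= b (e * n)%N /\ a n ^+ e <= A * n.+1%:R ^+ a0 / qK%:R ^+ t) ->
  (lambda_of qL b <= lambda_of qK a)%E.
Proof.
move=> qK1 qL1 e0 a_ge0 hb [A [a0 [A0 hcmp]]].
apply: le_ereal_inf_tmp => _ [alpha [PA [PB [[cop [PB0 hA]] hroot]]] <-].
apply/lee_addgt0Pr => eps eps0; rewrite -EFinD leNgt; apply/negP => hlt.
set lK := ln (qK%:R : RR); set lL := ln (qL%:R : RR).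
have lK0 : 0 < lK by rewrite ln_gt0 // ltr1n.
have lL0 : 0 < lL by rewrite ln_gt0 // ltr1n.
have qKe : (qK%:R : RR) = expR lK by rewrite lnK // posrE ltr0n ltnW.
have qLe : (qL%:R : RR) = expR lL by rewrite lnK // posrE ltr0n ltnW.
have al0 : alpha != 0 by apply: contraTneq hroot => ->; rewrite /root.
have na : 0 < nc alpha := nc_gt0 al0.
set th := ln (nc alpha) / lK in hlt.
have nae : nc alpha = expR (th * lK) by rewrite /th divfK ?gt_eqF // lnK // posrE.
set th' := th + eps in hlt.
have [A' [B' [cop' [B'0 hA']]]] := rat_rep_ex hb.
pose rho := expR (th' * lL).
have hrho beta : root B' beta -> rho < nc beta.
  move=> hbeta; have be0 : beta != 0 by apply: contraTneq hbeta => ->; rewrite /root.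
  rewrite ltNge; apply/negP => hle; move: hlt; apply/negP; rewrite -leNgt.
  apply: le_trans (_ : ((ln (nc beta) / lL)%:E <= _)%E).
    by apply: ereal_inf_lbound; exists beta => //; exists A', B'; split.
  rewrite lee_fin ler_pdivrMr // -[leRHS](expRK) ler_ln ?posrE ?expR_gt0 //.
  exact: nc_gt0.
have [C hC] := coef_growth (u := fun n => complex.Complex (b n) 0) (expR_gt0 _) B'0 hrho hA'.
pose C1 := Num.max 1 C; have C10 : 0 < C1 by rewrite lt_max ltr01.
have hbn n : b n * rho ^+ n <= C1.
  apply: le_trans (_ : C <= _); last by rewrite le_max lexx orbT.
  apply: le_trans (hC n); rewrite ler_wpM2r ?exprn_ge0 ?expR_ge0 //.
  by rewrite nc_real ler_norm.
pose g := ln C1 / lL; pose c0 := g * lK.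
have eC : C1 = expR (g * lL) by rewrite /g divfK ?gt_eqF // lnK // posrE.
have eV (l : RR) (t : nat) : expR l ^- t = expR (- l * t%:R) by rewrite expRM_natr exp.expRN exprVn.
have ht n t : (qL%:R : RR) ^- t <= b (e * n)%N -> (qK%:R : RR) ^- t <= expR c0 * expR (- th' * lK) ^+ (e * n).
  move=> h; have r0 : 0 < rho ^+ (e * n) by rewrite exprn_gt0 ?expR_gt0.
  have : qL%:R ^- t * rho ^+ (e * n) <= C1 by apply: le_trans (hbn (e * n)%N); rewrite ler_pM2r.
  rewrite qLe qKe /rho !eV -!expRM_natr -!exp.expRD eC !ler_expR /c0.
  have -> : - lL * t%:R + th' * lL * (e * n)%N%:R = (- t%:R + th' * (e * n)%N%:R) * lL by ring.
  rewrite ler_pM2r //; move: ((e * n)%N%:R) => m hc.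
  have -> : - lK * t%:R = (- t%:R) * lK by ring.
  have -> : g * lK + - th' * lK * m = (g - th' * m) * lK by ring.
  by rewrite ler_pM2r //; move: hc; clear; lra.
(* [y^n] is the gain, after raising to the power [e], from the rate [th + eps] instead of [th]. It
   must pay for the polynomial factor and for the growth [x^n] demanded by [no_pole], whence the
   exponent [a0 + e] on [x]. *)
pose y := expR (eps * lK * e%:R).
have y1 : 1 < y by rewrite expR_gt1 !mulr_gt0 // ltr0n.
have [d [d0 d1 hd]] := pow_small a0 e y1.
pose x := 1 + d.
have x1 : 1 < x by rewrite ltrDl.
have x0 : 0 < x by apply: lt_trans x1.
pose C2 := A * expR c0 / d ^+ a0.
have C20 : 0 < C2 by rewrite divr_gt0 ?exprn_gt0 // mulr_gt0 // expR_gt0.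
have hfin n : a n * (nc alpha * x) ^+ n <= 1 + C2.
  have [->|an0] := eqVneq (a n) 0; first by rewrite mul0r addr_ge0 // ltW.
  have [t [h1 h2]] := hcmp n an0; have h3 := ht n t h1.
  pose z := a n * (nc alpha * x) ^+ n.
  have z0 : 0 <= z by rewrite mulr_ge0 // exprn_ge0 // mulr_ge0 // ltW.
  have hz : z ^+ e <= C2.
    have w0 : 0 < (nc alpha * x) ^+ n ^+ e by rewrite !exprn_gt0 // mulr_gt0.
    rewrite /z exprMn; apply: le_trans (ler_wpM2r (ltW w0) h2) _.
    apply: le_trans (_ : A * (x ^+ (n * a0) / d ^+ a0) * (expR c0 * expR (- th' * lK) ^+ (e * n)) * (nc alpha * x) ^+ n ^+ e <= _).
      rewrite ler_pM2r //; apply: ler_pM => //; rewrite ?invr_ge0 ?mulr_ge0 ?exprn_ge0 ?(ltW A0) //.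
      by rewrite ler_pM2l // /x; apply: pow_lin.
    have hy : x ^+ (n * a0) * x ^+ (n * e) <= y ^+ n.
      by rewrite -exprD -mulnDr mulnC exprM; apply: lerXn2r => //; rewrite nnegrE ?exprn_ge0 ?expR_ge0 // ltW.
    have ey : expR (- th' * lK) ^+ (e * n) * (nc alpha ^+ n) ^+ e = (y ^+ n)^-1.
      rewrite nae /y -!expRM_natr -exp.expRN -exp.expRD /th' natrM; congr expR; ring.
    have y0 : 0 < y ^+ n by rewrite exprn_gt0 // expR_gt0.
    have -> : A * (x ^+ (n * a0) / d ^+ a0) * (expR c0 * expR (- th' * lK) ^+ (e * n)) * (nc alpha * x) ^+ n ^+ e =
       C2 * ((x ^+ (n * a0) * x ^+ (n * e)) * (expR (- th' * lK) ^+ (e * n) * (nc alpha ^+ n) ^+ e)).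
      by rewrite /C2 exprMn exprMn (exprM x n e); ring.
    rewrite ey ger_pMr // ler_pdivrMr // mul1r; exact: hy.
  rewrite -/z; have [z1|z1] := leP z 1; first by apply: le_trans z1 _; rewrite lerDl ltW.
  apply: le_trans (_ : z ^+ e <= _); last by apply: le_trans hz _; rewrite lerDr.
  by rewrite -{1}[z]expr1 ler_weXn2l // ltW.
apply: (no_pole cop PB0 hroot (u := fun n => complex.Complex (a n) 0) hA x1 (C := 1 + C2)) => n.
by rewrite nc_real ger0_norm // hfin.
Qed.

End Poles.

(** * Residue classes and definability of the two families *)

Section Coordinates.
Variable F : fieldType.

Fixpoint nthpt k (x : pt F k) (i : nat) : F :=
  match k return pt F k -> F with
  | 0%N => fun=> 0
  | k'.+1 => fun x => if i == k' then x.2 else @nthpt k' x.1 i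
  end x.

Fixpoint mkpt k (h : nat -> F) : pt F k := if k is k'.+1 then (mkpt k' h, h k') else tt.

Lemma nth_mkpt k h i : (i < k)%N -> nthpt (mkpt k h) i = h i.
Proof.
elim: k => //= k IH; rewrite ltnS leq_eqVlt; case: eqP => [-> //|_] /= hi; exact: IH.
Qed.

Lemma pallP P k (x : pt F k) : pall P x <-> forall i, (i < k)%N -> P (nthpt x i).
Proof.
elim: k x => [|k IH] x /=; first by split.
rewrite IH; split=> [[h1 h2] i|h].
  by rewrite ltnS leq_eqVlt; case: eqP => // _ /=; apply: h1.
split=> [i hi|]; last by have := h k (ltnSn k); rewrite eqxx.
by have := h i (leqW hi); rewrite (ltn_eqF hi).
Qed.

Lemma pall2P P k (x y : pt F k) : pall2 P x y <-> forall i, (i < k)%N -> P (nthpt x i) (nthpt y i).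
Proof.
elim: k x y => [|k IH] x y /=; first by split.
rewrite IH; split=> [[h1 h2] i|h].
  by rewrite ltnS leq_eqVlt; case: eqP => // _ /=; apply: h1.
split=> [i hi|]; last by have := h k (ltnSn k); rewrite eqxx.
by have := h i (leqW hi); rewrite (ltn_eqF hi).
Qed.

Definition tofun k (x : pt F k) : 'I_k -> F := fun i => nthpt x i.
Definition ofun k (h : 'I_k -> F) : pt F k := mkpt k (fun i => if insub i is Some j then h j else 0).

Lemma ofunK k (h : 'I_k -> F) : tofun (ofun h) = h.
Proof. by apply/funext => i; rewrite /tofun nth_mkpt // valK. Qed.

Fixpoint catpt m k (x : pt F m) : pt F k -> pt F (k + m) :=
  if k is k'.+1 then fun y => (@catpt m k' x y.1, y.2) else fun=> x.

Lemma nth_catl m k (x : pt F m) (y : pt F k) i : (i < m)%N -> nthpt (catpt x y) i = nthpt x i.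
Proof.
move=> hi; elim: k y => //= k IH y; rewrite ltn_eqF ?IH //.
by apply: leq_trans hi _; apply: leq_addl.
Qed.

Lemma nth_catr m k (x : pt F m) (y : pt F k) i : nthpt (catpt x y) (i + m) = nthpt y i \/ (k <= i)%N.
Proof.
have [hi|hi] := leqP k i; [by right|left].
elim: k y hi => //= k IH y; rewrite eqn_add2r ltnS leq_eqVlt; case: eqP => //= _ hi; exact: IH.
Qed.

End Coordinates.

Section Classes.
Variables (K : fieldType) (v : K -> int) (pi : K) (ds : seq K).
Hypotheses (hv : is_padic_val v) (pi0 : pi != 0) (vpi : v pi = 1) (hds : is_digits v ds).
Local Notation pint := (pall (fun x : K => vge v 0 x)).
Local Notation pcong n := (pall2 (fun x y : K => vge v n%:Z (x - y))).
Local Notation reps := (reps pi ds).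
Local Notation pts := (@pts K pi ds).

Lemma mem_pts k N (x : {classic pt K k}) :
  x \in (pts k N : seq {classic pt K k}) <-> pall (fun a => a \in reps N) x.
Proof.
elim: k x => [|k IH] x; first by case: x; split=> // _; apply/mem_head.
split.
  by case/(@allpairsP {classic pt K k} K {classic pt K k.+1} (fun a b => (a, b))) => -[a b] /= [/IH ha hb ->].
case: x => a b /= [/IH ha hb].
by apply/(@allpairsP {classic pt K k} K {classic pt K k.+1} (fun a b => (a, b))); exists (a, b).
Qed.

Lemma pts_uniq k N : uniq (pts k N : seq {classic pt K k}).
Proof.
elim: k => // k IH.
apply: (@allpairs_uniq {classic pt K k} K {classic pt K k.+1} (fun a b => (a, b))) => //.
  exact: (reps_uniq hv pi0 vpi hds).
by move=> [a b] [a' b'] _ _ /= [-> ->].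
Qed.

Lemma pts_cover k N (x : pt K k) : pint x -> exists2 y : {classic pt K k},
  y \in (pts k N : seq {classic pt K k}) & pcong N x y.
Proof.
move=> hx; suff [y h1 h2] : exists2 y : pt K k, pall (fun a => a \in reps N) y & pcong N x y.
  by exists y => //; apply/mem_pts.
elim: k x hx => [|k IH] x /=; first by exists tt.
move=> [/IH [y h1 h2] h3]; have [a h4 h5] := reps_cover hv pi0 vpi hds N h3.
by exists (y, a).
Qed.

Lemma pts_int k N (y : {classic pt K k}) : y \in (pts k N : seq {classic pt K k}) -> pint y.
Proof.
move=> /mem_pts /pallP h; apply/pallP => i hi; exact: (reps_int hv pi0 vpi hds (h i hi)).
Qed.

Lemma pts_sep k N (x y : {classic pt K k}) : x \in (pts k N : seq {classic pt K k}) ->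
  y \in (pts k N : seq {classic pt K k}) -> pcong N x y -> x = y.
Proof.
move=> /mem_pts hx /mem_pts hy; elim: k x y hx hy => [|k IH]; first by case; case.
move=> [x a] [y b] /= [hx ha] [hy hb] [h1 h2].
by rewrite (IH x y hx hy h1) (reps_sep hv pi0 vpi hds ha hb h2).
Qed.

Lemma ncls_spec_le m n (Q : ('I_m -> K) -> Prop) k k' : ncls_spec v n Q k -> ncls_spec v n Q k' -> (k <= k')%N.
Proof.
move=> [r [h1 [h2 h3]]] [r' [h1' [h2' h3']]].
have /choice [phi hphi] : forall j, exists j', congr v n (r j) (r' j').
  by move=> j; have [a b] := h1 j; apply: h3'.
have inj : injective phi.
  move=> j1 j2 e; apply: contrapT => hne; apply: (h2 j1 j2 hne) => i.
  have a1 := hphi j1 i; have a2 := hphi j2 i; rewrite -e in a2.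
  apply/inPn_vge; move/inPn_vge in a1; move/inPn_vge in a2.
  have -> : r j1 i - r j2 i = (r j1 i - r' (phi j1) i) - (r j2 i - r' (phi j1) i) by ring.
  exact: vgeB.
by have := leq_card _ inj; rewrite !card_ord.
Qed.

(** Two systems of representatives embed into each other, so the specification determines the number
    and [epsilon] has to return it. Selecting representatives among [pts] needs equality of points,
    taken classically. *)
Lemma ncls_cnt m n (Q : ('I_m -> K) -> Prop) :
  (forall x y : pt K m, pint x -> pint y -> pcong n x y -> Q (tofun x) -> Q (tofun y)) ->
  ncls v n Q = Counting.cnt pi ds n (fun x : pt K m => Q (tofun x)).
Proof.
move=> hQ; set c := Counting.cnt _ _ _ _.
suff hc : ncls_spec v n Q c.
  have he := @ClassicalEpsilon.epsilon_spec nat (inhabits 0%N) (ncls_spec v n Q) (ex_intro _ c hc).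
  by apply/eqP; rewrite eqn_leq (ncls_spec_le he hc) (ncls_spec_le hc he).
pose L : seq {classic pt K m} := [seq x <- (pts m n : seq {classic pt K m}) | `[< Q (tofun x) >]].
have hL : size L = c.
  rewrite size_filter -sum1_count big_mkcond /c /Counting.cnt; apply: eq_bigr => x _.
  by case: (`[< _ >]).
have hmem (j : 'I_c) : nth (mkpt m (fun=> 0) : {classic pt K m}) L j \in L by rewrite mem_nth // hL.
have hLp x : x \in L -> x \in (pts m n : seq {classic pt K m}) /\ Q (tofun x).
  by rewrite mem_filter => /andP[/asboolP h1 h2].
exists (fun j => tofun (nth (mkpt m (fun=> 0) : {classic pt K m}) L j)); split; last split.
- move=> j; have [h1 h2] := hLp _ (hmem j); split=> // i; apply/inPn_vge.
  by have /pallP h := pts_int h1; apply: h.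
- move=> j j' hne hcong; apply: hne; apply: val_inj => /=; apply/eqP.
  have [h1 _] := hLp _ (hmem j); have [h2 _] := hLp _ (hmem j').
  have e := pts_sep h1 h2; rewrite -(nth_uniq (mkpt m (fun=> 0) : {classic pt K m}) (s := L)) ?hL ?filter_uniq ?pts_uniq //.
  by apply/eqP/e/pall2P => i hi; have /inPn_vge := hcong (Ordinal hi).
move=> x hx hQx.
have hx' : pint (ofun x).
  apply/pallP => i hi; have e : nthpt (ofun x) i = x (Ordinal hi) := congr1 (fun f : 'I_m -> K => f (Ordinal hi)) (ofunK x).
  rewrite e.
  by have /inPn_vge := hx (Ordinal hi).
have [y hy hxy] := pts_cover n hx'.
have hyL : y \in L.
  rewrite mem_filter hy andbT; apply/asboolP; apply: (hQ _ _ hx' (pts_int hy) hxy).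
  by rewrite ofunK.
have hi : (index y L < c)%N by rewrite -hL index_mem.
exists (Ordinal hi) => i; rewrite /= nth_index //; apply/inPn_vge.
have /pall2P h := hxy; have := h i (ltn_ord i).
by have -> : nthpt (ofun x) i = x i := congr1 (fun f : 'I_m -> K => f i) (ofunK x).
Qed.

Lemma qresE : qres v = size ds.
Proof.
rewrite /qres ncls_cnt // cnt_total // mulnn expn1; by rewrite ?exp1n ?expn1.
Qed.

End Classes.

Section Polynomials.
Variable K : fieldType.

Fixpoint gX k (i : nat) : RI K k :=
  match k return RI K k with
  | 0%N => 0
  | k'.+1 => if i == k' then 'X : {poly RI K k'} else (@gX k' i)%:P
  end.

Fixpoint gC k (c : K) : RI K k :=
  match k return RI K k with 0%N => c | k'.+1 => (@gC k' c)%:P end.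

Lemma evk_gX (F : fieldType) (io : {rmorphism K -> F}) k (x : pt F k) i : (i < k)%N ->
  evk io x (gX k i) = nthpt x i.
Proof.
elim: k x => // k IH x; rewrite ltnS leq_eqVlt [gX _ _]/= [nthpt _ _]/=.
by case: eqP => [_ _|_] /=; [exact: evkX|move=> hi; rewrite -(IH x.1 hi); exact: evkC].
Qed.

Lemma evk_gC (F : fieldType) (io : {rmorphism K -> F}) k (x : pt F k) c : evk io x (gC k c) = io c.
Proof. by elim: k x => // k IH x; rewrite -(IH x.1); exact: evkC. Qed.

Lemma meval_map (K0 F : fieldType) (h : {rmorphism K0 -> F}) m (f : mpoly.mpoly m K0) (x : 'I_m -> F) :
  mpoly.meval x (mpoly.map_mpoly h f) =
  \sum_(mu <- mpoly.msupp f) h (mpoly.mcoeff mu f) * \prod_i x i ^+ mpoly.fun_of_multinom mu i.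
Proof.
rewrite mpoly.mevalE (perm_big _ (mpoly.msupp_map_mpoly f (fmorph_inj h))).
by apply: eq_bigr => mu _; rewrite mpoly.mcoeff_map_mpoly.
Qed.

(** One element [g] serves every extension [F] of [K], so the systems over [K] and over [L] are
    evaluations of the same polynomials. *)
Lemma mpoly_RI (K0 : fieldType) (i0 : {rmorphism K0 -> K}) m (f : mpoly.mpoly m K0) k (s : nat -> nat) :
  (forall i, (i < m)%N -> (s i < k)%N) ->
  exists g : RI K k, forall (F : fieldType) (io : {rmorphism K -> F}) (z : pt F k),
    evk io z g = mpoly.meval (fun i : 'I_m => nthpt z (s i)) (mpoly.map_mpoly (io \o i0) f).
Proof.
move=> hs; exists (\sum_(mu <- mpoly.msupp f) gC k (i0 (mpoly.mcoeff mu f)) *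
   \prod_(i < m) gX k (s i) ^+ mpoly.fun_of_multinom mu i) => F io z.
rewrite meval_map rmorph_sum; apply: eq_bigr => mu _.
rewrite rmorphM evk_gC rmorph_prod; congr (_ * _); apply: eq_bigr => i _.
by rewrite rmorphXn evk_gX // hs.
Qed.

Lemma meval_cong (v : K -> int) (hv : is_padic_val v) m (p : mpoly.mpoly m K) n (x y : pt K m) :
  (forall mu, vge v 0 (mpoly.mcoeff mu p)) ->
  pall (fun x => vge v 0 x) x -> pall (fun x => vge v 0 x) y ->
  pall2 (fun x y => vge v n%:Z (x - y)) x y ->
  vge v n%:Z (mpoly.meval (tofun x) p - mpoly.meval (tofun y) p).
Proof.
move=> hp /pallP hx /pallP hy /pall2P hxy.
pose Q (a b : K) := [/\ vge v 0 a, vge v 0 b & vge v n%:Z (a - b)].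
have QM a b a' b' : Q a b -> Q a' b' -> Q (a * a') (b * b').
  move=> [h1 h2 h3] [h1' h2' h3']; split; try exact: vgeM0.
  have -> : a * a' - b * b' = a * (a' - b') + b' * (a - b) by ring.
  by apply: (vgeD hv); apply: (vgeM0 hv).
have Q1 c : vge v 0 c -> Q c c by move=> hc; split=> //; rewrite subrr vge0.
suff [] : Q (mpoly.meval (tofun x) p) (mpoly.meval (tofun y) p) by [].
rewrite !mpoly.mevalE; apply: (big_ind2 Q) => [|a b a' b' [h1 h2 h3] [h1' h2' h3']|mu _].
- by apply: Q1; apply: vge0.
- split; try exact: (vgeD hv).
  have -> : a + a' - (b + b') = (a - b) + (a' - b') by ring.
  exact: (vgeD hv).
apply: (QM); first exact: Q1.
apply: (big_ind2 Q) => [||i _]; [by apply: Q1; apply: (vge1 hv)|exact: (QM)|].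
elim: (mpoly.fun_of_multinom mu i) => [|d IH]; first by apply: Q1; apply: (vge1 hv).
rewrite !exprS; apply: QM => //; split; [exact: hx|exact: hy|exact: hxy].
Qed.

Definition XT (v : K -> int) m r (f : 'I_r -> mpoly.mpoly m K) n (x : pt K m) :=
  forall j, inPn v n (mpoly.meval (tofun x) (f j)).

Definition XS (v : K -> int) m r (f : 'I_r -> mpoly.mpoly m K) n (x : pt K m) :=
  exists y : 'I_m -> K, (forall i, intg v (y i)) /\
    (forall j, mpoly.meval y (f j) = 0) /\ congr v n (tofun x) y.

Section Invariance.
Variables (v : K -> int) (m r : nat) (f : 'I_r -> mpoly.mpoly m K).
Hypothesis hv : is_padic_val v.
Local Notation pint := (pall (fun x : K => vge v 0 x)).
Local Notation pcong n := (pall2 (fun x y : K => vge v n%:Z (x - y))).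

Lemma XT_inv n x y : (forall j mu, intg v (mpoly.mcoeff mu (f j))) ->
  pint x -> pint y -> pcong n x y -> XT v f n x -> XT v f n y.
Proof.
move=> hf hx hy hxy h j; apply/inPn_vge; have /inPn_vge h1 := h j.
have h2 : vge v n%:Z (mpoly.meval (tofun x) (f j) - mpoly.meval (tofun y) (f j)).
  by apply: meval_cong => // mu; have /inPn_vge := hf j mu.
by have := vgeB hv h1 h2; rewrite opprB addrC subrK.
Qed.

Lemma XS_inv n x y : pint x -> pint y -> pcong n x y -> XS v f n x -> XS v f n y.
Proof.
move=> hx hy /pall2P hxy [z [h1 [h2 h3]]]; exists z; split=> //; split=> // i.
apply/inPn_vge; have /inPn_vge h4 := h3 i; have h5 := hxy i (ltn_ord i).
have -> : tofun y i - z i = (tofun x i - z i) - (nthpt x i - nthpt y i) by rewrite /tofun; ring.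
exact: vgeB.
Qed.

Variables (pi : K) (ds : seq K).
Hypotheses (pi0 : pi != 0) (vpi : v pi = 1) (hds : is_digits v ds).

Lemma Ntilde_cnt n : (forall j mu, intg v (mpoly.mcoeff mu (f j))) ->
  Ntilde v f n = Counting.cnt pi ds n (XT v f n).
Proof. by move=> hf; apply: ncls_cnt => // x y hx hy hxy; apply: XT_inv. Qed.

Lemma Nserre_cnt n : Nserre v f n = Counting.cnt pi ds n (XS v f n).
Proof. by apply: ncls_cnt => // x y hx hy hxy; apply: XS_inv. Qed.

End Invariance.
End Polynomials.

Lemma ratl_geom (R : fieldType) (w : R) a : ratl a -> ratl (fun n => w ^+ n * a n).
Proof.
move=> [B [A [h0 h]]].
pose B' := \poly_(k < size B) (B`_k * w ^+ k); pose A' := \poly_(k < size A) (A`_k * w ^+ k).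
have co (p : {poly R}) n : (\poly_(k < size p) (p`_k * w ^+ k))`_n = p`_n * w ^+ n.
  by rewrite coef_poly; case: ltnP => // hn; rewrite nth_default // mul0r.
exists B', A'; split; first by rewrite horner_coef0 co mulr1 -horner_coef0.
move=> n; rewrite co -h /conv mulr_suml; apply: eq_bigr => k _.
have e : w ^+ n = w ^+ k * w ^+ (n - k) by rewrite -exprD subnKC // -ltnS.
by rewrite co e; ring.
Qed.

(** * Ramification, and both series reduced to one comparison *)

Section Final.
Variables (K L : fieldType) (vK : K -> int) (vL : L -> int) (io : {rmorphism K -> L}).
Hypotheses (hK : is_padic_val vK) (hL : is_padic_val vL).
Hypothesis hio : forall x : K, intg vK x <-> intg vL (io x).
Local Notation vge := Valuation.vge.

(** Integral elements correspond on both sides, so units go to units; writing [a] as a unit times a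
    power of a uniformizer leaves the valuation of the image of the uniformizer as [e]. *)
Lemma ramification : exists2 e : nat, (0 < e)%N & forall a, a != 0 -> vL (io a) = e%:Z * vK a.
Proof.
have [pi [pi0 vpi]] := pv_unif hK.
have hv a : a != 0 -> (0 <= vK a) = (0 <= vL (io a)).
  move=> a0; have h := hio a; apply/idP/idP => h0.
    by case: (proj1 h (or_intror h0)) => // /eqP; rewrite fmorph_eq0 (negbTE a0).
  by case: (proj2 h (or_intror h0)) => // /eqP; rewrite (negbTE a0).
have unit a : a != 0 -> vK a = 0 -> vL (io a) = 0.
  move=> a0 va; have h1 : 0 <= vL (io a) by rewrite -hv // va.
  have : 0 <= vL (io a^-1) by rewrite -hv ?invr_eq0 // (vV hK a0) va oppr0.
  rewrite fmorphV (vV hL) ?fmorph_eq0 //; move: h1; move: (vL _) => z; clear; lia.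
have hpi : 0 < vL (io pi).
  have h1 : 0 <= vL (io pi) by rewrite -hv // vpi.
  have : ~~ (0 <= vL (io pi^-1)) by rewrite -hv ?invr_eq0 // (vV hK pi0) vpi.
  rewrite fmorphV (vV hL) ?fmorph_eq0 //; move: h1; move: (vL _) => z; clear; lia.
exists (absz (vL (io pi))) => [|a a0]; first by move: hpi; move: (vL _) => z; clear; lia.
have h := unit (a * pi ^ (- vK a)); rewrite mulf_neq0 ?expfz_neq0 // in h.
have := h isT; rewrite (vM hK) ?expfz_neq0 // (vXz hK) // vpi mul1r subrr => /(_ erefl).
rewrite rmorphM (vM hL) ?fmorph_eq0 ?expfz_neq0 // fmorphXz (vXz hL) ?fmorph_eq0 //.
have -> : (absz (vL (io pi)))%:Z = vL (io pi) by rewrite gtz0_abs.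
by move: (vL _) (vL _) (vK _) => x y z; clear; nia.
Qed.

(** The parameter [l] covers both normalisations: 1 for the Serre series, 0 for the other. The
    additional factor [q^(- n * l)] replaces [T] by a multiple of [T], which preserves
    rationality. *)
Lemma lambda_cnt (m l : nat) (piK : K) (piL : L) dsK dsL (P : (nat -> int) * pt L m -> Prop) (PK : nat -> pt K m -> Prop)
  (PL : nat -> pt L m -> Prop) :
  piK != 0 -> vK piK = 1 -> piL != 0 -> vL piL = 1 -> is_digits vK dsK -> is_digits vL dsL ->
  Dk vL io piL P -> (forall n x, P (fun=> n%:Z, x) <-> PL n x) ->
  (forall n x y, pall (fun x => vge vL 0 x) x -> pall (fun x => vge vL 0 x) y ->
     pall2 (fun x y => vge vL n%:Z (x - y)) x y -> PL n x -> PL n y) ->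
  (forall n x y, pall (fun x => vge vK 0 x) x -> pall (fun x => vge vK 0 x) y ->
     pall2 (fun x y => vge vK n%:Z (x - y)) x y -> PK n x -> PK n y) ->
  (forall e n x, (forall a, a != 0 -> vL (io a) = e%:Z * vK a) ->
     pall (fun x => vge vK 0 x) x -> PK n x -> PL (e * n)%N (emb io x)) ->
  (lambda_of (size dsL) (fun n => (Counting.cnt piL dsL n (PL n))%:R / ((size dsL)%:R : RR) ^+ (n * (l + m)))%R <=
   lambda_of (size dsK) (fun n => (Counting.cnt piK dsK n (PK n))%:R / ((size dsK)%:R : RR) ^+ (n * (l + m)))%R)%E.
Proof.
move=> pK0 vpK pL0 vpL hdK hdL hP hPL invL invK hemb.
have [e e0 hve] := ramification.
have ePL n : (fun x => P (fun=> n%:Z, x)) = PL n.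
  by apply/funext => x; apply/propext.
have invP n x y : pall (fun x => vge vL 0 x) x -> pall (fun x => vge vL 0 x) y ->
     pall2 (fun x y => vge vL n%:Z (x - y)) x y -> P (fun=> n%:Z, x) -> P (fun=> n%:Z, y).
  by move=> h1 h2 h3 /hPL h; apply/hPL; apply: invL h1 h2 h3 h.
have qK1 := digits_gt1 hK hdK; have qL1 := digits_gt1 hL hdL.
have qK0 : 0 < (size dsK)%:R :> RR by rewrite ltr0n ltnW.
have qL0 : 0 < (size dsL)%:R :> RR by rewrite ltr0n ltnW.
apply: (lambda_le (e := e)) => //.
- apply: (ratl_ext _ (ratl_geom ((size dsL)%:R ^- l : RR) (vol_ratl hL pL0 vpL hdL RR hP invP))) => n; rewrite ePL mulnDr exprD invfM mulrCA.
  by rewrite -exprVn -exprM mulnC exprVn.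
have [A [a0 [A0 hA]]] := vol_compare hL hK pL0 vpL pK0 vpK e0 hve hdL hdK RR hP invP invK
   (fun n x h1 h2 => proj2 (hPL _ _) (hemb e n x hve h1 h2)).
exists A, a0; split=> // n hn.
have c0 : (0 < Counting.cnt piK dsK n (PK n))%N.
  by rewrite lt0n; apply: contraNneq hn => ->; rewrite mul0r.
have [t [h1 h2]] := hA n c0; rewrite ePL in h1.
(* Over [L] the factor is evaluated at index [e * n], over [K] it is raised to the power [e]; both
   amount to [e * n * l] in the exponent. *)
exists (t + e * n * l)%N; split.
  rewrite mulnDr !exprD !invfM mulrCA [leLHS]mulrC ler_pM2l ?invr_gt0 ?exprn_gt0 //; exact: h1.
rewrite mulnDr !exprD !invfM mulrCA exprMn !mulrA [leLHS]mulrC.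
have -> : (size dsK)%:R ^- (n * l) ^+ e = (size dsK)%:R ^- (e * n * l) :> RR.
  by rewrite exprVn -exprM [(n * l * e)%N]mulnC mulnA.
by rewrite ler_pM2r ?invr_gt0 ?exprn_gt0.
Qed.

End Final.

(** * Definability of the two families and their passage from [K] to [L] *)

Section Definability.
Variables (K F : fieldType) (v : F -> int) (io : {rmorphism K -> F}) (pi : F).
Hypotheses (hv : is_padic_val v) (pi0 : pi != 0) (vpi : v pi = 1).
Local Notation env := (nat -> int).

Lemma vge_dfn k (t : env * pt F k -> int) (g : RI K k) : dlin v io t ->
  Dk v io pi (fun p : env * pt F k => vge v (t p) (evk io p.2 g)).
Proof.
move=> ht.
have h : Dk v io pi (fun p : env * pt F k => evk io p.2 g = 0 \/ t p <= v (evk io p.2 g)).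
  apply: dfn_or; first exact: (d_zero v pi (fun y : env * pt F k => @Tower.evk K F io k y.2 : RI K k -> F)).
  apply: dfn_le => //; exact: (lin_val v (fun y : env * pt F k => @Tower.evk K F io k y.2 : RI K k -> F)).
by apply: d_ext h => p; split=> [h|/vgeP //]; apply/vgeP.
Qed.

Lemma Dk_excat m k (Q : env * pt F (k + m) -> Prop) : Dk v io pi Q ->
  Dk v io pi (fun p : env * pt F m => exists y : pt F k, Q (p.1, catpt p.2 y)).
Proof.
elim: k Q => [|k IH] Q hQ.
  by apply: d_ext hQ => -[E x]; split=> [h|[[]]] //; exists tt.
apply: d_ext (IH _ (Dk_ex hv pi0 vpi hQ)) => -[E x]; split=> [[y [t h]]|[[y t] h]].
  by exists (y, t).
by exists y, t.
Qed.

Variables (m r : nat) (K0 : fieldType) (i0 : {rmorphism K0 -> K}) (f : 'I_r -> mpoly.mpoly m K0).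
Local Notation fF := (fun j => mpoly.map_mpoly (io \o i0) (f j)).

Lemma XT_dfn : exists2 P : env * pt F m -> Prop, Dk v io pi P & forall n x, P (fun=> n%:Z, x) <-> XT v fF n x.
Proof.
have /choice [G hG] : forall j, exists g : RI K m, forall (F' : fieldType) (io' : {rmorphism K -> F'}) (z : pt F' m),
    evk io' z g = mpoly.meval (fun i : 'I_m => nthpt z i) (mpoly.map_mpoly (io' \o i0) (f j)).
  by move=> j; apply: (mpoly_RI i0 (f j) (s := id)).
exists (fun p => forall j, j \in enum 'I_r -> vge v (p.1 0%N) (evk io p.2 (G j))).
  by apply: dfn_all => j _; apply: vge_dfn; apply: lin_var; exists 0%N.
move=> n x; split=> h j; last by move=> _; rewrite hG; apply/inPn_vge; apply: h.
by apply/inPn_vge; have := h j (mem_enum _ _); rewrite hG.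
Qed.

(** The exact solution [y] is appended as [m] further outermost coordinates, so its existence is a
    block of field quantifiers that [Dk_excat] removes. *)
Lemma XS_dfn : exists2 P : env * pt F m -> Prop, Dk v io pi P & forall n x, P (fun=> n%:Z, x) <-> XS v fF n x.
Proof.
have /choice [G hG] : forall j, exists g : RI K (m + m), forall (F' : fieldType) (io' : {rmorphism K -> F'}) (z : pt F' (m + m)),
    evk io' z g = mpoly.meval (fun i : 'I_m => nthpt z (i + m)) (mpoly.map_mpoly (io' \o i0) (f j)).
  by move=> j; apply: (mpoly_RI i0 (f j) (s := fun i => (i + m)%N)) => i; rewrite ltn_add2r.
pose Q (p : env * pt F (m + m)) := (forall i, i \in seq.iota 0 m -> vge v 0 (evk io p.2 (gX K (m + m) (i + m)))) /\
  ((forall j, j \in enum 'I_r -> evk io p.2 (G j) = 0) /\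
   forall i, i \in seq.iota 0 m -> vge v (p.1 0%N) (evk io p.2 (gX K (m + m) i - gX K (m + m) (i + m)))).
have hQ : Dk v io pi Q.
  apply: d_and; first by apply: dfn_all => i _; apply: vge_dfn; apply: lin_cst.
  apply: d_and; last by apply: dfn_all => i _; apply: vge_dfn; apply: lin_var; exists 0%N.
  by apply: dfn_all => j _; apply: (d_zero v pi (fun y : env * pt F (m + m) => @Tower.evk K F io (m + m) y.2 : RI K (m + m) -> F)).
exists (fun p => exists y : pt F m, Q (p.1, catpt p.2 y)); first exact: Dk_excat.
move=> n x.
have nr (y : pt F m) (i : 'I_m) : nthpt (catpt x y) (i + m) = nthpt y i.
  by case: (nth_catr x y i) => //; rewrite leqNgt ltn_ord.
have eG (y : pt F m) j : evk io (catpt x y) (G j) = mpoly.meval (tofun y) (fF j).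
  by rewrite hG; congr mpoly.meval; apply/funext => i; rewrite nr.
have hi (i : 'I_m) : nat_of_ord i \in seq.iota 0 m by rewrite mem_iota /=.
have lt1 (i : 'I_m) : (i + m < m + m)%N by rewrite ltn_add2r.
have lt2 (i : 'I_m) : (i < m + m)%N by apply: leq_trans (ltn_ord i) (leq_addr _ _).
split=> [[y [h1 [h2 h3]]]|[y [h1 [h2 h3]]]].
  exists (tofun y); split=> [i|].
    by apply/inPn_vge; have := h1 i (hi i); rewrite evk_gX // nr.
  split=> [j|i]; first by rewrite -eG; apply: h2; rewrite mem_enum.
  by apply/inPn_vge; have := h3 i (hi i); rewrite rmorphB !evk_gX // nr nth_catl.
exists (ofun y); rewrite /Q /=.
have yK (i : 'I_m) : nthpt (ofun y) i = y i := congr1 (fun h : 'I_m -> F => h i) (ofunK y).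
split=> [i|]; first rewrite mem_iota /= add0n => him.
  by rewrite (evk_gX io _ (lt1 (Ordinal him))) (nr _ (Ordinal him)) yK; apply/inPn_vge; apply: h1.
split=> [j _|i]; first by rewrite eG ofunK; apply: h2.
rewrite mem_iota /= add0n => him; rewrite rmorphB.
rewrite (evk_gX io _ (lt1 (Ordinal him))) (evk_gX io _ (lt2 (Ordinal him))) (nr _ (Ordinal him)) nth_catl // yK.
by apply/inPn_vge; apply: (h3 (Ordinal him)).
Qed.

End Definability.

Section Embedding.
Variables (K L : fieldType) (vK : K -> int) (vL : L -> int) (io : {rmorphism K -> L}) (e : nat).
Hypothesis hve : forall a, a != 0 -> vL (io a) = e%:Z * vK a.
Variables (m r : nat) (K0 : fieldType) (i0 : {rmorphism K0 -> K}) (f : 'I_r -> mpoly.mpoly m K0).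
Local Notation fK := (fun j => mpoly.map_mpoly i0 (f j)).
Local Notation fL := (fun j => mpoly.map_mpoly (io \o i0) (f j)).

Lemma vge_io (n : nat) a : vge vK n%:Z a -> vge vL (e * n)%N%:Z (io a).
Proof.
have [->|a0] := eqVneq a 0; first by rewrite rmorph0 !vge0.
by rewrite !vgeE ?fmorph_eq0 // hve // PoszM => h; apply: ler_wpM2l.
Qed.

Lemma nth_emb k (x : pt K k) i : nthpt (emb io x) i = io (nthpt x i).
Proof. by elim: k x => [|k IH] x /=; [rewrite rmorph0|case: ifP]. Qed.

Lemma meval_emb (y : pt K m) j : mpoly.meval (tofun (emb io y)) (fL j) = io (mpoly.meval (tofun y) (fK j)).
Proof.
rewrite !meval_map rmorph_sum; apply: eq_bigr => mu _; rewrite rmorphM rmorph_prod.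
by congr (_ * _); apply: eq_bigr => i _; rewrite rmorphXn /tofun nth_emb.
Qed.

Lemma XT_emb n (x : pt K m) : XT vK fK n x -> XT vL fL (e * n) (emb io x).
Proof. by move=> h j; rewrite meval_emb; apply/inPn_vge; apply: vge_io; apply/inPn_vge. Qed.

Lemma XS_emb n (x : pt K m) : XS vK fK n x -> XS vL fL (e * n) (emb io x).
Proof.
move=> [y [h1 [h2 h3]]]; exists (tofun (emb io (ofun y))).
have ye (i : 'I_m) : tofun (emb io (ofun y)) i = io (y i).
  by rewrite /tofun nth_emb; congr (io _); have := congr1 (fun h : 'I_m -> K => h i) (ofunK y).
split=> [i|]; first by rewrite ye; apply/inPn_vge; rewrite -[0%N](muln0 e); apply: vge_io; apply/inPn_vge; apply: h1.
split=> [j|i]; first by rewrite meval_emb ofunK h2 rmorph0.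
rewrite ye /tofun nth_emb -rmorphB; apply/inPn_vge; apply: vge_io; apply/inPn_vge; exact: h3.
Qed.

End Embedding.

Theorem theorem7p13
    (K0 K L : fieldType) (v0 : K0 -> int) (vK : K -> int) (vL : L -> int)
    (h0 : is_padic_val v0) (hK : is_padic_val vK) (hL : is_padic_val vL)
    (i0 : {rmorphism K0 -> K}) (i1 : {rmorphism K -> L})
    (e0 : fin_ext v0 vK i0) (e1 : fin_ext vK vL i1)
    (m r : nat) (f : 'I_r -> mpoly.mpoly m K0)
    (hf : forall (j : 'I_r) (mu : mpoly.multinom m), intg v0 (mpoly.mcoeff mu (f j))) :
  let fK := fun j => mpoly.map_mpoly i0 (f j) in
  let fL := fun j => mpoly.map_mpoly (i1 \o i0) (f j) in
  (lambdaP vL fL <= lambdaP vK fK)%E /\ (lambdaPt vL fL <= lambdaPt vK fK)%E.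
Proof.
move=> fK fL.
have [_ hi0] := e0; have [_ hi1] := e1.
have [piK [pK0 vpK]] := pv_unif hK; have [piL [pL0 vpL]] := pv_unif hL.
have [dsK hdK] := digits_ex hK; have [dsL hdL] := digits_ex hL.
have cK j mu : intg vK (mpoly.mcoeff mu (fK j)) by rewrite mpoly.mcoeff_map_mpoly; apply/hi0.
have cL j mu : intg vL (mpoly.mcoeff mu (fL j)) by rewrite mpoly.mcoeff_map_mpoly; apply/hi1/hi0.
have qK := qresE hK pK0 vpK hdK; have qL := qresE hL pL0 vpL hdL.
split.
  have [P hP eP] := XS_dfn i1 hL pL0 vpL i0 f.
  have := @lambda_cnt K L vK vL i1 hK hL hi1 m 1 piK piL dsK dsL P (XS vK fK) (XS vL fL) pK0 vpK pL0 vpL hdK hdL hP eP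
    (fun n x y => @XS_inv L vL m r fL hL n x y) (fun n x y => @XS_inv K vK m r fK hK n x y)
    (fun e n x hve _ => @XS_emb K L vK vL i1 e hve m r K0 i0 f n x).
  rewrite /lambdaP qK qL add1n.
  have -> : (fun n => (Counting.cnt piL dsL n (XS vL fL n))%:R / ((size dsL)%:R : RR) ^+ (n * m.+1)) =
            (fun n => (Nserre vL fL n)%:R / ((size dsL)%:R : RR) ^+ (n * m.+1)).
    by apply/funext => n; rewrite (Nserre_cnt fL hL pL0 vpL hdL).
  have -> // : (fun n => (Counting.cnt piK dsK n (XS vK fK n))%:R / ((size dsK)%:R : RR) ^+ (n * m.+1)) =
            (fun n => (Nserre vK fK n)%:R / ((size dsK)%:R : RR) ^+ (n * m.+1)).
  by apply/funext => n; rewrite (Nserre_cnt fK hK pK0 vpK hdK).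
have [P hP eP] := XT_dfn vL i1 piL i0 f.
have := @lambda_cnt K L vK vL i1 hK hL hi1 m 0 piK piL dsK dsL P (XT vK fK) (XT vL fL) pK0 vpK pL0 vpL hdK hdL hP eP
  (fun n x y => @XT_inv L vL m r fL hL n x y cL) (fun n x y => @XT_inv K vK m r fK hK n x y cK)
  (fun e n x hve _ => @XT_emb K L vK vL i1 e hve m r K0 i0 f n x).
rewrite /lambdaPt qK qL add0n.
have -> : (fun n => (Counting.cnt piL dsL n (XT vL fL n))%:R / ((size dsL)%:R : RR) ^+ (n * m)) =
          (fun n => (Ntilde vL fL n)%:R / ((size dsL)%:R : RR) ^+ (n * m)).
  by apply/funext => n; rewrite (Ntilde_cnt hL pL0 vpL hdL).
have -> // : (fun n => (Counting.cnt piK dsK n (XT vK fK n))%:R / ((size dsK)%:R : RR) ^+ (n * m)) =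
          (fun n => (Ntilde vK fK n)%:R / ((size dsK)%:R : RR) ^+ (n * m)).
by apply/funext => n; rewrite (Ntilde_cnt hK pK0 vpK hdK).
Qed.
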